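(* Let $p_1,p_2$ be primes with $p_1\equiv p_2\equiv 1\pmod 4$ such that at least two of $\left(\frac{p_1}{p_2}\right),\left(\frac{2}{p_1}\right),\left(\frac{2}{p_2}\right)$ equal $-1$. Let $k=\mathbb{Q}(\sqrt{2p_1p_2},i)$, $\mathbb{K}_1=k(\sqrt{p_1})=\mathbb{Q}(\sqrt{p_1},\sqrt{2p_2},i)$ and $\mathbb{K}_2=k(\sqrt{p_2})=\mathbb{Q}(\sqrt{p_2},\sqrt{2p_1},i)$. Write $p_1=e^2+(2f)^2$, $\pi_1=e+2if$, $\pi_2=e-2if$, and let $\mathcal{H}_0,\mathcal{H}_1,\mathcal{H}_2$ be the prime ideals of $k$ above $1+i,\pi_1,\pi_2$. Then exactly four classes of $\mathbf{C}_{k,2}$ capitulate in $\mathbb{K}_1$ and exactly four in $\mathbb{K}_2$; more precisely $\ker j_{\mathbb{K}_1}=\langle[\mathcal{H}_1],[\mathcal{H}_2]\rangle$ and $\ker j_{\mathbb{K}_2}=\langle[\mathcal{H}_0\mathcal{H}_1],[\mathcal{H}_0\mathcal{H}_2]\rangle$.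
   Context: $\mathbf{C}_{k,2}$ is the $2$-Sylow subgroup of the class group of $k$ (under these hypotheses it is of type $(2,2,2)$). For an unramified extension $K/k$, $j_K:\mathbf{C}_{k,2}\to\mathbf{C}_{K,2}$ is the homomorphism induced by extension of ideals $\mathfrak a\mapsto\mathfrak a\mathcal O_K$; a class capitulates in $K$ if it lies in $\ker j_K$. *)

(* Defs.v *)
From mathcomp Require Import all_boot all_order all_algebra all_field.
Set Implicit Arguments. Unset Strict Implicit. Unset Printing Implicit Defensive.
Import GRing.Theory Num.Theory.
Local Open Scope ring_scope.

(* Multiquadratic fields Q(g_1,...,g_n) where each g_j^2 is rational:
   their elements are the Q-linear combinations of products of subsets of
   the generators. *)
Fixpoint mq_basis (gs : seq algC) : seq algC :=
  match gs with
  | [::] => [:: 1]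
  | g :: gs' => mq_basis gs' ++ map ( *%R g) (mq_basis gs')
  end.

Definition mq_field (gs : seq algC) (x : algC) : Prop :=
  exists c : seq rat,
    x = \sum_(j < size (mq_basis gs)) ratr c`_j * (mq_basis gs)`_j.

Definition nfield := algC -> Prop.

Definition Oint (F : nfield) (x : algC) : Prop := F x /\ x \in Aint.

Definition ideal (F : nfield) (I : algC -> Prop) : Prop :=
  [/\ forall x, I x -> Oint F x,
      I 0,
      forall x y, I x -> I y -> I (x + y),
      forall a x, Oint F a -> I x -> I (a * x)
    & exists x, I x /\ x != 0].

Definition prime_ideal (F : nfield) (P : algC -> Prop) : Prop :=
  [/\ ideal F P, ~ P 1 & forall x y, Oint F x -> Oint F y -> P (x * y) -> P x \/ P y].

Definition idealM (I J : algC -> Prop) (x : algC) : Prop :=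
  exists s : seq (algC * algC),
    (forall u, u \in s -> I u.1 /\ J u.2) /\ x = \sum_(u <- s) u.1 * u.2.

Fixpoint idealX (F : nfield) (I : algC -> Prop) (n : nat) : algC -> Prop :=
  match n with
  | 0 => Oint F
  | n'.+1 => idealM (idealX F I n') I
  end.

Definition ideal_ext (K : nfield) (I : algC -> Prop) : algC -> Prop :=
  idealM I (Oint K).

Definition principal (F : nfield) (I : algC -> Prop) : Prop :=
  exists al, F al /\ forall x, I x <-> exists o, Oint F o /\ x = al * o.

Definition ideal_equiv (F : nfield) (I J : algC -> Prop) : Prop :=
  exists al be, [/\ F al, F be, al != 0, be != 0 &
    forall x, (exists y, I y /\ x = al * y) <-> (exists y, J y /\ x = be * y)].

(* [I] lies in the 2-Sylow subgroup C_{F,2}: its order is a power of 2. *)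
Definition in_2class (F : nfield) (I : algC -> Prop) : Prop :=
  exists e, principal F (idealX F I (2 ^ e)).

(* [I] lies in the subgroup generated by [H] and [H']. *)
Definition in_gen2 (F : nfield) (H H' I : algC -> Prop) : Prop :=
  exists m1 n1 m2 n2 : nat,
    ideal_equiv F (idealM (idealM I (idealX F H m1)) (idealX F H' n1))
                  (idealM (idealX F H m2) (idealX F H' n2)).

Definition capitulates (k K : nfield) (I : algC -> Prop) : Prop :=
  in_2class k I /\ principal K (ideal_ext K I).

Definition exactly_four_capitulate (k K : nfield) : Prop :=
  exists a : 'I_4 -> (algC -> Prop),
    [/\ forall i, ideal k (a i) /\ capitulates k K (a i),
        forall i j, ideal_equiv k (a i) (a j) -> i = j
      & forall I, ideal k I -> capitulates k K I ->
          exists i, ideal_equiv k I (a i)].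

Definition qnr (a p : nat) : bool :=
  [&& ~~ (p %| a)%N & ~~ [exists x : 'I_p, (x ^ 2 %% p == a %% p)%N]].

(* Main.v *)
(* Let K be one of the two extensions and k = Q(sqrt(2 p1 p2), i). If I O_K is generated by al, then
   I^2 is generated by the norm of al, so only classes of order at most two capitulate. A descent on
   the ideals of k that are invariant under Gal(k/Q(i)) shows that those classes are represented by
   products of the prime ideals above the Gaussian primes 1 + i, pi1, pi2 and those above p2, and the
   unit of norm -1 of Q(sqrt(2 p1 p2)) expresses the latter through the former.

   An ideal with square (c) becomes principal in K if and only if c is a square in K up to a unit.
   For a unit e = x + y sqrt n of norm -1 one has (e + i)^2 = 2 e (x + i), and x + i is, up to a unit
   and a square of Z[i], a product of primes dividing n or 2. For n = p1 this makes pi1 and pi2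
   squares up to units in K_1; for n = p2 and n = 2 p1 p2 it does the same for (1 + i) pi1 and
   (1 + i) pi2 in K_2. Nothing more capitulates because 1 + i is not a square up to a unit in K:
   after multiplication by 1, i, 1 - i or 1 + i a square root would be real, and its norm to
   Q(sqrt p1), resp. Q(sqrt p2), would have up to a rational factor a square of the form 2 e with e
   a unit, which is impossible modulo 4.
   The ideals obtained stay non-principal in k because p1 and 2 p1 are not, up to sign, norms from k
   to Q(i), by the residue conditions at p1 and p2 and quadratic reciprocity. *)
From HB Require Import structures.
Require Import Defs.
From Stdlib Require Import Classical FunctionalExtensionality PropExtensionality.
From mathcomp Require Import all_boot all_order all_fingroup all_algebra all_solvable all_field.
From mathcomp Require Import ring zify.
Set Implicit Arguments. Unset Strict Implicit. Unset Printing Implicit Defensive.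
Import Order.TTheory GRing.Theory Num.Theory.
Local Open Scope ring_scope.

(** * Negative Pell equations *)

(** Neither class numbers nor unit groups are computed. Each ideal that matters has a square (q)
    with q in Z[i]; as rings of integers are integrally closed, its principality in k or K is the
    question whether q is a square up to a unit, asked for the eight products of 1 + i, [pi] and
    [pi^*]. The obstacle in the descent is that a principal I^2 only gives conj(I) = be I with a
    unit of Z[i] as the norm of be. Hilbert 90 yields an invariant multiple of I when this norm is
    1. The norm -1 is repaired by the factor i, which has norm i^2 over Q(i), and the norms i and -i
    are impossible because they would make 2 a residue modulo both p1 and p2. A norm C prime to p1
    must be a residue modulo p1. For C divisible by p1 one passes to - D / C instead, and comparing
    the two conditions requires reciprocity. The same non-norm statements produce the unit of norm
    -1: a least Pell solution splits D as m m' with m' a norm, and only m' = D survives. Galois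
    automorphisms are taken on all of [algC], so that they preserve [Aint] and every identity. *)

(* Conway's river for x^2 - D y^2: a basis (x,y), (z,w) of Z^2 on which the form takes values
   of opposite signs is moved one step by replacing one of its vectors by their sum. *)
Record pell_basis (D : int) (x y z w : int) : Prop := {
  pb_pos : [/\ 0 <= x, 0 <= y, 0 <= z & 0 <= w];
  pb_det : x * w - z * y = 1;
  pb_gt0 : 0 < x ^+ 2 - D * y ^+ 2;
  pb_lt0 : z ^+ 2 - D * w ^+ 2 < 0 }.

Definition river_step (D : int) (s : int * int * int * int) : int * int * int * int :=
  let: (x, y, z, w) := s in
  if 0 < (x + z) ^+ 2 - D * (y + w) ^+ 2 then (x + z, y + w, z, w)
  else (x, y, x + z, y + w).

Definition river (D : int) (n : nat) := iter n (river_step D) (1, 0, 0, 1).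

Lemma inord_absz_inj (n : nat) (a b : int) : 0 <= a <= n -> 0 <= b <= n ->
  inord (absz a) = inord (absz b) :> 'I_n.+1 -> a = b.
Proof. by move=> ha hb /(congr1 val); rewrite /= !inordK; lia. Qed.

Lemma mulz_eq1_pos (t v : int) : 0 < t -> t * v = 1 -> t = 1.
Proof.
move=> t0 e; have v0 : 0 < v by rewrite -(pmulr_rgt0 _ t0) e.
by nia.
Qed.

Section Pell.
Variables (D : nat).
Hypothesis nonsquare : forall a b : int, a ^+ 2 = D%:Z * b ^+ 2 -> b = 0.

Lemma pell_D_gt0 : 0 < D%:Z.
Proof.
rewrite lt0r lez_nat leq0n andbT; apply/eqP => D0.
by have := nonsquare (a := 0) (b := 1); rewrite D0 mul0r expr0n => /(_ erefl).
Qed.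

Lemma river_basis n x y z w : river D n = (x, y, z, w) -> pell_basis D x y z w.
Proof.
elim: n => [|n IHn] in x y z w *.
  by rewrite /river /= => -[<- <- <- <-]; have := pell_D_gt0; split=> //; lia.
rewrite /river iterS -/(river D n); case: (river D n) IHn => [[[x' y'] z'] w'] IHn.
have [[x0 y0 z0 w0] det gt0 lt0] := IHn _ _ _ _ erefl.
rewrite /=; case: ifP => [v|/negbT v] [<- <- <- <-]; split=> //.
- by split=> //; lia.
- by lia.
- by split=> //; lia.
- by lia.
- have v0 : (x' + z') ^+ 2 - D%:Z * (y' + w') ^+ 2 != 0.
    by apply/eqP => /eqP; rewrite subr_eq0 => /eqP /nonsquare; nia.
  by rewrite lt_neqAle v0 leNgt.
Qed.

(** Since the entries keep growing, the river never returns to a basis; this is what prevents the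
    automorph of [pell_exists] from being trivial. *)
Lemma river_sum_mono m n x y z w x' y' z' w' : (m < n)%N ->
  river D m = (x, y, z, w) -> river D n = (x', y', z', w') ->
  x + y + z + w < x' + y' + z' + w'.
Proof.
move=> lt_mn; elim: n => // n IHn in lt_mn x' y' z' w' *.
move=> Dm; rewrite /river iterS -/(river D n).
case E : (river D n) => [[[x1 y1] z1] w1].
have [[x0 y0 z0 w0] det gt0 lt0] := river_basis E.
have : x + y + z + w <= x1 + y1 + z1 + w1.
  move: lt_mn; rewrite ltnS leq_eqVlt => /predU1P[emn|lt_mn].
    by move: E; rewrite -emn Dm => -[-> -> -> ->].
  by apply: ltW; apply: IHn.
by rewrite /=; case: ifP => _ le [<- <- <- <-]; nia.
Qed.

(** The Gram matrix of the form in a unimodular basis has determinant -D, and its diagonal entries a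
    and -c have opposite signs: b^2 + a c = D with a, c > 0 leaves only finitely many matrices. *)
Lemma river_gram_bound x y z w : pell_basis D x y z w ->
  [/\ 0 < x ^+ 2 - D%:Z * y ^+ 2 <= D, 0 < D%:Z * w ^+ 2 - z ^+ 2 <= D
    & - D%:Z <= x * z - D%:Z * y * w <= D].
Proof.
case=> _ det gt0 lt0.
have : (x * z - D%:Z * y * w) ^+ 2 + (x ^+ 2 - D%:Z * y ^+ 2) * (D%:Z * w ^+ 2 - z ^+ 2) = D.
  by transitivity (D%:Z * (x * w - z * y) ^+ 2); [ring | rewrite det; ring].
have : 0 < D%:Z * w ^+ 2 - z ^+ 2 by lia.
move: (x ^+ 2 - D%:Z * y ^+ 2) (D%:Z * w ^+ 2 - z ^+ 2) (x * z - _) gt0 => a c b a0 c0 e.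
by split; nia.
Qed.

Lemma river_gram_repeat : exists m n x y z w x' y' z' w',
  [/\ (m < n)%N, river D m = (x, y, z, w), river D n = (x', y', z', w'),
      x ^+ 2 - D%:Z * y ^+ 2 = x' ^+ 2 - D%:Z * y' ^+ 2
    & z ^+ 2 - D%:Z * w ^+ 2 = z' ^+ 2 - D%:Z * w' ^+ 2
   /\ x * z - D%:Z * y * w = x' * z' - D%:Z * y' * w'].
Proof.
pose T := ('I_D.+1 * 'I_D.+1 * 'I_(2 * D).+1)%type.
(* The mixed entry lies between -D and D; it is shifted by D to fit into an ordinal. *)
pose f (n : 'I_(#|{: T}|).+1) : T := let: (x, y, z, w) := river D n in
  (inord (absz (x ^+ 2 - D%:Z * y ^+ 2)%R), inord (absz (D%:Z * w ^+ 2 - z ^+ 2)%R),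
   inord (absz (x * z - D%:Z * y * w + D%:Z)%R)).
have /injectivePn[i [j ne_ij]] : ~~ injectiveb f.
  by apply/negP => /injectiveP/leq_card; rewrite card_ord ltnn.
wlog lt_ij : i j ne_ij / (i < j)%N.
  move=> H e; move: (ne_ij); rewrite -val_eqE neq_ltn => /orP[ij|ji].
    by apply: (H i j ne_ij ij e).
  by apply: (H j i _ ji (esym e)); rewrite eq_sym.
rewrite /f; case E : (river D i) => [[[x y] z] w]; case E' : (river D j) => [[[x' y'] z'] w'].
have := river_gram_bound (river_basis E); have := river_gram_bound (river_basis E').
move=> [/andP[a1 a1'] /andP[c1 c1'] b1] [/andP[a2 a2'] /andP[c2 c2'] b2] [] ea ec eb.
exists i, j, x, y, z, w, x', y', z', w'; split=> //.
  by apply: inord_absz_inj ea; rewrite ltW.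
split.
  have {}ec : D%:Z * w ^+ 2 - z ^+ 2 = D%:Z * w' ^+ 2 - z' ^+ 2.
    by apply: inord_absz_inj ec; rewrite ltW.
  by rewrite -[LHS]opprB ec opprB.
have shift (t : int) : - D%:Z <= t <= D -> 0 <= t + D%:Z <= (2 * D)%N by lia.
by apply: (addIr D%:Z); apply: inord_absz_inj eb; apply: shift.
Qed.

(** Two bases with the same Gram matrix are exchanged by an automorph of the form, and (X, Y) is the
    image of (1, 0) under it, hence of norm 1. *)
Lemma pell_exists : exists X Y : int, X ^+ 2 - D%:Z * Y ^+ 2 = 1 /\ Y != 0.
Proof.
have [m [n [x [y [z [w [x' [y' [z' [w' [lt_mn E E' ea [ec eb]]]]]]]]]]]] := river_gram_repeat.
have [[x0 y0 z0 w0] det gt0 lt0] := river_basis E.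
have [[x0' y0' z0' w0'] det' gt0' lt0'] := river_basis E'.
exists (x' * w - z' * y), (y' * w - w' * y); split.
  transitivity ((x' ^+ 2 - D%:Z * y' ^+ 2) * w ^+ 2 - 2 * (x' * z' - D%:Z * y' * w') * w * y
     + (z' ^+ 2 - D%:Z * w' ^+ 2) * y ^+ 2); first by ring.
  rewrite -ea -ec -eb; transitivity ((x * w - z * y) ^+ 2); first by ring.
  by rewrite det.
apply/eqP => Y0.
have {}Y0 : y' * w = w' * y by apply/eqP; rewrite -subr_eq0 Y0.
(* If Y = 0, the second coordinates of the new basis are t times the old ones. Then t divides the
   determinant 1, so t = 1 and both bases coincide, against [river_sum_mono]. *)
set t := x * w' - z * y'.
have Dy : y' = y * t.
  rewrite /t -[LHS]mul1r -det; transitivity (x * (y' * w) - z * y * y'); first by ring.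
  by rewrite Y0; ring.
have Dw : w' = w * t.
  rewrite /t -[LHS]mul1r -det; transitivity (x * w * w' - z * (w' * y)); first by ring.
  by rewrite -Y0; ring.
have w1 : 0 < w.
  by rewrite lt_def w0 andbT; apply: contraTneq lt0 => ->; rewrite -leNgt; nia.
have w1' : 0 < w'.
  by rewrite lt_def w0' andbT; apply: contraTneq lt0' => ->; rewrite -leNgt; nia.
have t0 : 0 < t by rewrite -(pmulr_rgt0 _ w1) -Dw.
have t1 : t = 1.
  have : t * (x' * w - z' * y) = 1 by rewrite -det' {1}Dw {1}Dy; ring.
  exact: mulz_eq1_pos.
move: Dy Dw; rewrite t1 !mulr1 => ey ew.
have ex : x' = x.
  by apply/eqP; rewrite -(@eqrXn2 _ 2) //; move: ea; rewrite ey => /addIr->.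
have ez : z' = z.
  by apply/eqP; rewrite -(@eqrXn2 _ 2) //; move: ec; rewrite ew => /addIr->.
have := river_sum_mono lt_mn E E'; rewrite ex ey ez ew; lia.
Qed.

End Pell.

(** * Legendre's splitting of a Pell solution; units of norm -1 for prime radicands *)

Section HalfPell.
Local Open Scope nat_scope.

(** The p-adic valuations of the two sides would have different parities. *)
Lemma prime_part_nonsquare (p m : nat) : prime p -> ~~ (p %| m) ->
  forall a b : int, (a ^+ 2 = (p * m)%N%:Z * b ^+ 2 -> b = 0)%R.
Proof.
move=> pr_p p'm a b e; apply/eqP; apply: contraT => b0.
have {e} : (absz a ^ 2 = p * m * absz b ^ 2)%N.
  by have := congr1 absz e; rewrite abszM !abszX.
have b1 : (0 < absz b)%N by rewrite absz_gt0.
have m1 : (0 < m)%N by rewrite lt0n; apply: contraNneq p'm => ->; rewrite dvdn0.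
move: (absz a) (absz b) b1 => c d d0 e.
have c0 : (0 < c)%N by case: c e (prime_gt0 pr_p) => // /esym/eqP; rewrite exp0n // !muln_eq0; lia.
have : odd (logn p (c ^ 2)) = odd (logn p (p * m * d ^ 2)) by rewrite e.
have p0 := prime_gt0 pr_p; have pm0 : (0 < p * m)%N by rewrite muln_gt0 p0.
have d20 : (0 < d ^ 2)%N by rewrite expn_gt0 d0.
rewrite (lognM p pm0 d20) (lognM p p0 m1) !lognX (logn_prime p pr_p) eqxx.
by rewrite (lognE p m) (negPf p'm) !andbF !mul2n !oddD !odd_double //.
Qed.

(** The root is gcd(a, v): its square is a gcd(a, v, b), and the last factor is 1. *)
Lemma coprime_mul_square (a b v : nat) : coprime a b -> (a * b = v ^ 2)%N -> exists c, a = (c ^ 2)%N.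
Proof.
move=> cop e; exists (gcdn a v).
rewrite -mulnn muln_gcdr !muln_gcdl (mulnn v) -e [v * a]mulnC.
by rewrite -gcdnA -!muln_gcdr (gcdnA v v) gcdnn gcdnCA (eqP cop) gcdn1 muln1.
Qed.

(** In the least solution write x = 2 u + 1 and y = 2 v. Then u (u + 1) = D v^2 with coprime
    factors, so u = m a^2 and u + 1 = m' b^2 with m m' = D. The case m' = 1 would read b^2 = D a^2 +
    1, a smaller solution since a divides v. *)
Lemma pell_half (D : nat) :
  (forall a b : int, (a ^+ 2 = D%:Z * b ^+ 2 -> b = 0)%R) ->
  (forall x y : nat, x ^ 2 = D * y ^ 2 + 1 -> ~~ odd y) ->
  exists m m' a b : nat, [/\ m * m' = D, m' * b ^ 2 = m * a ^ 2 + 1 & m' != 1].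
Proof.
move=> nsq ev; have D0 : 0 < D by have := pell_D_gt0 nsq.
(* The explicit bound on x makes [P] a boolean predicate, as [ex_minnP] requires. *)
pose P y := (0 < y) && [exists x : 'I_(D * y ^ 2 + 2), x ^ 2 == D * y ^ 2 + 1].
have Pmk x y : 0 < y -> x ^ 2 = D * y ^ 2 + 1 -> P y.
  move=> y0 e; rewrite /P y0; apply/existsP.
  have lt : x < D * y ^ 2 + 2 by nia.
  by exists (Ordinal lt); rewrite /= e.
have exP : exists y, P y.
  have [X [Y [e Y0]]] := pell_exists nsq; exists (absz Y); apply: (Pmk (absz X)).
    by rewrite absz_gt0.
  have : ((absz X ^ 2)%N%:Z = (D * absz Y ^ 2 + 1)%N%:Z)%R.
    by rewrite -abszX PoszD PoszM -abszX !gez0_abs ?sqr_ge0 //; lia.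
  by move/eqP; rewrite eqz_nat => /eqP.
case: (ex_minnP exP) => y /andP[y0 /existsP[[x /= _] /eqP e]] min_y.
have [v Dv] : exists v, y = v.*2 by exists y./2; rewrite even_halfK // (ev x y).
have [u Du] : exists u, x = u.*2.+1.
  exists x./2; rewrite -[LHS]odd_double_half; suff -> : odd x by [].
  have : odd (x ^ 2) by rewrite e addn1 oddS oddM oddX (negPf (ev _ _ e)) andbF.
  by rewrite oddX.
have euv : u * u.+1 = D * v ^ 2 by move: e; rewrite Du Dv -!mul2n; nia.
have v0 : 0 < v by case: v Dv y0 {euv} => // ->.
have u0 : 0 < u.
  case: u euv {Du} => // /esym/eqP; rewrite mul0n muln_eq0 expn_eq0; lia.
(* With m = gcd(u, D), the cofactor m' = D / m is prime to u / m and therefore divides u + 1. *)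
pose m := gcdn u D; have m0 : 0 < m by rewrite gcdn_gt0 u0.
have /dvdnP[u1 Du1] : m %| u by apply: dvdn_gcdl.
have /dvdnP[m' Dm'] : m %| D by apply: dvdn_gcdr.
have cop1 : coprime m' u1.
  by rewrite coprime_sym; rewrite /coprime -(eqn_pmul2r m0) muln_gcdl mul1n -Du1 -Dm'.
have e1 : u1 * u.+1 = m' * v ^ 2.
  by apply/eqP; rewrite -(eqn_pmul2r m0); apply/eqP; move: euv; rewrite {1}Du1 Dm'; nia.
have /dvdnP[s Ds] : m' %| u.+1 by rewrite -(Gauss_dvdr _ cop1) e1 dvdn_mulr.
have m'0 : 0 < m' by case: (m') Dm' D0 => // ->.
have e2 : u1 * s = v ^ 2.
  by apply/eqP; rewrite -(eqn_pmul2l m'0); apply/eqP; move: e1; rewrite Ds; nia.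
have cop2 : coprime u1 s.
  have : coprime u u.+1 by apply: coprimenS.
  by rewrite {1}Du1 Ds coprimeMl coprimeMr => /andP[/andP[->]].
have [a Da] := coprime_mul_square cop2 e2.
have [b Db] : exists b, s = b ^ 2.
  by apply: (@coprime_mul_square s u1 v); [rewrite coprime_sym | rewrite mulnC].
exists m, m', a, b; split; first by rewrite mulnC.
  by rewrite -Db -Da; move: Ds Du1; nia.
apply/eqP => m'1.
have Pa : P a.
  apply: (Pmk b); first by case: (a) Da Du1 u0 => // ->; rewrite mul0n => ->.
  by move: Ds; rewrite m'1 muln1 -Db => <-; rewrite Du1 Dm' m'1 mul1n Da; lia.
have := min_y a Pa; have : v = a * b.
  by apply/eqP; rewrite -(eqn_exp2r _ _ (isT : 0 < 2)) expnMn -Da -Db e2.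
have b0 : 0 < b by case: (b) Db Ds => // ->; rewrite mul0n.
move=> Dvab; have : a <= v by rewrite Dvab leq_pmulr.
by move: v0; rewrite Dv -muln2; clear; lia.
Qed.

(** In [pell_half] the factor m' of p is not 1, so it is p. An odd y cannot occur in x^2 = p y^2 +
    1, because the right side would be 2 modulo 4. *)
Lemma neg_pell_prime (p : nat) : prime p -> p %% 4 = 1 ->
  exists x y : nat, x ^ 2 + 1 = p * y ^ 2.
Proof.
move=> pr_p p1; have [||m [m' [a [b [Dp e m'1]]]]] := @pell_half p.
- move=> a b; rewrite -{1}[p]muln1; apply: prime_part_nonsquare => //.
  by rewrite dvdn1; case: eqP pr_p => // ->.
- move=> x y e; apply/negP => oy.
  have [t Dt] : exists t, y = t.*2.+1 by exists y./2; rewrite -{1}[y]odd_double_half oy.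
  have ep := divn_eq p 4; rewrite p1 in ep.
  have : x ^ 2 %% 4 = 2 by rewrite e ep Dt -mul2n; lia.
  by rewrite -[x]odd_double_half -mul2n; case: (odd x); lia.
have : m' %| p by rewrite -Dp dvdn_mull.
have /primeP[_ /(_ m')H] := pr_p; move=> /H /=; rewrite (negPf m'1) /= => /eqP Dm'.
have m1 : m = 1 by apply/eqP; rewrite -(eqn_pmul2r (prime_gt0 pr_p)) mul1n -{1}Dm' Dp.
by exists a, b; rewrite -Dm' e m1 mul1n.
Qed.

End HalfPell.

(** * Quadratic reciprocity for primes congruent to 1 modulo 4 *)

(** Zero counts as a residue, which makes this the complement of [qnr] for a prime p. *)
Definition qres (a p : nat) : Prop := exists x : nat, (x ^ 2 = a %[mod p])%N.

Section GaussSum.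
Variables (p q : nat) (L : finFieldType) (z : L).
Hypotheses (pr_p : prime p) (zp : z ^+ p = 1) (z1 : z != 1).

(** The additive character of the prime field attached to the root of unity z. *)
Let e (a : 'F_p) : L := z ^+ a.

Let eD a b : e (a + b) = e a * e b.
Proof.
rewrite /e -exprD -[RHS](expr_mod _ zp); congr (z ^+ _).
by rewrite /=; move: (nat_of_ord a + nat_of_ord b)%N => m; rewrite Fp_cast.
Qed.

Let e0 : e 0 = 1. Proof. exact: expr0. Qed.

Let e_nat n : e n%:R = z ^+ n.
Proof. by rewrite /e val_Fp_nat // expr_mod. Qed.

Let e_mulrn a n : e (a *+ n) = e a ^+ n.
Proof. by elim: n => [|n IHn]; rewrite ?mulr0n ?expr0 // mulrS exprS eD IHn. Qed.

(** Translation by 1 multiplies the sum by z, and z is not 1. *)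
Let sum_e : \sum_a e a = 0.
Proof.
have H : \sum_a e a = z * \sum_a e a.
  rewrite mulr_sumr [LHS](reindex_inj (addrI 1)); apply: eq_bigr => a _.
  by rewrite eD -(mulr1n 1) e_nat expr1.
apply/eqP; have /eqP : (1 - z) * \sum_a e a = 0 by rewrite mulrBl mul1r -H subrr.
by rewrite mulf_eq0 subr_eq0 eq_sym (negPf z1).
Qed.

(** The quadratic Gauss sum in the form that avoids the Legendre symbol. *)
Definition gauss_sum : L := \sum_(x : 'F_p) z ^+ (x ^+ 2)%R.

(** As r^2 = -1, the substitution x -> x + r y turns x^2 + y^2 into x^2 + 2 r x y. For x != 0 the
    sum over y is a full character sum and vanishes; x = 0 contributes p. *)
Lemma gauss_sum_sqr (r : 'F_p) : r ^+ 2 = -1 -> odd p -> gauss_sum ^+ 2 = p%:R.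
Proof.
move=> r2 odd_p; have n2 : 2%:R != 0 :> 'F_p.
  rewrite -(dvdn_pcharf (pchar_Fp pr_p)); apply/negP => /(dvdn_leq (isT : (0 < 2)%N)).
  by have := prime_gt1 pr_p; case: (p) odd_p => [|[|[|]]].
have r0 : r != 0 by apply: contra_eqN r2 => /eqP->; rewrite expr0n /= eq_sym oppr_eq0 oner_eq0.
rewrite expr2 {2}/gauss_sum mulr_sumr.
transitivity (\sum_(y : 'F_p) \sum_(x : 'F_p) e (x ^+ 2) * e (2%:R * r * x * y)).
  apply: eq_bigr => y _; rewrite mulr_suml (reindex_inj (addIr (r * y))).
  apply: eq_bigr => x _; rewrite -!/(e _) -!eD; congr e.
  transitivity (x ^+ 2 + 2%:R * r * x * y + (r ^+ 2 + 1) * y ^+ 2); first by ring.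
  by rewrite r2 addNr mul0r addr0.
rewrite exchange_big (bigD1 0) //= [X in _ + X]big1 ?addr0 => [|x x0].
  rewrite (eq_bigr (fun _ => 1)) => [|y _]; last by rewrite expr0n mulr0 mul0r e0 mulr1.
  by rewrite sumr_const card_Fp.
rewrite -mulr_sumr; have c0 : 2%:R * r * x != 0 by rewrite !mulf_neq0.
have := sum_e; rewrite (reindex_inj (mulfI c0)) => /= H.
by rewrite (eq_bigr (fun y => e (2%:R * r * x * y))) // H mulr0.
Qed.

(** Frobenius multiplies the exponents x^2 by q = s^2, which only permutes them through x -> s x. *)
Lemma gauss_sum_frobenius (s : 'F_p) : q \in [pchar L] -> s != 0 -> s ^+ 2 = q%:R ->
  gauss_sum ^+ q = gauss_sum.
Proof.
move=> chL s0 s2; rewrite -(pFrobenius_autE chL) /gauss_sum rmorph_sum /=.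
rewrite [RHS](reindex_inj (mulfI s0)); apply: eq_bigr => x _.
rewrite pFrobenius_autE -/(e (x ^+ 2)) -/(e ((s * x) ^+ 2)) -e_mulrn; congr e.
by rewrite exprMn s2 mulr_natl.
Qed.

End GaussSum.

(** The polynomial X^q - X has at most q roots, and the prime field already supplies q of them. *)
Lemma frobenius_fixed_nat (L : finFieldType) (q : nat) (g : L) :
  q \in [pchar L] -> g ^+ q = g -> exists n : nat, g = n%:R.
Proof.
move=> chL gq; have pr_q := pcharf_prime chL; have q1 := prime_gt1 pr_q.
pose rs : seq L := [seq (i : nat)%:R | i <- iota 0 q].
have [/mapP[n _ ->]|nrs] := boolP (g \in rs); first by exists n.
pose P : {poly L} := 'X^q - 'X.
have szP : size P = q.+1 by rewrite /P size_polyDl ?size_polyXn // size_polyN size_polyX.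
have fixn (n : nat) : (n%:R : L) ^+ q = n%:R by rewrite -(pFrobenius_autE chL) rmorph_nat.
have rootP x : x ^+ q = x -> root P x by move=> e; rewrite rootE /P !hornerE e subrr.
have := @max_poly_roots _ P (g :: rs); rewrite szP /= size_map size_iota ltnn.
have -> : P != 0 by rewrite -size_poly_gt0 szP.
have -> : all (root P) rs by apply/allP => _ /mapP[n _ ->]; apply: rootP.
rewrite rootP // nrs /= => /(_ isT isT) H; suff /H : uniq rs by [].
rewrite map_inj_in_uniq ?iota_uniq // {H} => m n; rewrite !mem_iota !add0n /= => ltm ltn.
wlog le_mn : m n ltm ltn / (m <= n)%N.
  by move=> H e; case: (leqP m n) => [/H->|/ltnW/H->].
move/esym/eqP; rewrite -subr_eq0 -natrB // -(dvdn_pcharf chL) => dv.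
apply/eqP; rewrite eqn_leq le_mn -subn_eq0 /=.
by move: dv; apply: contraTT => nm; rewrite gtnNdvd ?lt0n // (leq_ltn_trans (leq_subr _ _)).
Qed.

(** When q is a residue modulo p, the Gauss sum in characteristic q is fixed by Frobenius. It thus
    lies in the prime field, where its square is p. *)
Lemma quad_reciprocity_1mod4 (p q : nat) : prime p -> prime q -> p != q ->
  (p %% 4 = 1)%N -> qres q p -> qres p q.
Proof.
move=> pr_p pr_q npq p1 [s Ds].
have p_gt1 := prime_gt1 pr_p.
(* In a field with q^(p-1) elements, p divides the order of the unit group by Fermat, so a
   nontrivial p-th root of unity exists. *)
have [|L chL cardL] := PrimePowerField pr_q (k := p.-1); first by rewrite -subn1 subn_gt0.
have dv : (p %| #|[set: {unit L}]|)%N.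
  rewrite card_finField_unit cardL -subn1.
  have cop : coprime q p by rewrite prime_coprime // dvdn_prime2 // eq_sym.
  rewrite -eqn_mod_dvd ?expn_gt0 ?prime_gt0 //.
  by rewrite -(totient_prime pr_p) Euler_exp_totient.
have [x _ ox] := Cauchy pr_p dv.
pose z : L := FinRing.uval x.
have zp : z ^+ p = 1 by rewrite /z -FinRing.val_unitX -ox expg_order.
have z1 : z != 1.
  apply: contraTneq (p_gt1) => z1; rewrite -ox; suff -> : x = 1%g by rewrite order1.
  exact: val_inj.
(* The equation a^2 + 1 = p b^2 exhibits -1 as a square modulo p. *)
have [a [b eab]] := neg_pell_prime pr_p p1.
have p0 : p%:R = 0 :> 'F_p by apply/eqP; rewrite -(dvdn_pcharf (pchar_Fp pr_p)).
have r2 : (a%:R : 'F_p) ^+ 2 = -1.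
  apply/eqP; rewrite -subr_eq0 opprK -natrX -(natrD _ _ 1) eab natrM p0 mul0r //.
have s2 : (s%:R : 'F_p) ^+ 2 = q%:R.
  by apply: val_inj; rewrite -natrX /= !val_Fp_nat.
have q0 : q%:R != 0 :> 'F_p.
  by rewrite -(dvdn_pcharf (pchar_Fp pr_p)) dvdn_prime2.
have s0 : s%:R != 0 :> 'F_p by apply: contraNneq q0 => s0; rewrite -s2 s0 expr0n.
have odd_p : odd p by rewrite (divn_eq p 4) p1 oddD oddM andbF.
have [n Dn] := frobenius_fixed_nat chL (gauss_sum_frobenius pr_p zp chL s0 s2).
have := gauss_sum_sqr pr_p zp z1 r2 odd_p; rewrite Dn -natrX => e.
exists n; move: (n ^ 2)%N e => m e.
wlog le_mp : m p e {pr_p npq p1 Ds p_gt1 cardL dv ox zp eab p0 r2 s2 q0 s0 odd_p a s z z1 b x n Dn} / (m <= p)%N.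
  by move=> H; case: (leqP m p) => [/H->|/ltnW/H->].
move/esym/eqP: e; rewrite -subr_eq0 -natrB // -(dvdn_pcharf chL) => dv.
by apply/eqP; rewrite eq_sym eqn_mod_dvd.
Qed.

Lemma qnrP (a p : nat) : prime p -> qnr a p -> ~ qres a p.
Proof.
move=> pr_p /andP[_ /existsP nx] [x Dx]; apply: nx.
have lt : (x %% p < p)%N by rewrite ltn_mod prime_gt0.
by exists (Ordinal lt); rewrite /= modnXm Dx.
Qed.

(** * Subfields and Gaussian integers *)

Record subfield (F : algC -> Prop) : Prop := {
  sf1 : F 1;
  sfB : forall x y, F x -> F y -> F (x - y);
  sfM : forall x y, F x -> F y -> F (x * y);
  sfV : forall x, F x -> F x^-1 }.

Section SubfieldTheory.
Variables (F : algC -> Prop) (sF : subfield F).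

Lemma sf0 : F 0. Proof. by rewrite -(subrr 1); apply: (sfB sF); apply: sf1. Qed.

Lemma sfN x : F x -> F (- x).
Proof. by move=> Fx; rewrite -sub0r; apply: sfB => //; apply: sf0. Qed.

Lemma sfD x y : F x -> F y -> F (x + y).
Proof. by move=> Fx Fy; rewrite -[y]opprK; apply: sfB => //; apply: sfN. Qed.

Lemma sfX x n : F x -> F (x ^+ n).
Proof.
move=> Fx; elim: n => [|n IHn]; first by rewrite expr0; apply: sf1.
by rewrite exprS; apply: sfM.
Qed.

Lemma sf_div x y : F x -> F y -> F (x / y).
Proof. by move=> Fx Fy; apply: sfM => //; apply: sfV. Qed.

Lemma sf_nat n : F n%:R.
Proof.
elim: n => [|n IHn]; first exact: sf0.
by rewrite -natr1; apply: sfD => //; apply: sf1.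
Qed.

Lemma sf_int (z : int) : F z%:~R.
Proof.
case: z => n; first by rewrite -pmulrn; apply: sf_nat.
by rewrite NegzE rmorphN /= -pmulrn; apply: sfN; apply: sf_nat.
Qed.

Lemma sf_rat (q : rat) : F (ratr q).
Proof. by rewrite -[q]divq_num_den fmorph_div !rmorph_int; apply: sf_div; apply: sf_int. Qed.

Lemma sf_sum (I : Type) (r : seq I) (P : pred I) (E : I -> algC) :
  (forall i, P i -> F (E i)) -> F (\sum_(i <- r | P i) E i).
Proof. by move=> FE; elim/big_rec: _ => [|i x Pi Fx]; [apply: sf0 | apply: sfD; auto]. Qed.

End SubfieldTheory.

Lemma subfield_rat : subfield (fun x => x \in Crat).
Proof.
by split=> [|x y Fx Fy|x y Fx Fy|x Fx] /=; rewrite ?rpred1 ?rpredB ?rpredM ?rpredV.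
Qed.

Definition quad_ext (F : algC -> Prop) (g x : algC) : Prop :=
  exists a b, [/\ F a, F b & x = a + g * b].

Section QuadExt.
Variables (F : algC -> Prop) (sF : subfield F) (g : algC) (Fg2 : F (g ^+ 2)).

Lemma quad_ext_base x : F x -> quad_ext F g x.
Proof. by move=> Fx; exists x, 0; rewrite mulr0 addr0; split=> //; apply: sf0. Qed.

Lemma quad_ext_gen : quad_ext F g g.
Proof. by exists 0, 1; rewrite mulr1 add0r; split=> //; [apply: sf0 | apply: sf1]. Qed.

(** The number g may belong to F, so a^2 - g^2 b^2 can vanish. Then b = 0 or g is a / b up to sign,
    and a + g b lies in F, where its inverse is taken. *)
Lemma subfield_quad_ext : subfield (quad_ext F g).
Proof.
split.
- by apply: quad_ext_base; apply: sf1.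
- move=> _ _ [a [b [Fa Fb ->]]] [c [d [Fc Fd ->]]].
  by exists (a - c), (b - d); split; [apply: sfB | apply: sfB | ring].
- move=> _ _ [a [b [Fa Fb ->]]] [c [d [Fc Fd ->]]].
  exists (a * c + g ^+ 2 * (b * d)), (a * d + b * c).
  by split; [apply: sfD => //; do ?apply: sfM => // | apply: sfD => //; apply: sfM | ring].
move=> _ [a [b [Fa Fb ->]]].
have [n0|n0] := eqVneq (a ^+ 2 - g ^+ 2 * b ^+ 2) 0; last first.
  exists (a / (a ^+ 2 - g ^+ 2 * b ^+ 2)), (- b / (a ^+ 2 - g ^+ 2 * b ^+ 2)).
  have Fn : F (a ^+ 2 - g ^+ 2 * b ^+ 2).
    by apply: sfB => //; [apply: sfX | apply: sfM => //; apply: sfX].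
  split; [exact: sf_div | by apply: sf_div => //; apply: sfN |].
  have n1 : a + g * b != 0.
    apply: contraNneq n0 => e.
    have -> : a ^+ 2 - g ^+ 2 * b ^+ 2 = (a + g * b) * (a - g * b) by ring.
    by rewrite e mul0r.
  by field; rewrite n1 andbT exprMn.
apply: quad_ext_base; apply: sfV => //; have [b0|b0] := eqVneq b 0.
  by rewrite b0 mulr0 addr0.
suff Fg : F g by apply: sfD => //; apply: sfM.
have : (g - a / b) * (g + a / b) = 0.
  have -> : (g - a / b) * (g + a / b) = - (a ^+ 2 - g ^+ 2 * b ^+ 2) / b ^+ 2 by field.
  by rewrite n0 oppr0 mul0r.
move/eqP; rewrite mulf_eq0 subr_eq0 addr_eq0 => /orP[] /eqP->; first exact: sf_div.
by apply: sfN => //; apply: sf_div.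
Qed.

(** Kummer theory in degree two: the square of a + g b has the g-part 2 a b g, so a = 0, or b = 0,
    or g lies in F. *)
Lemma quad_ext_sqrt x : quad_ext F g x -> F (x ^+ 2) -> F x \/ F (x * g).
Proof.
move=> [a [b [Fa Fb ->]]] Fx2.
have [b0|b0] := eqVneq b 0; first by left; rewrite b0 mulr0 addr0.
have [a0|a0] := eqVneq a 0.
  right; rewrite a0 add0r (_ : g * b * g = g ^+ 2 * b); last by ring.
  exact: sfM.
left; suff Fg : F g by apply: sfD => //; apply: sfM.
rewrite (_ : g = ((a + g * b) ^+ 2 - a ^+ 2 - g ^+ 2 * b ^+ 2) / (2%:R * a * b)).
  apply: sf_div => //; last by apply: sfM => //; apply: sfM => //; apply: sf_nat.
  by apply: sfB => //; [apply: sfB => //; apply: sfX | apply: sfM => //; apply: sfX].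
by field; rewrite a0 b0.
Qed.

End QuadExt.

Lemma quad_ext_ext (F G : algC -> Prop) g x :
  (forall y, F y <-> G y) -> quad_ext F g x <-> quad_ext G g x.
Proof.
by move=> FG; split=> -[a [b [/FG Fa /FG Fb ->]]]; exists a, b.
Qed.

Lemma mq_field_nil x : mq_field [::] x <-> x \in Crat.
Proof.
split=> [[c ->]|/CratP[a ->]].
  rewrite rpred_sum // => -[[|//] i] _ /=; rewrite mulr1; exact: Crat_rat.
by exists [:: a]; rewrite big_ord_recl big_ord0 /= mulr1 addr0.
Qed.

Lemma mq_field_cons g gs x : mq_field (g :: gs) x <-> quad_ext (mq_field gs) g x.
Proof.
set B := mq_basis gs; set n := size B.
have Bg : mq_basis (g :: gs) = B ++ map ( *%R g) B by [].
have szB : size (mq_basis (g :: gs)) = (n + n)%N by rewrite Bg size_cat size_map.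
split.
  case=> c ->; exists (\sum_(j < n) ratr c`_j * B`_j).
  exists (\sum_(j < n) ratr (drop n c)`_j * B`_j); split; first by exists c.
    by exists (drop n c).
  rewrite szB big_split_ord /= -/B; congr (_ + _).
    by apply: eq_bigr => i _; rewrite nth_cat ltn_ord.
  rewrite mulr_sumr; apply: eq_bigr => i _.
  rewrite nth_cat ltnNge leq_addr /= addKn (nth_map 0) // nth_drop; ring.
(* A plain concatenation of c and d would misplace d when c does not have length n; missing
   coefficients are read as the default 0. *)
case=> a [b [[c ->] [d ->] ->]]; exists (mkseq (fun j => if (j < n)%N then c`_j else d`_(j - n)) (n + n)).
rewrite szB big_split_ord /= -/B; congr (_ + _).
  apply: eq_bigr => i _; rewrite nth_cat ltn_ord nth_mkseq ?ltn_ord //.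
  by apply: leq_trans (ltn_ord i) (leq_addr _ _).
rewrite mulr_sumr; apply: eq_bigr => i _.
rewrite nth_mkseq ?ltn_add2l // nth_cat ltnNge leq_addr /= addKn.
rewrite (nth_map 0) //; ring.
Qed.

Definition QI : algC -> Prop := mq_field [:: 'i].

Definition ZI (x : algC) : Prop := exists a b : int, x = a%:~R + 'i * b%:~R.

Definition cnorm (x : algC) : algC := x * x^*.

Definition gdvd (x y : algC) : Prop := exists z, ZI z /\ y = x * z.

Definition gcoprime (x y : algC) : Prop :=
  exists u v, [/\ ZI u, ZI v & u * x + v * y = 1].

Definition gunit (x : algC) : Prop := ZI x /\ gdvd x 1.

Lemma mulii : 'i * 'i = -1 :> algC. Proof. by rewrite -expr2 sqrCi. Qed.

Lemma subfield_QI : subfield QI.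
Proof.
have := subfield_quad_ext subfield_rat (g := 'i).
rewrite sqrCi => /(_ (rpredN1 _)) H.
have E x : QI x <-> quad_ext (fun x => x \in Crat) 'i x.
  by rewrite /QI mq_field_cons; apply: quad_ext_ext => y; apply: mq_field_nil.
split=> [|x y /E Fx /E Fy|x y /E Fx /E Fy|x /E Fx]; apply/E.
- exact: (sf1 H).
- exact: (sfB H).
- exact: (sfM H).
- exact: (sfV H).
Qed.

Lemma QIP x : QI x <-> exists a b : rat, x = ratr a + 'i * ratr b.
Proof.
rewrite /QI mq_field_cons; split.
  case=> a [b [/mq_field_nil/CratP[r ->] /mq_field_nil/CratP[s ->] ->]].
  by exists r, s.
by case=> a [b ->]; exists (ratr a), (ratr b); split=> //; apply/mq_field_nil/Crat_rat.
Qed.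

Lemma QI_i : QI 'i.
Proof. by apply/QIP; exists 0, 1; rewrite rmorph0 rmorph1 add0r mulr1. Qed.

Lemma conj_rat (a : rat) : (ratr a : algC)^* = ratr a.
Proof. by rewrite fmorph_rat. Qed.

Lemma conj_int (a : int) : (a%:~R : algC)^* = a%:~R.
Proof. by rewrite rmorph_int. Qed.

Lemma QI_conj x : QI x -> QI x^*.
Proof.
case/QIP=> a [b ->]; apply/QIP; exists a, (- b).
by rewrite rmorphD rmorphM /= conjCi !conj_rat rmorphN /= mulrN mulNr.
Qed.

Lemma ZI_int (z : int) : ZI z%:~R.
Proof. by exists z, 0; rewrite mulr0 addr0. Qed.

Lemma ZI_nat (n : nat) : ZI n%:R.
Proof. by exists n, 0; rewrite mulr0 addr0. Qed.

Lemma ZI0 : ZI 0. Proof. exact: (ZI_nat 0). Qed.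
Lemma ZI1 : ZI 1. Proof. exact: (ZI_nat 1). Qed.

Lemma ZI_i : ZI 'i.
Proof. by exists 0, 1; rewrite add0r mulr1. Qed.

Lemma ZIN x : ZI x -> ZI (- x).
Proof. by case=> a [b ->]; exists (- a), (- b); rewrite !intrN; ring. Qed.

Lemma ZID x y : ZI x -> ZI y -> ZI (x + y).
Proof. by move=> [a [b ->]] [c [d ->]]; exists (a + c), (b + d); rewrite !intrD; ring. Qed.

Lemma ZIB x y : ZI x -> ZI y -> ZI (x - y).
Proof. by move=> Zx Zy; apply: ZID => //; apply: ZIN. Qed.

Lemma ZIM x y : ZI x -> ZI y -> ZI (x * y).
Proof.
move=> [a [b ->]] [c [d ->]]; exists (a * c - b * d), (a * d + b * c).
rewrite !intrD !intrM intrN intrM.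
rewrite (_ : (a%:~R + 'i * b%:~R) * (c%:~R + 'i * d%:~R) = 
  a%:~R * c%:~R + ('i * 'i) * (b%:~R * d%:~R) + 'i * (a%:~R * d%:~R + b%:~R * c%:~R)); last by ring.
by rewrite mulii; ring.
Qed.

Lemma ZIX x n : ZI x -> ZI (x ^+ n).
Proof.
move=> Zx; elim: n => [|n IHn]; first by rewrite expr0; apply: ZI1.
by rewrite exprS; apply: ZIM.
Qed.

Lemma ZI_conj x : ZI x -> ZI x^*.
Proof.
case=> a [b ->]; exists a, (- b).
by rewrite rmorphD rmorphM /= conjCi !conj_int intrN mulrN mulNr.
Qed.

Lemma ZI_QI x : ZI x -> QI x.
Proof. by case=> a [b ->]; apply/QIP; exists a%:~R, b%:~R; rewrite !ratr_int. Qed.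

Lemma Aint_i : 'i \in Aint.
Proof.
apply: (@Aint_unity_root 4) => //; apply/unity_rootP.
by rewrite (exprM _ 2 2) sqrCi sqrrN expr1n.
Qed.

Lemma ZI_Aint x : ZI x -> x \in Aint.
Proof. by case=> a [b ->]; rewrite rpredD ?rpredM ?Aint_int ?Aint_i. Qed.

Lemma Aint_conj x : (x^* \in Aint) = (x \in Aint).
Proof. exact: (Aint_aut Num.conj). Qed.

Lemma intr_inj_C : injective (fun z : int => z%:~R : algC).
Proof. exact: intr_inj. Qed.

Lemma ZI_inj (a b c d : int) :
  a%:~R + 'i * b%:~R = c%:~R + 'i * d%:~R :> algC -> a = c /\ b = d.
Proof.
move=> e; have R (z : int) : (z%:~R : algC) \is Num.real by rewrite realz.
split; apply: intr_inj_C.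
  by have := congr1 (fun z : algC => 'Re z) e; rewrite !Re_rect ?R.
by have := congr1 (fun z : algC => 'Im z) e; rewrite !Im_rect ?R.
Qed.

Lemma cnormM x y : cnorm (x * y) = cnorm x * cnorm y.
Proof. by rewrite /cnorm rmorphM mulrACA. Qed.

Lemma cnorm_ge0 x : 0 <= cnorm x. Proof. exact: mul_conjC_ge0. Qed.

Lemma cnorm_eq0 x : (cnorm x == 0) = (x == 0). Proof. exact: mul_conjC_eq0. Qed.

Lemma cnormE (a b : int) : cnorm (a%:~R + 'i * b%:~R) = (a ^+ 2 + b ^+ 2)%:~R.
Proof.
rewrite /cnorm rmorphD rmorphM /= conjCi !conj_int intrD !rmorphXn /=.
rewrite (_ : _ * _ = a%:~R ^+ 2 - ('i * 'i) * b%:~R ^+ 2); last by ring.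
by rewrite mulii; ring.
Qed.

Lemma ZI_cnorm x : ZI x -> exists n : nat, cnorm x = n%:R.
Proof.
case=> a [b ->]; rewrite cnormE; exists (absz (a ^+ 2 + b ^+ 2)).
by rewrite pmulrn gez0_abs // addr_ge0 ?sqr_ge0.
Qed.

(** Trace and norm show that A = 2 a and B = 2 b are integers with A^2 + B^2 divisible by 4, and
    squares modulo 4 force A and B to be even. *)
Lemma QI_Aint_ZI x : QI x -> x \in Aint -> ZI x.
Proof.
case/QIP=> a [b Dx] Ax; have Acx : x^* \in Aint by rewrite Aint_conj.
have Dcx : x^* = ratr a - 'i * ratr b.
  by rewrite Dx rmorphD rmorphM /= conjCi !conj_rat mulNr.
have Cr r : (ratr r : algC) \in Crat by apply: Crat_rat.
have /intrP[A DA] : 2%:R * ratr a \in (Num.int : {pred algC}).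
  apply: Cint_rat_Aint; first by rewrite rpredM ?rpred_nat.
  rewrite (_ : 2%:R * ratr a = x + x^*) ?rpredD // Dcx Dx; ring.
have /intrP[B DB] : 2%:R * ratr b \in (Num.int : {pred algC}).
  apply: Cint_rat_Aint; first by rewrite rpredM ?rpred_nat.
  rewrite (_ : 2%:R * ratr b = 'i * (x^* - x)) ?rpredM ?rpredB ?Aint_i // Dcx Dx.
  rewrite (_ : 'i * _ = - ('i * 'i) * (2%:R * ratr b)); last by ring.
  by rewrite mulii; ring.
have /intrP[n Dn] : x * x^* \in (Num.int : {pred algC}).
  apply: Cint_rat_Aint; last by rewrite rpredM.
  rewrite Dcx Dx (_ : _ * _ = ratr a ^+ 2 - ('i * 'i) * ratr b ^+ 2); last by ring.
  rewrite mulii mulN1r opprK; apply: rpredD; apply: rpredX; exact: Cr.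
have E : A ^+ 2 + B ^+ 2 = 4 * n.
  apply: intr_inj_C => /=; rewrite intrD (intrM _ 4) !rmorphXn /= -DA -DB -Dn Dcx Dx.
  rewrite (_ : (ratr a + 'i * ratr b) * _ = ratr a ^+ 2 - ('i * 'i) * ratr b ^+ 2); last by ring.
  by rewrite mulii; ring.
have [A2 B2] : (exists A', A = 2 * A') /\ (exists B', B = 2 * B').
  have eA := divz_eq A 2; have eB := divz_eq B 2.
  have := ltz_pmod A (isT : 0 < 2 :> int); have := modz_ge0 A (isT : 2 != 0 :> int).
  have := ltz_pmod B (isT : 0 < 2 :> int); have := modz_ge0 B (isT : 2 != 0 :> int).
  move: (A %% 2)%Z (B %% 2)%Z (A %/ 2)%Z (B %/ 2)%Z eA eB E => r s A' B' -> -> E s0 s1 r0 r1.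
  suff [-> ->] : r = 0 /\ s = 0 by split; [exists A' | exists B']; ring.
  have r01 : r = 0 \/ r = 1 by lia. have s01 : s = 0 \/ s = 1 by lia.
  by case: r01 => ?; case: s01 => ?; subst; split => //; lia.
case: A2 => A' DA'; case: B2 => B' DB'; exists A', B'.
have n2 : 2%:R != 0 :> algC by rewrite pnatr_eq0.
rewrite Dx; congr (_ + 'i * _); apply: (mulfI n2).
  by rewrite DA DA' intrM.
by rewrite DB DB' intrM.
Qed.

Lemma gdvdxx x : gdvd x x. Proof. by exists 1; rewrite mulr1; split=> //; apply: ZI1. Qed.
Lemma gdvd0 x : gdvd x 0. Proof. by exists 0; rewrite mulr0; split=> //; apply: ZI0. Qed.

Lemma gdvd_trans x y z : gdvd x y -> gdvd y z -> gdvd x z.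
Proof.
by move=> [a [Za ->]] [b [Zb ->]]; exists (a * b); rewrite mulrA; split=> //; apply: ZIM.
Qed.

Lemma gdvdD x y z : gdvd x y -> gdvd x z -> gdvd x (y + z).
Proof.
by move=> [a [Za ->]] [b [Zb ->]]; exists (a + b); rewrite mulrDr; split=> //; apply: ZID.
Qed.

Lemma gdvdN x y : gdvd x y -> gdvd x (- y).
Proof. by move=> [a [Za ->]]; exists (- a); rewrite mulrN; split=> //; apply: ZIN. Qed.

Lemma gdvdB x y z : gdvd x y -> gdvd x z -> gdvd x (y - z).
Proof. by move=> xy xz; apply: gdvdD => //; apply: gdvdN. Qed.

Lemma gdvdMl x y z : ZI z -> gdvd x y -> gdvd x (z * y).
Proof. by move=> Zz [a [Za ->]]; exists (z * a); rewrite mulrCA; split=> //; apply: ZIM. Qed.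

Lemma gdvdMr x y z : ZI z -> gdvd x y -> gdvd x (y * z).
Proof. by move=> Zz xy; rewrite mulrC; apply: gdvdMl. Qed.

Lemma gdvdMM x y z t : gdvd x y -> gdvd z t -> gdvd (x * z) (y * t).
Proof.
by move=> [a [Za ->]] [b [Zb ->]]; exists (a * b); rewrite mulrACA; split=> //; apply: ZIM.
Qed.

Lemma gdvd_conj x y : gdvd x y -> gdvd x^* y^*.
Proof. by move=> [a [Za ->]]; exists a^*; rewrite rmorphM; split=> //; apply: ZI_conj. Qed.

Lemma gcoprime_sym x y : gcoprime x y -> gcoprime y x.
Proof. by case=> u [v [Zu Zv e]]; exists v, u; rewrite addrC. Qed.

Lemma gcoprime_gdvd x y z : ZI z -> gcoprime x y -> gdvd x (y * z) -> gdvd x z.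
Proof.
move=> Zz [u [v [Zu Zv e]]] xyz; rewrite -[z]mul1r -e mulrDl; apply: gdvdD.
  by rewrite mulrAC mulrC; apply: gdvdMr; [apply: ZIM | apply: gdvdxx].
by rewrite -mulrA; apply: gdvdMl.
Qed.

Lemma gcoprimeM x y z : ZI x -> ZI y -> ZI z -> gcoprime x y -> gcoprime x z -> gcoprime x (y * z).
Proof.
move=> Zx Zy Zz [u [v [Zu Zv e]]] [s [t [Zs Zt f]]].
exists (u * (s * x + t * z) + v * y * s), (v * t); split.
- by apply: ZID; do !apply: ZIM => //; apply: ZID; apply: ZIM.
- exact: ZIM.
transitivity ((u * x + v * y) * (s * x + t * z)); first by ring.
by rewrite e f mulr1.
Qed.

Lemma gcoprimeMr x y z : ZI z -> gcoprime x (y * z) -> gcoprime x y.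
Proof.
by move=> Zz [u [v [Zu Zv e]]]; exists u, (v * z); split=> //; [apply: ZIM | rewrite -e; ring].
Qed.

Lemma gcoprime_dvdr x y z : gcoprime x y -> gdvd z y -> gcoprime x z.
Proof. by move=> cxy [a [Za Dy]]; apply: (gcoprimeMr Za); rewrite -Dy. Qed.

Lemma gcoprime_dvdl x y z : gcoprime x y -> gdvd z x -> gcoprime z y.
Proof. by move=> cxy zx; apply/gcoprime_sym/(gcoprime_dvdr (gcoprime_sym cxy)). Qed.

Lemma gunit_neq0 x : gunit x -> x != 0.
Proof.
by case=> _ [y [_ e]]; apply: contra_eqN e => /eqP->; rewrite mul0r oner_eq0.
Qed.

Lemma gdvd_coprime_unit x y : ZI x -> gcoprime x y -> gdvd x y -> gunit x.
Proof.
move=> Zx [u [v [Zu Zv e]]] xy; split=> //; rewrite -e.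
by apply: gdvdD; apply: gdvdMl => //; apply: gdvdxx.
Qed.

(** The coordinates of x / y = x y^* / N are rounded to nearest integers, which leaves an error of
    norm at most 1/4 + 1/4. *)
Lemma ZI_euclid x y : ZI x -> ZI y -> y != 0 ->
  exists2 q, ZI q & 2%:R * cnorm (x - q * y) <= cnorm y.
Proof.
move=> Zx Zy y0; have [N DN] := ZI_cnorm Zy.
have N0 : (0 < N)%N by rewrite -(ltr0n algC) -DN lt_def cnorm_ge0 cnorm_eq0 y0.
have [A [B DAB]] := ZIM Zx (ZI_conj Zy).
have near (C : int) : exists n : int, 2 * (C - n * N) <= N /\ - (N : int) <= 2 * (C - n * N).
  (* The floor of C / N + 1/2, that is, the integer nearest to C / N. *)
  exists ((2 * C + N) %/ (2 * N))%Z.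
  have := divz_eq (2 * C + N) (2 * N).
  have p : 0 < 2 * N :> int by lia.
  have p' : 2 * N != 0 :> int by lia.
  have := ltz_pmod (2 * C + N) p; have := modz_ge0 (2 * C + N) p'.
  by move: (_ %% _)%Z (_ %/ _)%Z => r n; nia.
have [n [n1 n2]] := near A; have [m [m1 m2]] := near B.
pose q : algC := n%:~R + 'i * m%:~R; have Zq : ZI q by exists n, m.
exists q => //; have [M DM] := ZI_cnorm (ZIB Zx (ZIM Zq Zy)).
rewrite DM DN -natrM ler_nat.
have /intr_inj_C e : (M%:Z * N%:Z)%:~R = ((A - n * N) ^+ 2 + (B - m * N) ^+ 2)%:~R :> algC.
  rewrite -cnormE intrM -!pmulrn -DM -DN.
  have -> : cnorm y = cnorm y^* by rewrite /cnorm conjCK mulrC.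
  rewrite -cnormM; congr cnorm; rewrite mulrBl DAB -mulrA -/(cnorm y) DN /q.
  by rewrite !intrD !intrN !intrM -pmulrn; ring.
have : (2 * (M%:Z * N%:Z) <= N%:Z * N%:Z)%R.
  rewrite e; nia.
by nia.
Qed.

Lemma ZI_PID (I : algC -> Prop) :
  (forall x, I x -> ZI x) -> (forall x y, I x -> I y -> I (x + y)) ->
  (forall a x, ZI a -> I x -> I (a * x)) -> (exists x, I x /\ x != 0) ->
  exists g, [/\ I g, g != 0 & forall x, I x -> gdvd g x].
Proof.
move=> IZ ID IM [g0 [Ig0 g00]].
have [N DN] := ZI_cnorm (IZ _ Ig0).
have [n leNn] := ubnP N.
elim: n => // n IHn in N g0 Ig0 g00 DN leNn *.
have [div|] := classic (forall x, I x -> gdvd g0 x); first by exists g0.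
move=> /not_all_ex_not[x nIx]; case: (imply_to_and _ _ nIx) => Ix nx.
have [q Zq qP] := ZI_euclid (IZ _ Ix) (IZ _ Ig0) g00.
have Ir : I (x - q * g0).
  by rewrite -mulNr; apply: ID => //; apply: IM => //; apply: ZIN.
have [M DM] := ZI_cnorm (IZ _ Ir).
have r0 : x - q * g0 != 0.
  rewrite subr_eq0; apply/eqP => e; apply: nx; exists q; split => //.
  by rewrite e mulrC.
apply: (IHn M _ Ir r0 DM).
have M0 : (0 < M)%N by rewrite -(ltr0n algC) -DM lt_def cnorm_ge0 cnorm_eq0 r0.
by move: qP; rewrite DM DN -natrM ler_nat; lia.
Qed.

Lemma gcd_exists x y : ZI x -> ZI y -> x != 0 ->
  exists g u v, [/\ g = u * x + v * y, ZI u, ZI v, g != 0 & gdvd g x /\ gdvd g y].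
Proof.
move=> Zx Zy x0.
pose I z := exists u v, [/\ z = u * x + v * y, ZI u & ZI v].
have [||||g [[u [v [Dg Zu Zv]]] g0 Ig]] := @ZI_PID I.
- by move=> _ [u [v [-> Zu Zv]]]; apply: ZID; apply: ZIM.
- move=> _ _ [u [v [-> Zu Zv]]] [s [t [-> Zs Zt]]].
  by exists (u + s), (v + t); split; [ring | apply: ZID | apply: ZID].
- move=> a _ Za [u [v [-> Zu Zv]]].
  by exists (a * u), (a * v); split; [ring | apply: ZIM | apply: ZIM].
- by exists x; split=> //; exists 1, 0; split; [ring | apply: ZI1 | apply: ZI0].
exists g, u, v; split=> //; split; apply: Ig.
  by exists 1, 0; split; [ring | apply: ZI1 | apply: ZI0].
by exists 0, 1; split; [ring | apply: ZI0 | apply: ZI1].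
Qed.

Lemma gunitP x : gunit x -> [\/ x = 1, x = -1, x = 'i | x = - 'i].
Proof.
case=> -[a [b ->]] [_ [[c [d ->]] e]].
have /intr_inj_C : ((a ^+ 2 + b ^+ 2) * (c ^+ 2 + d ^+ 2))%:~R = 1%:~R :> algC.
  by rewrite intrM -!cnormE -cnormM -e /cnorm rmorph1 mulr1.
move=> E; have {}E : a ^+ 2 + b ^+ 2 = 1.
  have : 0 <= a ^+ 2 + b ^+ 2 by rewrite addr_ge0 ?sqr_ge0.
  have : 0 <= c ^+ 2 + d ^+ 2 by rewrite addr_ge0 ?sqr_ge0.
  move: (a ^+ 2 + b ^+ 2) (c ^+ 2 + d ^+ 2) E => m n E n0 m0.
  have [m1|[m1|m1]] : m = 0 \/ m = 1 \/ 2 <= m by lia.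
  - by move: E; rewrite m1 mul0r.
  - exact: m1.
  - have [n1|n1] : n = 0 \/ 1 <= n by lia.
      by move: E; rewrite n1 mulr0.
    by nia.
have [[-> []->]|[-> []->]] : (b = 0 /\ (a = 1 \/ a = -1)) \/ (a = 0 /\ (b = 1 \/ b = -1)).
- have a1 : a = 0 \/ a = 1 \/ a = -1 by nia.
  by case: a1 => [|[]] ?; subst a; [right|left|left]; split=> //; nia.
- by rewrite mulr0 addr0; constructor 1.
- by rewrite mulr0 addr0; constructor 2.
- by rewrite mulr1 add0r; constructor 3.
- by rewrite mulrN1 add0r; constructor 4.
Qed.

Lemma cnorm1_unit x : ZI x -> cnorm x = 1 -> gunit x.
Proof. by move=> Zx e; split=> //; exists x^*; split; [apply: ZI_conj|rewrite -e]. Qed.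

Lemma gunitM x y : gunit x -> gunit y -> gunit (x * y).
Proof. by move=> [Zx x1] [Zy y1]; split; [apply: ZIM | rewrite -(mulr1 1); apply: gdvdMM]. Qed.

Lemma gunitV x : gunit x -> gunit x^-1.
Proof.
move=> ux; have x0 := gunit_neq0 ux; case: ux => Zx [y [Zy e]].
have -> : x^-1 = y by apply: (mulfI x0); rewrite divff.
by split=> //; exists x; rewrite mulrC.
Qed.

Lemma gunit_i : gunit 'i.
Proof. by apply: cnorm1_unit; [apply: ZI_i | rewrite /cnorm conjCi mulrN mulii opprK]. Qed.

Lemma gdvd_antisym x y : x != 0 -> gdvd x y -> gdvd y x -> exists u, gunit u /\ y = x * u.
Proof.
move=> x0 [a [Za Dy]] [b [Zb Dx]]; exists a; split=> //; split=> //.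
by exists b; split=> //; apply: (mulfI x0); rewrite mulrA -Dy mulr1.
Qed.

(* With g = gcd(X, y): g^2 divides y^2 = X * X^*, hence X, by coprimality; and X divides
   g^2 = (u X + v y)^2 because X divides y^2. *)
Lemma gcoprime_conj_square X y : ZI X -> ZI y -> X != 0 -> gcoprime X X^* ->
  X * X^* = y ^+ 2 -> exists u g, [/\ gunit u, ZI g, g != 0 & X = u * g ^+ 2].
Proof.
move=> ZX Zy X0 cop e; have [g [u [v [Dg Zu Zv g0 [gX gy]]]]] := gcd_exists ZX Zy X0.
have Zg : ZI g by rewrite Dg; apply: ZID; apply: ZIM.
have g2X : gdvd (g ^+ 2) X.
  apply: (gcoprime_gdvd (y := X^*)) => //.
    have cg : gcoprime X^* g by apply: gcoprime_dvdr gX; apply: gcoprime_sym.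
    apply: gcoprime_sym; apply: gcoprimeM => //; exact: ZI_conj.
  by rewrite mulrC e !expr2; apply: gdvdMM.
have Xg2 : gdvd X (g ^+ 2).
  rewrite Dg (_ : _ ^+ 2 = X * (u * (u * X + v * y) + v * y * u) + v ^+ 2 * y ^+ 2); last by ring.
  apply: gdvdD.
    by apply: gdvdMr; [do !(apply: ZID || apply: ZIM) | apply: gdvdxx].
  by apply: gdvdMl; [apply: ZIX | rewrite -e; apply: gdvdMr; [apply: ZI_conj | apply: gdvdxx]].
have [w [uw Dw]] := gdvd_antisym (expf_neq0 2 g0) g2X Xg2.
by exists w, g; split=> //; rewrite mulrC.
Qed.

(** * Integrality criteria and automorphisms of the algebraic numbers *)

Lemma Aint_integralOver x : x \in Aint <-> integralOver (intr : int -> algC) x.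
Proof.
split=> [/floorpP[p Dp]|[p mon_p px0]]; last first.
  apply: root_monic_Aint px0 _ _; first by rewrite monicE lead_coef_map_inj ?(monicP mon_p) //; apply: intr_inj.
  by apply/polyOverP=> i; rewrite coef_map rpred_int.
exists p; last by rewrite -Dp root_minCpoly.
have := minCpoly_monic x; rewrite Dp !monicE lead_coef_map_inj //; last exact: intr_inj.
by move=> /eqP e; apply/eqP; apply: (@intr_inj algC).
Qed.

Lemma Aint_monic_root (p : {poly algC}) x :
  p \is monic -> root p x -> p \is a polyOver Aint -> x \in Aint.
Proof.
move=> mon_p px0 /polyOverP Ap; apply/Aint_integralOver.
apply: integral_root_monic mon_p px0 _ => _ /(nthP 0)[i _ <-].
exact/Aint_integralOver.
Qed.

Lemma Aint_sqr x : x ^+ 2 \in Aint -> x \in Aint.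
Proof.
move=> Ax; apply: (@Aint_monic_root ('X^2 - (x ^+ 2)%:P)); first exact: monicXnsubC.
  by rewrite rootE !hornerE subrr.
by rewrite rpredB ?polyOverXn ?polyOverC.
Qed.

Lemma Aint_quad t n x : t \in Aint -> n \in Aint -> x ^+ 2 = t * x - n -> x \in Aint.
Proof.
move=> At An e; apply: (@Aint_monic_root ('X^2 - (t *: 'X - n%:P))).
- rewrite monicE lead_coefDl ?lead_coefXn // size_polyXn size_polyN.
  apply: leq_ltn_trans (size_polyD _ _) _; rewrite size_polyN gtn_max.
  rewrite (leq_ltn_trans (size_scale_leq _ _)) ?size_polyX //.
  by rewrite (leq_ltn_trans (size_polyC_leq1 _)).
- by rewrite rootE !hornerE e subrr.
- by rewrite rpredB ?polyOverXn ?rpredB ?polyOverZ ?polyOverX ?polyOverC.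
Qed.

Lemma subfield_adjoin (F : algC -> Prop) (sF : subfield F) (Qs : fieldExtType rat)
  (QsC : {rmorphism Qs -> algC}) (E : {subfield Qs}) x :
  (forall z, z \in E -> F (QsC z)) -> F (QsC x) ->
  forall z, z \in <<E; x>>%VS -> F (QsC z).
Proof.
move=> EF Fx z /Fadjoin_polyP[p /polyOverP Ep ->].
rewrite horner_coef rmorph_sum; apply: sf_sum => // i _.
by rewrite rmorphM rmorphXn; apply: sfM => //; [apply: EF | apply: sfX].
Qed.

(** In a number field containing h1, h2 and g, let E = Q(h1, h2). Its image lies in F, so g is not
    in E and has minimal polynomial X^2 - g^2 over E. The identity of E thus extends by g -> - g,
    and the result extends to [algC]. *)
Lemma exists_aut_neg (F : algC -> Prop) (sF : subfield F) g h1 h2 :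
  F h1 -> F h2 -> ~ F g -> g ^+ 2 \in Crat ->
  exists nu : {rmorphism algC -> algC}, [/\ nu g = - g, nu h1 = h1 & nu h2 = h2].
Proof.
move=> F1 F2 nFg /CratP[c Dc].
have [Qs [QsC [s1 Ds genQs]]] := num_field_exists [:: h1; h2; g].
case: s1 Ds genQs => [|y1 [|y2 [|x [|//]]]] // [D1 D2 Dx].
rewrite !adjoin_cons adjoin_nil agenv_id => genQs.
pose E : {subfield Qs} := <<<<1; y1>>; y2>>%AS.
have EF z : z \in E -> F (QsC z).
  apply: (subfield_adjoin sF) => [{}z|]; last by rewrite D2.
  apply: (subfield_adjoin sF) => [{}z|]; last by rewrite D1.
  by case/vlineP=> a ->; rewrite alg_num_field fmorph_rat; apply: sf_rat.
have nEx : x \notin E by apply/negP => /EF; rewrite Dx.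
have Dx2 : x ^+ 2 = ratr c by apply: (fmorph_inj QsC); rewrite rmorphXn /= Dx Dc fmorph_rat.
have Ec : ratr c \in E by rewrite -alg_num_field rpredZ ?rpred1.
pose q : {poly Qs} := 'X^2 - (ratr c)%:P.
have mon_q : q \is monic by apply: monicXnsubC.
have szq : size q = 3%N by apply: size_XnsubC.
have qx : root q x by rewrite rootE /q !hornerE Dx2 subrr.
have Eq : q \is a polyOver E by rewrite rpredB ?polyOverXn ?polyOverC.
have dv : (minPoly E x %| q)%R by apply: minPoly_dvdp.
have minE : minPoly E x = q.
  apply/eqP; rewrite -eqp_monic ?monic_minPoly // -dvdp_size_eqp // szq size_minPoly.
  have := dvdp_leq (monic_neq0 mon_q) dv; rewrite szq size_minPoly ltnS.
  have : (0 < adjoin_degree E x)%N by [].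
  have := adjoin_deg_eq1 E x; rewrite (negPf nEx).
  by case: (adjoin_degree E x) => [|[|[|]]].
have homE : kHom 1 E (\1%VF : 'End(Qs)) by apply: kHomSl (sub1v E) (kHom1 _ _).
have root_neg : root (map_poly \1%VF (minPoly E x)) (- x).
  have -> : map_poly \1%VF (minPoly E x) = minPoly E x.
    by rewrite map_poly_id // => z _; rewrite id_lfunE.
  by rewrite minE rootE /q !hornerE sqrrN Dx2 subrr.
pose phi := kHomExtend E \1 x (- x).
have phim : monoid_morphism phi.
  by apply/kHom_monoid_morphism; rewrite -genQs; apply: (kHomExtendP (sub1v E) homE root_neg).
pose phimM := GRing.isMonoidMorphism.Build _ _ phi phim.
pose phiRM : {rmorphism _ -> _} := HB.pack (fun_of_lfun phi) phimM.
have [nu Dnu] := extend_algC_subfield_aut QsC phiRM.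
have Ey1 : y1 \in E by apply: subvP_adjoin; apply: memv_adjoin.
have Ey2 : y2 \in E by apply: memv_adjoin.
exists nu; split.
- by rewrite -Dx -Dnu /= (kHomExtend_val homE) // rmorphN.
- by rewrite -D1 -Dnu /= (kHomExtend_id _ _ _ Ey1) id_lfunE.
- by rewrite -D2 -Dnu /= (kHomExtend_id _ _ _ Ey2) id_lfunE.
Qed.

(** * Fractional ideals *)

(** Ideals are predicates; extensionality makes equal ideals interchangeable by rewriting, so that
    ideal arithmetic becomes equational. *)
Lemma pred_ext (P Q : algC -> Prop) : (forall x, P x <-> Q x) -> P = Q.
Proof.
by move=> PQ; apply: functional_extensionality => x; apply: propositional_extensionality.
Qed.

Section Oint.
Variables (F : nfield) (sF : subfield F).

Lemma Oint0 : Oint F 0. Proof. by split; [apply: sf0 | apply: Aint0]. Qed.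
Lemma Oint1 : Oint F 1. Proof. by split; [apply: sf1 | apply: Aint1]. Qed.
Lemma OintD x y : Oint F x -> Oint F y -> Oint F (x + y).
Proof. by move=> [Fx Ax] [Fy Ay]; split; [apply: sfD | rewrite rpredD]. Qed.
Lemma OintN x : Oint F x -> Oint F (- x).
Proof. by move=> [Fx Ax]; split; [apply: sfN | rewrite rpredN]. Qed.
Lemma OintB x y : Oint F x -> Oint F y -> Oint F (x - y).
Proof. by move=> Ox Oy; apply: OintD => //; apply: OintN. Qed.
Lemma OintM x y : Oint F x -> Oint F y -> Oint F (x * y).
Proof. by move=> [Fx Ax] [Fy Ay]; split; [apply: sfM | rewrite rpredM]. Qed.
End Oint.

(* Ideals are handled as nonzero submodules of the field, i.e. as fractional ideals;
   [scale c I] is the fractional ideal c I. *)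
Record omod (F : nfield) (I : algC -> Prop) : Prop := {
  omod0 : I 0;
  omodD : forall x y, I x -> I y -> I (x + y);
  omodM : forall a x, Oint F a -> I x -> I (a * x) }.

Definition scale (c : algC) (I : algC -> Prop) (x : algC) : Prop :=
  exists y, I y /\ x = c * y.

Lemma idealM_mem (I J : algC -> Prop) x y : I x -> J y -> idealM I J (x * y).
Proof.
move=> Ix Jy; exists [:: (x, y)]; rewrite big_seq1; split=> // u.
by rewrite inE => /eqP->.
Qed.

(** The induction principle for elements of a product ideal, used in place of the finite sums of the
    definition. *)
Lemma idealM_min (I J P : algC -> Prop) :
  P 0 -> (forall x y, P x -> P y -> P (x + y)) ->
  (forall x y, I x -> J y -> P (x * y)) -> forall x, idealM I J x -> P x.
Proof.
move=> P0 PD PM _ [s [sIJ ->]]; elim: s sIJ => [|u s IHs] sIJ; first by rewrite big_nil.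
rewrite big_cons; apply: PD.
  by have [] := sIJ u (mem_head _ _) => ? ?; apply: PM.
by apply: IHs => v sv; apply: sIJ; rewrite inE sv orbT.
Qed.

Lemma idealM0 (I J : algC -> Prop) : idealM I J 0.
Proof. by exists [::]; rewrite big_nil. Qed.

Lemma idealMD (I J : algC -> Prop) x y : idealM I J x -> idealM I J y -> idealM I J (x + y).
Proof.
move=> [s [sIJ ->]] [t [tIJ ->]]; exists (s ++ t); rewrite big_cat; split=> // u.
by rewrite mem_cat => /orP[/sIJ|/tIJ].
Qed.

Lemma idealMC (I J : algC -> Prop) : idealM I J = idealM J I.
Proof.
have H (I' J' : algC -> Prop) x : idealM I' J' x -> idealM J' I' x.
  apply: idealM_min; [exact: idealM0 | exact: idealMD | move=> y z Iy Jz].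
  by rewrite mulrC; apply: idealM_mem.
by apply: pred_ext => x; split; apply: H.
Qed.

Lemma idealMA (I J L : algC -> Prop) : idealM I (idealM J L) = idealM (idealM I J) L.
Proof.
have H I1 I2 I3 : forall x, idealM I1 (idealM I2 I3) x -> idealM (idealM I1 I2) I3 x.
  apply: idealM_min; [exact: idealM0 | exact: idealMD | move=> x y Ix].
  apply: (@idealM_min I2 I3 (fun y => idealM (idealM I1 I2) I3 (x * y))).
  - by rewrite mulr0; apply: idealM0.
  - by move=> y' z'; rewrite mulrDr; apply: idealMD.
  - by move=> y' z' Jy Lz; rewrite mulrA; apply: idealM_mem => //; apply: idealM_mem.
apply: pred_ext => x; split; first exact: H.
by rewrite (idealMC _ L) (idealMC I J) (idealMC I) (idealMC J L); apply: H.
Qed.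

Lemma idealMCA I J L : idealM I (idealM J L) = idealM J (idealM I L).
Proof. by rewrite !idealMA (idealMC I J). Qed.

Lemma idealMACA I J L M :
  idealM (idealM I J) (idealM L M) = idealM (idealM I L) (idealM J M).
Proof. by rewrite -!idealMA (idealMCA J). Qed.

Lemma scaleM a b I : scale a (scale b I) = scale (a * b) I.
Proof.
apply: pred_ext => x; split=> [[_ [[z [Iz ->]] ->]]|[y [Iy ->]]].
  by exists z; rewrite mulrA.
by exists (b * y); split; [exists y | rewrite mulrA].
Qed.

Lemma scale1 I : scale 1 I = I.
Proof.
apply: pred_ext => x; split=> [[y [Iy ->]]|Ix]; first by rewrite mul1r.
by exists x; rewrite mul1r.
Qed.

Lemma scaleK c I J : c != 0 -> scale c I = J -> I = scale c^-1 J.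
Proof. by move=> c0 <-; rewrite scaleM mulVf // scale1. Qed.

Lemma idealM_scalel c I J : idealM (scale c I) J = scale c (idealM I J).
Proof.
apply: pred_ext => x; split.
  apply: idealM_min => [|x' y' [x1 [Ix1 ->]] [y1 [Iy1 ->]]|_ y [x1 [Ix1 ->]] Jy].
  - by exists 0; rewrite mulr0; split=> //; apply: idealM0.
  - by exists (x1 + y1); rewrite mulrDr; split=> //; apply: idealMD.
  - by exists (x1 * y); rewrite mulrA; split=> //; apply: idealM_mem.
case=> y [IJy ->]; apply: (@idealM_min I J (fun y => idealM (scale c I) J (c * y))) IJy.
- by rewrite mulr0; apply: idealM0.
- by move=> x' y'; rewrite mulrDr; apply: idealMD.
- by move=> x' y' Ix Jy; rewrite mulrA; apply: idealM_mem => //; exists x'.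
Qed.

Lemma idealM_scaler c I J : idealM I (scale c J) = scale c (idealM I J).
Proof. by rewrite idealMC idealM_scalel idealMC. Qed.

Section OMod.
Variables (F : nfield) (sF : subfield F).

Lemma omod_Oint : omod F (Oint F).
Proof. by split; [apply: Oint0 | apply: OintD | apply: OintM]. Qed.

Lemma omod_idealM I J : omod F I -> omod F (idealM I J).
Proof.
move=> mI; split; [exact: idealM0 | exact: idealMD |move=> a x Oa].
apply: (@idealM_min I J (fun y => idealM I J (a * y))).
- by rewrite mulr0; apply: idealM0.
- by move=> x' y'; rewrite mulrDr; apply: idealMD.
- by move=> x' y' Ix Jy; rewrite mulrA; apply: idealM_mem => //; apply: (omodM mI).
Qed.

Lemma omod_scale c I : omod F I -> omod F (scale c I).
Proof.
move=> mI; split.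
- by exists 0; rewrite mulr0; split=> //; apply: (omod0 mI).
- move=> _ _ [x [Ix ->]] [y [Iy ->]]; exists (x + y); rewrite mulrDr; split=> //.
  exact: (omodD mI).
- move=> a _ Oa [x [Ix ->]]; exists (a * x); rewrite mulrCA; split=> //.
  exact: (omodM mI).
Qed.

Lemma idealMO I : omod F I -> idealM I (Oint F) = I.
Proof.
move=> mI; apply: pred_ext => x; split.
  apply: idealM_min; [exact: (omod0 mI) | exact: (omodD mI) | move=> y a Iy Oa].
  by rewrite mulrC; apply: (omodM mI).
by move=> Ix; rewrite -(mulr1 x); apply: idealM_mem => //; apply: Oint1.
Qed.

Lemma idealOM I : omod F I -> idealM (Oint F) I = I.
Proof. by move=> mI; rewrite idealMC idealMO. Qed.

Lemma scale_Oint_unit u : Oint F u -> Oint F u^-1 -> u != 0 -> scale u (Oint F) = Oint F.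
Proof.
move=> Ou Ov u0; apply: pred_ext => x; split=> [[y [Oy ->]]|Ox]; first exact: OintM.
by exists (u^-1 * x); rewrite mulVKf //; split=> //; apply: OintM.
Qed.

Lemma scale_omod_unit u I : omod F I -> Oint F u -> Oint F u^-1 -> u != 0 -> scale u I = I.
Proof.
move=> mI Ou Ov u0; apply: pred_ext => x; split=> [[y [Iy ->]]|Ix].
  exact: (omodM mI).
by exists (u^-1 * x); rewrite mulVKf //; split=> //; apply: (omodM mI).
Qed.

Lemma ideal_omod I : ideal F I -> omod F I.
Proof. by case=> _ I0 ID IM _; split. Qed.

Lemma principalE I : principal F I <-> exists al, F al /\ I = scale al (Oint F).
Proof.
split=> -[al [Fal H]]; exists al; split=> //; last by rewrite H.
by apply: pred_ext => x; rewrite H.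
Qed.

Lemma ideal_equivE I J :
  ideal_equiv F I J <-> exists c, [/\ F c, c != 0 & I = scale c J].
Proof.
split=> [[al [be [Fal Fbe al0 be0 H]]]|[c [Fc c0 ->]]].
  exists (be / al); split; [exact: sf_div|by rewrite mulf_neq0 ?invr_eq0|].
  have E : scale al I = scale be J by apply: pred_ext => x; apply: H.
  by rewrite (scaleK al0 E) scaleM mulrC.
exists 1, c; split=> //; [exact: sf1 | exact: oner_neq0 |move=> x].
by rewrite -/(scale 1 (scale c J) x) scale1.
Qed.

Lemma idealX2 I : omod F I -> idealX F I 2 = idealM I I.
Proof. by move=> mI; rewrite /= idealOM. Qed.

(* A fractional ideal whose square is (1) equals (1), because the ring of integers is
   integrally closed. *)
Lemma omod_sqr_principal I c : omod F I -> (forall x, I x -> F x) -> F c -> c != 0 ->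
  idealM I I = scale (c ^+ 2) (Oint F) ->
  I = scale c (Oint F).
Proof.
move=> mI IF Fc c0 II.
have sub x : I x -> Oint F (x / c).
  move=> Ix; split; first by apply: sf_div => //; apply: IF.
  apply: Aint_sqr; have : idealM I I (x * x) by apply: idealM_mem.
  rewrite II => -[o [[_ Ao] e]]; rewrite expr_div_n expr2 e mulrAC divff ?mul1r //.
  by rewrite expf_neq0.
have Ic : I c.
  have : idealM I I (c ^+ 2) by rewrite II; exists 1; rewrite mulr1; split=> //; apply: Oint1.
  move=> H; suff : I (c ^+ 2 / c) by rewrite expr2 mulfK.
  apply: (@idealM_min I I (fun y => I (y / c))) H.
  - by rewrite mul0r; apply: (omod0 mI).
  - by move=> x y; rewrite mulrDl; apply: (omodD mI).
  - by move=> x y Ix Iy; rewrite mulrAC; apply: (omodM mI) => //; apply: sub.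
apply: pred_ext => x; split=> [Ix|[o [Oo ->]]].
  by exists (x / c); rewrite (mulrC c) divfK //; split=> //; apply: sub.
by rewrite mulrC; apply: (omodM mI).
Qed.

End OMod.

(** * Gaussian primes and norms from Q(i, sqrt(2 p1 p2)) *)

(** The Gaussian primes of degree one. The prime 1 + i is included, with p = 2. *)
Record gprime (q : algC) (p : nat) : Prop := {
  gp_ZI : ZI q;
  gp_norm : q * q^* = p%:R;
  gp_prime : prime p }.

Section GPrime.
Variables (q : algC) (p : nat) (hq : gprime q p).
Let Zq := gp_ZI hq.

Lemma gprime_neq0 : q != 0.
Proof.
have := gp_norm hq; apply: contra_eqN => /eqP->.
by rewrite mul0r eq_sym pnatr_eq0 -lt0n prime_gt0 ?(gp_prime hq).
Qed.

Lemma gprime_conj : gprime q^* p.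
Proof.
by split; [apply: ZI_conj | rewrite conjCK mulrC (gp_norm hq) | apply: gp_prime hq].
Qed.

Lemma gprime_dvd_norm : gdvd q p%:R.
Proof. by exists q^*; rewrite (gp_norm hq); split=> //; apply: ZI_conj. Qed.

Lemma gprime_coprime x : ZI x -> ~ gdvd q x -> gcoprime q x.
Proof.
move=> Zx nqx; have [g [u [v [Dg Zu Zv g0 [[z [Zz Dq]] gx]]]]] := gcd_exists Zq Zx gprime_neq0.
have Zg : ZI g by rewrite Dg; apply: ZID; apply: ZIM.
have [n Dn] := ZI_cnorm Zg; have [m Dm] := ZI_cnorm Zz.
have /eqP : (n * m)%:R = p%:R :> algC by rewrite natrM -Dn -Dm -cnormM -Dq -(gp_norm hq).
rewrite eqr_nat => /eqP nm.
have /primeP[_ /(_ n)] := gp_prime hq; rewrite -{1}nm dvdn_mulr // => /(_ isT)/orP[/eqP n1|/eqP np].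
  have [_ [w [Zw gw]]] : gunit g by apply: cnorm1_unit; rewrite // Dn n1.
  exists (w * u), (w * v); split; [exact: ZIM|exact: ZIM|].
  by rewrite gw Dg; ring.
case: nqx; apply: gdvd_trans gx.
have m1 : m = 1%N.
  by apply/eqP; rewrite -(eqn_pmul2l (prime_gt0 (gp_prime hq))) -{1}np nm muln1.
have [_ [w [Zw zw]]] : gunit z by apply: cnorm1_unit; rewrite // Dm m1.
by exists w; split=> //; rewrite Dq -mulrA -zw mulr1.
Qed.

Lemma gprime_not_dvd1 : ~ gdvd q 1.
Proof.
case=> z [Zz e]; have [m Dm] := ZI_cnorm Zz.
have /eqP : (p * m)%:R = 1%:R :> algC.
  have E : cnorm q = p%:R := gp_norm hq.
  by rewrite natrM -Dm -E -cnormM -e /cnorm conjC1 mulr1.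
by rewrite eqr_nat muln_eq1 => /andP[/eqP p1]; have := gp_prime hq; rewrite p1.
Qed.

Lemma gprime_mul x y : ZI x -> ZI y -> gdvd q (x * y) -> gdvd q x \/ gdvd q y.
Proof.
move=> Zx Zy qxy; have [|nqx] := Classical_Prop.classic (gdvd q x); first by left.
by right; apply: gcoprime_gdvd qxy => //; apply: gprime_coprime.
Qed.

Lemma gprime_sqr x : ZI x -> gdvd q (x ^+ 2) -> gdvd q x.
Proof. by move=> Zx; rewrite expr2 => /gprime_mul[]. Qed.

(** Taking norms, q | n gives p | n^2. *)
Lemma gprime_int (n : int) : gdvd q n%:~R <-> (p %| absz n)%N.
Proof.
split=> [[z [Zz e]]|/dvdnP[k Dk]].
  have [m Dm] := ZI_cnorm Zz.
  have /intr_inj_C : (n ^+ 2)%:~R = (p%:Z * m%:Z)%:~R :> algC.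
    have E : cnorm q = p%:R := gp_norm hq.
    by rewrite intrM -!pmulrn -Dm -E -cnormM -e /cnorm conj_int -intrM.
  move/(congr1 absz); rewrite abszX abszM /= => e2.
  by have := dvdn_mulr m (dvdnn p); rewrite -e2 Euclid_dvdX ?(gp_prime hq) // andbT.
have {Dk} : n%:~R = k%:R * p%:R :> algC \/ n%:~R = - (k%:R * p%:R) :> algC.
  rewrite -natrM -Dk; case: n {Dk} => n; first by left.
  by right; rewrite NegzE rmorphN.
have H : gdvd q (k%:R * p%:R) by apply: gdvdMl; [apply: ZI_nat | apply: gprime_dvd_norm].
by case=> ->; [|apply: gdvdN].
Qed.

Lemma gprime_nat (n : nat) : gdvd q n%:R <-> (p %| n)%N.
Proof. by have := gprime_int n; rewrite -pmulrn. Qed.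

End GPrime.

(** If q = a + b i divided its conjugate, it would divide the trace 2 a, so p would divide a, which
    a^2 + b^2 = p does not allow. *)
Lemma gprime_odd_coprime_conj q p : gprime q p -> odd p -> gcoprime q q^*.
Proof.
move=> hq odd_p; apply: (gprime_coprime hq); first exact/ZI_conj/(gp_ZI hq).
move=> qq; have [a [b Dq]] := gp_ZI hq; have pr_p := gp_prime hq.
have : gdvd q (2 * a)%:~R.
  have -> : (2 * a)%:~R = q + q^*.
    by rewrite Dq rmorphD rmorphM /= conjCi !conj_int intrM mulNr; ring.
  by apply: gdvdD => //; apply: gdvdxx.
move/(gprime_int hq); rewrite abszM Euclid_dvdM // => /orP[|pa].
  by rewrite dvdn_prime2 // => /eqP p2; rewrite p2 in odd_p.
have /intr_inj_C : (a ^+ 2 + b ^+ 2)%:~R = p%:Z%:~R :> algC.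
  by rewrite -cnormE -Dq -pmulrn -(gp_norm hq).
have [a0|a0] := eqVneq a 0.
  move/(congr1 absz); rewrite a0 expr0n add0r abszX /= => e.
  by have := gp_prime hq; rewrite -e; case: (absz b) => [|[|n]] // ; rewrite -mulnn => /primeP[_ /(_ n.+2)]; rewrite dvdn_mulr // => /(_ isT) /orP[] // /eqP; lia.
have : (p <= absz a)%N by apply: dvdn_leq; rewrite ?absz_gt0.
have := prime_gt1 pr_p; nia.
Qed.

(* The residue field Z[i]/q has prime order, so that every residue is a rational integer:
   with v q^* = 1 mod q, s is congruent to the trace of s v q^*. *)
Lemma gprime_residue q p s : gprime q p -> gcoprime q q^* -> ZI s ->
  exists n : int, gdvd q (s - n%:~R).
Proof.
move=> hq [u [v [Zu Zv e]]] Zs; have Zq := gp_ZI hq.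
have [a [b Dx]] : ZI (s * v * q^*) by do !apply: ZIM => //; apply: ZI_conj.
exists (2 * a).
have Dn : (2 * a)%:~R = s * v * q^* + (s * v)^* * q.
  have -> : (s * v)^* * q = (s * v * q^*)^* by rewrite [in RHS]rmorphM /= conjCK.
  by rewrite Dx rmorphD rmorphM /= conjCi !conj_int intrM mulNr; ring.
rewrite (_ : _ - _ = q * (s * u - (s * v)^*)).
  exists (s * u - (s * v)^*); split=> //; apply: ZIB; first exact: ZIM.
  by apply: ZI_conj; apply: ZIM.
have Ds : s = s * (u * q + v * q^*) by rewrite e mulr1.
by rewrite Dn [X in X - _]Ds; ring.
Qed.

(** By [gprime_residue] the root s may be replaced by a rational integer, and then divisibility by q
    is divisibility by p. *)
Lemma gsquare_qres q p s (n : nat) : gprime q p -> gcoprime q q^* -> ZI s ->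
  gdvd q (s ^+ 2 - n%:R) -> qres n p.
Proof.
move=> hq cq Zs qs; have [m qm] := gprime_residue hq cq Zs.
have : gdvd q (m ^+ 2 - n%:Z)%:~R.
  have -> : (m ^+ 2 - n%:Z)%:~R = (s ^+ 2 - n%:R) - (s - m%:~R) * (s + m%:~R) :> algC.
    by rewrite intrD intrN rmorphXn /= -!pmulrn; ring.
  apply: gdvdB => //; apply: gdvdMr => //; apply: ZID => //; exact: ZI_int.
move/(gprime_int hq) => dv; exists (absz m).
have e : (absz m ^ 2)%N%:Z = m ^+ 2 by rewrite -abszX gez0_abs ?sqr_ge0.
apply/eqP; rewrite -eqz_nat -!modz_nat.
by change ((absz m ^ 2)%N%:Z == n%:Z %[mod p%:Z])%Z; rewrite eqz_mod_dvd e.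
Qed.

Lemma QI_denom x : QI x -> exists n : nat, (0 < n)%N /\ ZI (n%:R * x).
Proof.
case/QIP=> a [b ->]; exists (absz (denq a * denq b)); split.
  by rewrite absz_gt0 mulf_neq0 ?denq_neq0.
exists (numq a * denq b), (numq b * denq a).
rewrite pmulrn gez0_abs ?mulr_ge0 ?denq_ge0 // !intrM.
have Ha : ratr a * (denq a)%:~R = (numq a)%:~R :> algC.
  by rewrite -[X in _ * X]ratr_int -rmorphM /= -{1}[a]divq_num_den divfK ?intr_eq0 ?denq_neq0 // ratr_int.
have Hb : ratr b * (denq b)%:~R = (numq b)%:~R :> algC.
  by rewrite -[X in _ * X]ratr_int -rmorphM /= -{1}[b]divq_num_den divfK ?intr_eq0 ?denq_neq0 // ratr_int.
by rewrite -Ha -Hb; ring.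
Qed.

(** The local condition at a prime q dividing D exactly once. Without denominators the equation
    reads A^2 - D B^2 = C c^2. If q does not divide c, invert c modulo q. Otherwise q divides A,
    then q divides B because D / q is prime to q, and q cancels from A, B and c; the norm of c
    decreases. *)
Lemma local_norm_square q p D D' C : gprime q p -> ZI D' -> D = q * D' -> ~ gdvd q D' ->
  ZI C -> ~ gdvd q C ->
  (exists a b, [/\ QI a, QI b & a ^+ 2 - D * b ^+ 2 = C]) ->
  exists s, ZI s /\ gdvd q (s ^+ 2 - C).
Proof.
move=> hq ZD' DD nqD' ZC nqC [a [b [Qa Qb e]]]; have Zq := gp_ZI hq; have q0 := gprime_neq0 hq.
have [n [n0 Zna]] := QI_denom Qa; have [m [m0 Zmb]] := QI_denom Qb.
have {a b Qa Qb e n n0 m m0 Zna Zmb} : exists A B c, [/\ ZI A, ZI B, ZI c, c != 0 & A ^+ 2 - D * B ^+ 2 = C * c ^+ 2].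
  exists (m%:R * (n%:R * a)), (n%:R * (m%:R * b)), (n * m)%:R; split.
  - by apply: ZIM => //; apply: ZI_nat.
  - by apply: ZIM => //; apply: ZI_nat.
  - exact: ZI_nat.
  - by rewrite pnatr_eq0 -lt0n muln_gt0 n0.
  - by rewrite -e natrM; ring.
case=> A [B [c [ZA ZB Zc c0 e]]]; have [N DN] := ZI_cnorm Zc.
have [k leNk] := ubnP N.
elim: k => // k IHk in N A B c ZA ZB Zc c0 e DN leNk *.
have ZD : ZI D by rewrite DD; apply: ZIM.
have qD : gdvd q D by exists D'.
have [[c1 [Zc1 Dc]]|nqc] := Classical_Prop.classic (gdvd q c); last first.
  have [u [v [Zu Zv uv]]] := gprime_coprime hq Zc nqc.
  exists (A * v); split; first exact: ZIM.
  have -> : (A * v) ^+ 2 - C = D * (B * v) ^+ 2 + q * (C * u * (q * u - 2%:R)).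
    rewrite (_ : _ - C = (A ^+ 2 - D * B ^+ 2) * v ^+ 2 + D * (B * v) ^+ 2 - C); last by ring.
    rewrite e (_ : C * c ^+ 2 * v ^+ 2 = C * (v * c) ^+ 2); last by ring.
    rewrite (_ : v * c = 1 - u * q); last by rewrite -uv; ring.
    by ring.
  apply: gdvdD.
    by apply: gdvdMr => //; apply: ZIX; apply: ZIM.
  apply: gdvdMr; last exact: gdvdxx.
  apply: ZIM; first exact: ZIM.
  by apply: ZIB; [apply: ZIM | apply: ZI_nat].
have [A1 [ZA1 DA]] : gdvd q A.
  apply: (gprime_sqr hq) => //; have -> : A ^+ 2 = C * c ^+ 2 + D * B ^+ 2 by rewrite -e; ring.
  apply: gdvdD; last by apply: gdvdMr => //; apply: ZIX.
  by rewrite Dc exprMn expr2 mulrCA -mulrA; apply: gdvdMr; [do !apply: ZIM=> //; apply: ZIX| apply: gdvdxx].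
have [B1 [ZB1 DB]] : gdvd q B.
  apply: (gprime_sqr hq) => //; apply: (gcoprime_gdvd (y := D')).
  - exact: ZIX.
  - exact: (gprime_coprime hq).
  - exists (A1 ^+ 2 - C * c1 ^+ 2); split.
      by apply: ZIB; [apply: ZIX | apply: ZIM => //; apply: ZIX].
    apply: (mulfI q0); move: e; rewrite DA Dc DD => e.
    rewrite (_ : q * (D' * B ^+ 2) = (q * A1) ^+ 2 - ((q * A1) ^+ 2 - q * D' * B ^+ 2)); last by ring.
    by rewrite e; ring.
have q20 : q ^+ 2 != 0 by rewrite expf_neq0.
have e1 : A1 ^+ 2 - D * B1 ^+ 2 = C * c1 ^+ 2.
  apply: (mulfI q20); transitivity (A ^+ 2 - D * B ^+ 2); first by rewrite DA DB; ring.
  by rewrite e Dc; ring.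
have c10 : c1 != 0 by apply: contraNneq c0; rewrite Dc => ->; rewrite mulr0.
have [N1 DN1] := ZI_cnorm Zc1; apply: (IHk N1 A1 B1 c1) => //.
have /eqP : N%:R = (p * N1)%:R :> algC.
  by rewrite natrM -DN -DN1 Dc cnormM /cnorm (gp_norm hq).
rewrite eqr_nat => /eqP eN; have p2 := prime_gt1 (gp_prime hq).
have N10 : (0 < N1)%N by rewrite -(ltr0n algC) -DN1 lt_def cnorm_ge0 cnorm_eq0 c10.
by rewrite eN in leNk; nia.
Qed.

Lemma qres_Fp (n p : nat) : prime p -> qres n p <-> exists x : 'F_p, x ^+ 2 = n%:R.
Proof.
move=> pr_p; split=> [[s Ds]|[x Dx]].
  by exists s%:R; apply: val_inj; rewrite -natrX /= !val_Fp_nat.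
have {}Dx : (x ^ 2)%N%:R = n%:R :> 'F_p by rewrite natrX natr_Zp.
by exists x; have := congr1 val Dx; rewrite /= !val_Fp_nat.
Qed.

Lemma qres_div (a b p : nat) : prime p -> ~~ (p %| b)%N -> qres (a * b) p -> qres b p -> qres a p.
Proof.
move=> pr_p pb /(qres_Fp _ pr_p)[x Dx] /(qres_Fp _ pr_p)[y Dy]; apply/(qres_Fp _ pr_p).
exists (x / y); rewrite expr_div_n Dx Dy natrM mulfK //.
by rewrite -(dvdn_pcharf (pchar_Fp pr_p)).
Qed.

Definition QI_norm (D C : algC) : Prop :=
  exists a b, [/\ QI a, QI b & a ^+ 2 - D * b ^+ 2 = C].

(* The norm of sqrt(D) / (a + b sqrt(D)) is - D / C. *)
Lemma QI_norm_compl (D C : algC) : QI D -> D != 0 -> C != 0 -> QI_norm D C -> QI_norm D (- D / C).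
Proof.
move=> QD D0 C0 [a [b [Qa Qb e]]]; have sQ := subfield_QI.
have QC : QI C by rewrite -e; apply: sfB => //; [apply: sfX | apply: sfM => //; apply: sfX].
exists (- D * b / C), (a / C); split.
- by apply: sf_div => //; apply: sfM => //; apply: sfN.
- exact: sf_div.
- transitivity (- D * (a ^+ 2 - D * b ^+ 2) / C ^+ 2); first by field.
  by rewrite e; field.
Qed.

(** At least two of the three symbols equal -1 exactly when no two of them equal 1. The three
    exclusions are written so that exchanging p1 and p2 permutes them. The Gaussian prime [rho]
    above p2 does not occur in the theorem; it serves for the local conditions at p2 and for the
    ramified primes there. *)
Record biprime (p1 p2 : nat) (pi rho : algC) : Prop := {
  bp_pi : gprime pi p1;
  bp_rho : gprime rho p2;
  bp_neq : p1 != p2;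
  bp_mod1 : (p1 %% 4 = 1)%N;
  bp_mod2 : (p2 %% 4 = 1)%N;
  bp_res2 : ~ (qres 2 p1 /\ qres 2 p2);
  bp_res1 : ~ (qres p1 p2 /\ qres 2 p1);
  bp_res1' : ~ (qres p2 p1 /\ qres 2 p2) }.

Lemma biprime_sym p1 p2 pi rho : biprime p1 p2 pi rho -> biprime p2 p1 rho pi.
Proof.
move=> [h1 h2 ne m1 m2 r2 r1 r1']; split=> //; first by rewrite eq_sym.
by move=> [a b]; apply: r2.
Qed.

Lemma mod4_odd p : (p %% 4 = 1)%N -> odd p.
Proof. by move=> p1; rewrite (divn_eq p 4) p1 oddD oddM andbF. Qed.

Section LocalPi.
Variables (p1 p2 : nat) (pi rho : algC) (H : biprime p1 p2 pi rho).
Let D : algC := (2 * p1 * p2)%:R.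
Let hpi := bp_pi H.
Let pr1 : prime p1 := gp_prime hpi.
Let pr2 : prime p2 := gp_prime (bp_rho H).

Lemma bp_ndvd2 : ~~ (p1 %| 2)%N.
Proof.
rewrite dvdn_prime2 //; apply/eqP => e; have := mod4_odd (bp_mod1 H); by rewrite e.
Qed.

Lemma bp_ndvd12 : ~~ (p1 %| p2)%N.
Proof. by rewrite dvdn_prime2 // (bp_neq H). Qed.

Lemma bp_ndvd22 : ~~ (p1 %| 2 * p2)%N.
Proof. by rewrite Euclid_dvdM // negb_or bp_ndvd2 bp_ndvd12. Qed.

Lemma bp_coprime_conj : gcoprime pi pi^*.
Proof. by apply: gprime_odd_coprime_conj hpi _; apply: mod4_odd (bp_mod1 H). Qed.

Lemma bp_D_neq0 : D != 0.
Proof. by rewrite pnatr_eq0 -lt0n !muln_gt0 !prime_gt0. Qed.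

Lemma bp_D_pi : D = pi * (pi^* * (2 * p2)%:R).
Proof. by rewrite mulrA (gp_norm hpi) -natrM /D; congr (_%:R); lia. Qed.

Lemma bp_ndvd_D_pi : ~ gdvd pi (pi^* * (2 * p2)%:R).
Proof.
have Zpi := gp_ZI hpi.
case/(gprime_mul hpi) => [||pp|/(gprime_nat hpi)]; [exact: ZI_conj|exact: ZI_nat| |].
  by case: (gprime_not_dvd1 hpi); case: (gdvd_coprime_unit Zpi bp_coprime_conj pp).
by rewrite (negPf bp_ndvd22).
Qed.

Lemma bp_local_pi C : ZI C -> ~ gdvd pi C -> QI_norm D C -> exists s, ZI s /\ gdvd pi (s ^+ 2 - C).
Proof.
move=> ZC nC NC; apply: (local_norm_square hpi _ bp_D_pi bp_ndvd_D_pi ZC nC NC).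
by apply: ZIM; [apply: ZI_conj; apply: gp_ZI hpi | apply: ZI_nat].
Qed.

(** The sign does not matter because -1 is the square of i. *)
Lemma bp_local_pi_nat C (n : nat) : C = n%:R \/ C = - n%:R -> ~~ (p1 %| n)%N ->
  QI_norm D C -> qres n p1.
Proof.
move=> DC p1n NC; have nC : ~ gdvd pi n%:R by move/(gprime_nat hpi); apply/negP.
case: DC NC => -> NC.
  have [s [Zs qs]] := bp_local_pi (ZI_nat n) nC NC.
  exact: gsquare_qres hpi bp_coprime_conj Zs qs.
have [||s [Zs qs]] := bp_local_pi _ _ NC.
- by apply: ZIN; apply: ZI_nat.
- by move=> /gdvdN; rewrite opprK.
apply: (gsquare_qres hpi bp_coprime_conj (s := 'i * s)); first by apply: ZIM => //; apply: ZI_i.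
rewrite exprMn sqrCi mulN1r -opprD -(opprK n%:R); exact: gdvdN.
Qed.

(** Passing to the complementary divisor of D makes the condition at a prime dividing n
    available. *)
Lemma bp_compl C (n m : nat) : (n * m = 2 * p1 * p2)%N -> C = n%:R \/ C = - n%:R -> QI_norm D C ->
  exists C', (C' = m%:R \/ C' = - m%:R) /\ QI_norm D C'.
Proof.
move=> nm DC NC; have n0 : n%:R != 0 :> algC.
  by have := bp_D_neq0; rewrite /D -nm natrM mulf_eq0 negb_or => /andP[].
have QD : QI D by apply: sf_nat; apply: subfield_QI.
exists (- D / C); split; last first.
  apply: QI_norm_compl => //; first exact: bp_D_neq0.
  by case: DC => ->; rewrite ?oppr_eq0.
by case: DC => ->; rewrite /D -nm natrM; [right|left]; field.
Qed.

End LocalPi.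

Section BiprimeNorms.
Variables (p1 p2 : nat) (pi rho : algC) (H : biprime p1 p2 pi rho).
Let D : algC := (2 * p1 * p2)%:R.
Let H' := biprime_sym H.
Let pr1 : prime p1 := gp_prime (bp_pi H).
Let pr2 : prime p2 := gp_prime (bp_rho H).

Lemma bp_DC : (2 * p2 * p1)%:R = D. Proof. by rewrite /D mulnAC. Qed.

Lemma bp_local_rho_nat C (n : nat) : C = n%:R \/ C = - n%:R -> ~~ (p2 %| n)%N ->
  QI_norm D C -> qres n p2.
Proof. by move=> DC nd; rewrite -bp_DC; apply: (bp_local_pi_nat H' DC nd). Qed.

Lemma bp_not_norm2 C : C = 2%:R \/ C = - 2%:R -> ~ QI_norm D C.
Proof.
move=> DC NC; apply: (bp_res2 H); split.
  exact: (bp_local_pi_nat H DC (bp_ndvd2 H)).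
exact: (bp_local_rho_nat DC (bp_ndvd2 H')).
Qed.

(** At p2 the norm condition makes p1 a residue, and by reciprocity p2 is a residue modulo p1. At p1
    the complementary norm 2 p2 has to be used; it makes 2 p2, hence 2, a residue modulo p1.
    Together this contradicts [bp_res1]. *)
Lemma bp_not_norm_p1 C : C = p1%:R \/ C = - p1%:R -> ~ QI_norm D C.
Proof.
move=> DC NC; have q12 : qres p1 p2 := bp_local_rho_nat DC (bp_ndvd12 H') NC.
apply: (bp_res1 H); split=> //.
have q21 : qres p2 p1.
  by apply: quad_reciprocity_1mod4 q12; rewrite // ?(bp_mod2 H) // eq_sym (bp_neq H).
have [|C' [DC' NC']] := @bp_compl _ _ _ _ H _ p1 (2 * p2) _ DC NC; first by lia.
have q2 := bp_local_pi_nat H DC' (bp_ndvd22 H) NC'.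
exact: qres_div (bp_ndvd12 H) q2 q21.
Qed.

End BiprimeNorms.

Section BiprimeNorms2.
Variables (p1 p2 : nat) (pi rho : algC) (H : biprime p1 p2 pi rho).
Let D : algC := (2 * p1 * p2)%:R.
Let H' := biprime_sym H.

Lemma bp_not_norm_p2 C : C = p2%:R \/ C = - p2%:R -> ~ QI_norm D C.
Proof. by move=> DC; rewrite /D mulnAC; apply: (bp_not_norm_p1 H'). Qed.

Lemma bp_not_norm_2p1 C : C = (2 * p1)%:R \/ C = - (2 * p1)%:R -> ~ QI_norm D C.
Proof.
move=> DC NC; have [|C' [DC' NC']] := @bp_compl _ _ _ _ H _ (2 * p1) p2 _ DC NC; first by lia.
exact: bp_not_norm_p2 NC'.
Qed.

Lemma bp_not_norm_2p2 C : C = (2 * p2)%:R \/ C = - (2 * p2)%:R -> ~ QI_norm D C.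
Proof.
move=> DC NC; have [|C' [DC' NC']] := @bp_compl _ _ _ _ H _ (2 * p2) p1 _ DC NC; first by lia.
exact: bp_not_norm_p1 H _ DC' NC'.
Qed.

Lemma bp_not_norm_p1p2 C : C = (p1 * p2)%:R \/ C = - (p1 * p2)%:R -> ~ QI_norm D C.
Proof.
move=> DC NC; have [|C' [DC' NC']] := @bp_compl _ _ _ _ H _ (p1 * p2) 2 _ DC NC; first by lia.
exact: bp_not_norm2 H _ DC' NC'.
Qed.

(* If i is a square modulo pi, so is 2 = i^3 (1 + i)^2. *)
Lemma bp_norm_i_res C : C = 'i \/ C = - 'i -> QI_norm D C -> qres 2 p1.
Proof.
move=> DC NC; have hpi := bp_pi H.
have uC : gunit C.
  case: DC => ->; first exact: gunit_i.
  by split; [apply/ZIN/ZI_i | exists 'i; split; [apply: ZI_i | rewrite mulNr mulii opprK]].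
have nC : ~ gdvd pi C.
  by move=> pC; case: (gprime_not_dvd1 hpi); apply: gdvd_trans pC _; case: uC.
have ZC : ZI C by case: uC.
have [s [Zs qs]] := bp_local_pi H ZC nC NC.
have Zc : ZI (1 + C) by apply: ZID => //; apply: ZI1.
have C2 : C ^+ 2 = -1 by case: DC => ->; rewrite ?sqrrN sqrCi.
apply: (gsquare_qres hpi (bp_coprime_conj H) (s := s ^+ 3 * (1 + C))).
  by apply: ZIM => //; apply: ZIX.
have C3 : C ^+ 3 * (1 + C) ^+ 2 = 2%:R.
  transitivity (C ^+ 2 * (C * (1 + C ^+ 2) + 2%:R * C ^+ 2)); first by ring.
  by rewrite C2; ring.
have -> : (s ^+ 3 * (1 + C)) ^+ 2 - 2%:R =
   (s ^+ 2 - C) * ((s ^+ 4 + s ^+ 2 * C + C ^+ 2) * (1 + C) ^+ 2) by rewrite -C3; ring.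
apply: gdvdMr => //; apply: ZIM; last exact: ZIX.
by apply: ZID; [apply: ZID; [|apply: ZIM => //] | ]; apply: ZIX.
Qed.

End BiprimeNorms2.

Lemma bp_not_norm_i p1 p2 pi rho (H : biprime p1 p2 pi rho) C :
  C = 'i \/ C = - 'i -> ~ QI_norm (2 * p1 * p2)%:R C.
Proof.
move=> DC NC; apply: (bp_res2 H); split; first exact: bp_norm_i_res H _ DC NC.
by apply: (bp_norm_i_res (biprime_sym H) DC); rewrite mulnAC.
Qed.

(** The number m' is the norm of m' b + a sqrt D. *)
Lemma QI_norm_nat (D m m' a b : nat) : (m * m' = D)%N -> (m' * b ^ 2 = m * a ^ 2 + 1)%N ->
  QI_norm D%:R m'%:R.
Proof.
move=> DD e; exists (m' * b)%:R, a%:R; split; try by apply: sf_nat; apply: subfield_QI.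
rewrite -!natrX -natrM -DD; have -> : ((m' * b) ^ 2 = m * m' * a ^ 2 + m')%N by nia.
by rewrite natrD; ring.
Qed.

Lemma dvdn_prime_mul (p m d : nat) : prime p -> (d %| p * m)%N ->
  (d %| m)%N \/ exists2 d', (d = p * d')%N & (d' %| m)%N.
Proof.
move=> pr_p dv; have [pd|npd] := boolP (p %| d)%N.
  right; case/dvdnP: pd dv => k ->; rewrite mulnC dvdn_pmul2l ?prime_gt0 // => km.
  by exists k.
by left; rewrite -(Gauss_dvdr _ (n := p)) // coprime_sym prime_coprime.
Qed.

Lemma dvdn_2pq (p q d : nat) : prime p -> prime q -> (d %| 2 * p * q)%N ->
  d \in [:: 1; 2; p; q; 2 * p; 2 * q; p * q; 2 * p * q]%N.
Proof.
move=> pr_p pr_q; rewrite -mulnA.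
have q_dvd d' : (d' %| q)%N -> d' = 1%N \/ d' = q.
  by case/primeP: pr_q => _ dq /dq /orP[] /eqP; [left|right].
have pq_dvd d' : (d' %| p * q)%N -> [\/ d' = 1%N, d' = q, d' = p | d' = (p * q)%N].
  case/(dvdn_prime_mul pr_p) => [/q_dvd[]|[e -> /q_dvd[]]] ->; rewrite ?muln1.
  - by constructor 1.
  - by constructor 2.
  - by constructor 3.
  - by constructor 4.
by case/(dvdn_prime_mul (isT : prime 2)) => [/pq_dvd[]|[e -> /pq_dvd[]]] ->;
  rewrite !inE ?muln1 ?mulnA ?eqxx ?orbT.
Qed.

(** In the splitting D = m m' of [pell_half] the factor m' is a norm, which excludes every divisor
    of D except 1 and D, and m' = D is the equation sought. An odd y in x^2 = D y^2 + 1 would make x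
    odd, and then x^2 - 1 is divisible by 4 while D y^2 is not. *)
Lemma bp_neg_pell p1 p2 pi rho (H : biprime p1 p2 pi rho) :
  exists x y : nat, (x ^ 2 + 1 = 2 * p1 * p2 * y ^ 2)%N.
Proof.
have pr1 := gp_prime (bp_pi H); have pr2 := gp_prime (bp_rho H).
have o1 := mod4_odd (bp_mod1 H); have o2 := mod4_odd (bp_mod2 H).
have [||m [m' [a [b [Dm e m'1]]]]] := @pell_half (2 * p1 * p2).
- move=> a b; rewrite -mulnA; apply: prime_part_nonsquare => //.
  by rewrite dvdn2 oddM o1 o2.
- move=> x y e; apply/negP => oy.
  have : odd (x ^ 2) by rewrite e addn1 oddS -!mulnA mul2n odd_double.
  rewrite oddX /= => ox.
  have [t Dt] : exists t, (y = t.*2.+1)%N by exists y./2; rewrite -{1}[y]odd_double_half oy.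
  have [u Du] : exists u, (x = u.*2.+1)%N by exists x./2; rewrite -{1}[x]odd_double_half ox.
  have [v Dv] : exists v, (p1 * p2 = v.*2.+1)%N.
    by exists (p1 * p2)./2; rewrite -[LHS]odd_double_half oddM o1 o2.
  move: e; rewrite -(mulnA 2 p1 p2) Dv Du Dt -!mul2n => e.
  have : (4 * (u ^ 2 + u) = 2 * ((2 * v).+1 * (2 * t).+1 ^ 2))%N by nia.
  by clear; move=> /(congr1 (fun n => n %% 4)%N); nia.
have m'D : (m' %| 2 * p1 * p2)%N by rewrite -Dm dvdn_mull.
have N := QI_norm_nat Dm e.
have := dvdn_2pq pr1 pr2 m'D; rewrite !inE (negPf m'1) /= => /orP[/eqP E|/orP[/eqP E|/orP[/eqP E|/orP[/eqP E|/orP[/eqP E|/orP[/eqP E|/eqP E]]]]]].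
- by rewrite E in N; case: (bp_not_norm2 H (or_introl (erefl _)) N).
- by rewrite E in N; case: (bp_not_norm_p1 H (or_introl (erefl _)) N).
- by rewrite E in N; case: (bp_not_norm_p2 H (or_introl (erefl _)) N).
- by rewrite E in N; case: (bp_not_norm_2p1 H (or_introl (erefl _)) N).
- by rewrite E in N; case: (bp_not_norm_2p2 H (or_introl (erefl _)) N).
- by rewrite E in N; case: (bp_not_norm_p1p2 H (or_introl (erefl _)) N).
have D0 : (0 < 2 * p1 * p2)%N by rewrite !muln_gt0 !prime_gt0.
have m1 : m = 1%N by apply/eqP; rewrite -(eqn_pmul2r D0) mul1n -{1}E Dm.
by exists a, b; rewrite -E e m1 mul1n.
Qed.

Lemma gprime_2 : gprime (1 + 'i) 2.
Proof.
split=> //; first by apply: ZID; [apply: ZI1 | apply: ZI_i].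
by rewrite rmorphD rmorph1 /= conjCi mulrC -subr_sqr sqrCi expr1n opprK.
Qed.

(* A prime factor of p in Z[i] is gcd(p, x + i), where x^2 = -1 mod p. *)
Lemma gprime_exists (p : nat) : prime p -> (p %% 4 = 1)%N -> exists q, gprime q p.
Proof.
move=> pr_p p1; have [x [y e]] := neg_pell_prime pr_p p1.
pose X : algC := x%:R + 'i; have ZX : ZI X by apply: ZID; [apply: ZI_nat | apply: ZI_i].
have XX : X * X^* = p%:R * (y ^ 2)%:R.
  rewrite /X rmorphD rmorph_nat /= conjCi -natrM -e mulrC -subr_sqr sqrCi opprK.
  by rewrite natrD natrX.
have p0 : p%:R != 0 :> algC by rewrite pnatr_eq0 -lt0n prime_gt0.
have pX : ~ gdvd p%:R X.
  case=> _ [[a [b ->]] E].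
  have /ZI_inj[] : x%:~R + 'i * 1%:~R = (p%:Z * a)%:~R + 'i * (p%:Z * b)%:~R :> algC.
    by rewrite !intrM -!pmulrn mulr1 -[LHS]/X E; ring.
  move=> _ /(congr1 absz); rewrite abszM /= => /esym/eqP; rewrite muln_eq1 => /andP[/eqP p11 _].
  by rewrite p11 in pr_p.
have [g [u [v [Dg Zu Zv g0 [[z [Zz Dp]] gX]]]]] := gcd_exists (ZI_nat p) ZX p0.
have Zg : ZI g by rewrite Dg; apply: ZID; apply: ZIM => //; apply: ZI_nat.
have [n Dn] := ZI_cnorm Zg; have [m Dm] := ZI_cnorm Zz.
have /eqP : (n * m)%:R = (p ^ 2)%:R :> algC.
  by rewrite natrM -Dn -Dm -cnormM -Dp /cnorm rmorph_nat natrX.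
rewrite eqr_nat => /eqP nm; exists g; split=> //.
suff -> : p = n by [].
have : (n %| p ^ 2)%N by rewrite -nm dvdn_mulr.
case/(dvdn_pfactor _ _ pr_p) => [[|[|[|//]]]] _ En; last 2 first.
- by rewrite En expn1.
- have m1 : m = 1%N.
    by apply/eqP; rewrite -(eqn_pmul2l (_ : 0 < n)%N) ?muln1 ?nm ?En // expn_gt0 prime_gt0.
  have [_ [w [Zw zw]]] : gunit z by apply: cnorm1_unit; rewrite // Dm m1.
  case: pX; apply: gdvd_trans gX; exists w; split=> //.
  by rewrite Dp -mulrA -zw mulr1.
have [_ g1] : gunit g by apply: cnorm1_unit; rewrite // Dn En.
(* g is a unit, hence p divides X^*, being coprime to X *)
have cop : gcoprime p%:R X.
  case: g1 => w [Zw gw]; exists (w * u), (w * v); split; [exact: ZIM|exact: ZIM|].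
  by rewrite [RHS]gw Dg; ring.
have : gdvd p%:R X^*.
  apply: gcoprime_gdvd cop _; first exact: ZI_conj.
  by rewrite XX; apply: gdvdMr; [apply: ZI_nat | apply: gdvdxx].
by move/gdvd_conj; rewrite conjCK rmorph_nat.
Qed.

(** * Ideal classes of order two in Q(i, sqrt(2 p1 p2)) *)

(** Here k = Q(i, sqrt(2 P)), and [tau] restricts to the generator of its Galois group over Q(i).
    The theorem uses P = p1 p2. *)
Record quad_data (P : nat) (s : algC) (k : nfield) (tau : {rmorphism algC -> algC}) : Prop := {
  qd_k : forall x, k x <-> quad_ext QI s x;
  qd_s : s ^+ 2 = (2 * P)%:R;
  qd_tau_i : tau 'i = 'i;
  qd_tau_s : tau s = - s;
  qd_P : (P %% 4 = 1)%N }.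

Section QuadData.
Variables (P : nat) (s : algC) (k : nfield) (tau : {rmorphism algC -> algC}).
Hypothesis H : quad_data P s k tau.

Lemma qd_P0 : (0 < P)%N.
Proof. by have := qd_P H; case: P. Qed.

Lemma qd_s0 : s != 0.
Proof.
have : s ^+ 2 != 0 by rewrite (qd_s H) pnatr_eq0 -lt0n muln_gt0 qd_P0.
by rewrite expf_eq0.
Qed.

Lemma qd_subfield : subfield k.
Proof.
have S : subfield (quad_ext QI s).
  by apply: (subfield_quad_ext subfield_QI); rewrite (qd_s H); apply: (sf_nat subfield_QI).
have E := qd_k H; split=> [|x y /E kx /E ky|x y /E kx /E ky|x /E kx]; apply/E.
- exact: (sf1 S).
- exact: (sfB S).
- exact: (sfM S).
- exact: (sfV S).
Qed.
Let sk := qd_subfield.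

Lemma qd_QI x : QI x -> k x.
Proof. by move=> Qx; apply/(qd_k H); apply: quad_ext_base => //; apply: subfield_QI. Qed.

Lemma qd_ks : k s.
Proof. by apply/(qd_k H); apply: quad_ext_gen; apply: subfield_QI. Qed.

Lemma qd_tau_QI x : QI x -> tau x = x.
Proof.
case/QIP=> a [b ->].
by rewrite rmorphD fmorph_rat [tau ('i * _)]rmorphM /= (qd_tau_i H) fmorph_rat.
Qed.

Lemma qd_tau_k x : k x -> k (tau x).
Proof.
case/(qd_k H)=> a [b [Qa Qb ->]]; rewrite rmorphD rmorphM /= (qd_tau_s H) !qd_tau_QI //.
by apply: sfD => //; [apply: qd_QI | apply: sfM => //; [apply: sfN => //; apply: qd_ks | apply: qd_QI]].
Qed.

Lemma qd_tauK x : k x -> tau (tau x) = x.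
Proof.
case/(qd_k H)=> a [b [Qa Qb ->]].
by rewrite !(rmorphD, rmorphM, qd_tau_s H, rmorphN, qd_tau_QI Qa, qd_tau_QI Qb) /= opprK.
Qed.

Lemma qd_fix x : k x -> tau x = x -> QI x.
Proof.
case/(qd_k H)=> a [b [Qa Qb ->]].
rewrite rmorphD rmorphM /= (qd_tau_s H) !qd_tau_QI // => /addrI /eqP.
rewrite mulNr eqNr mulf_eq0 (negPf qd_s0) /= => /eqP->.
by rewrite mulr0 addr0.
Qed.

Lemma qd_normE x : k x -> exists a b, [/\ QI a, QI b & x * tau x = a ^+ 2 - (2 * P)%:R * b ^+ 2].
Proof.
case/(qd_k H)=> a [b [Qa Qb ->]]; exists a, b; split=> //.
by rewrite rmorphD rmorphM /= (qd_tau_s H) !qd_tau_QI // -(qd_s H); ring.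
Qed.

Lemma qd_O_ZI x : ZI x -> Oint k x.
Proof. by move=> Zx; split; [apply/qd_QI/ZI_QI | apply: ZI_Aint]. Qed.

Lemma qd_O_tau x : Oint k x -> Oint k (tau x).
Proof. by move=> [kx Ax]; split; [apply: qd_tau_k | rewrite Aint_aut]. Qed.

Lemma qd_O_fix x : Oint k x -> tau x = x -> ZI x.
Proof. by move=> [kx Ax] /(qd_fix kx) Qx; apply: QI_Aint_ZI. Qed.

Lemma qd_O_quad x t n : k x -> ZI t -> ZI n -> x ^+ 2 = t * x - n -> Oint k x.
Proof.
by move=> kx Zt Zn e; split=> //; apply: (Aint_quad (t := t) (n := n)); rewrite // ZI_Aint.
Qed.

Lemma qd_N_ZI x : Oint k x -> ZI (x * tau x).
Proof.
move=> Ox; have [kx _] := Ox; apply: qd_O_fix; first by apply: OintM => //; apply: qd_O_tau.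
by rewrite rmorphM /= qd_tauK // mulrC.
Qed.

Lemma qd_T_ZI x : Oint k x -> ZI (x + tau x).
Proof.
move=> Ox; have [kx _] := Ox; apply: qd_O_fix; first by apply: OintD => //; apply: qd_O_tau.
by rewrite rmorphD /= qd_tauK // addrC.
Qed.

(** Because 2 is - i (1 + i)^2, dividing s by 1 + i removes the factor 2: this generator of k over
    Q(i) is an integer with square - i P. *)
Definition qd_theta : algC := s / (1 + 'i).
Local Notation theta := qd_theta.

Lemma qd_theta2 : theta ^+ 2 = - 'i * P%:R.
Proof.
have i2 : (1 + 'i) ^+ 2 = 2%:R * 'i :> algC.
  by rewrite sqrrD expr1n sqrCi mul1r mulr_natl; ring.
rewrite /qd_theta expr_div_n (qd_s H) i2 natrM -mulf_div divff ?pnatr_eq0 // mul1r.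
by rewrite invCi mulrC.
Qed.

Lemma qd_O_theta : Oint k theta.
Proof.
split.
  apply: sf_div => //; first exact: qd_ks.
  by apply: qd_QI; apply: ZI_QI; apply: gp_ZI gprime_2.
by apply: Aint_sqr; rewrite qd_theta2 rpredM ?rpredN ?Aint_i // Aint_Cnat.
Qed.

Lemma qd_tau_theta : tau theta = - theta.
Proof. by rewrite /qd_theta fmorph_div rmorphD rmorph1 /= (qd_tau_i H) (qd_tau_s H) mulNr. Qed.

(** The number v = i theta (x - tau x) is an integer fixed by tau, hence Gaussian. This relation
    between the trace and the norm of an integer replaces an integral basis of k. *)
Lemma qd_disc x : Oint k x ->
  exists v, ZI v /\ v ^+ 2 = 'i * (P%:R * ((x + tau x) ^+ 2 - 4%:R * (x * tau x))).
Proof.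
move=> Ox; have [kx _] := Ox; exists ('i * theta * (x - tau x)); split.
  apply: qd_O_fix.
    apply: OintM => //; first apply: OintM => //; first exact/qd_O_ZI/ZI_i.
      exact: qd_O_theta.
    by apply: OintB => //; apply: qd_O_tau.
  rewrite [tau (_ * (x - _))]rmorphM [tau ('i * _)]rmorphM /= (qd_tau_i H) qd_tau_theta.
  by rewrite rmorphB /= qd_tauK //; ring.
transitivity ('i ^+ 2 * theta ^+ 2 * (x - tau x) ^+ 2); first by ring.
by rewrite sqrCi qd_theta2; ring.
Qed.

(* q is a prime of Z[i] that ramifies in k; the last field says that the ideal of [ram_ideal]
   has square (q) and not only a square contained in (q). *)
Record ramified (q : algC) : Prop := {
  rm_gprime : exists p, gprime q p;
  rm_trace : forall x, Oint k x -> gdvd q (x * tau x) -> gdvd q (x + tau x);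
  rm_gen : exists y y' a b, [/\ Oint k y /\ gdvd q (y * tau y), Oint k y' /\ gdvd q (y' * tau y'),
     ZI a, ZI b & q = a * (y * y') + b * q ^+ 2] }.

(** When q divides the norm, q divides v in [qd_disc]; as q divides P only once, it divides the
    discriminant T^2 - 4 N and so the trace T. With u q + v P' = 1 one has q = u q^2 + i v theta^2,
    so theta generates the ideal together with q. *)
Lemma ramified_divisor q p P' : gprime q p -> ZI P' -> P%:R = q * P' -> ~ gdvd q P' -> ramified q.
Proof.
move=> hq ZP' DP nqP'; have Zq := gp_ZI hq; have q0 := gprime_neq0 hq.
have cop := gprime_coprime hq ZP' nqP'.
split; first by exists p.
  move=> x Ox qN; have [v [Zv Dv]] := qd_disc Ox.
  have ZT := qd_T_ZI Ox; have ZN := qd_N_ZI Ox.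
  have Zd : ZI ((x + tau x) ^+ 2 - 4%:R * (x * tau x)).
    by apply: ZIB; [apply: ZIX | apply: ZIM => //; apply: ZI_nat].
  have [w [Zw Dw]] : gdvd q v.
    apply: (gprime_sqr hq) => //; rewrite Dv DP; apply: gdvdMl; first exact: ZI_i.
    by rewrite -mulrA; apply: gdvdMr; [apply: ZIM | apply: gdvdxx].
  have qd : gdvd q ((x + tau x) ^+ 2 - 4%:R * (x * tau x)).
    apply: (gcoprime_gdvd Zd cop); exists (- 'i * w ^+ 2); split.
      by apply: ZIM; [apply/ZIN/ZI_i | apply: ZIX].
    apply: (mulfI q0); rewrite (mulrA q P') -DP.
    have -> : q * (q * (- 'i * w ^+ 2)) = - 'i * (q * w) ^+ 2 by ring.
    by rewrite -Dw Dv mulNr ['i * (_ * _)]mulrA mulii mulN1r opprK.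
  apply: (gprime_sqr hq) => //.
  rewrite -(subrK (4%:R * (x * tau x)) ((x + tau x) ^+ 2)); apply: gdvdD => //.
  by apply: gdvdMl => //; apply: ZI_nat.
have Ot : Oint k theta /\ gdvd q (theta * tau theta).
  split; first exact: qd_O_theta.
  rewrite qd_tau_theta mulrN -expr2 qd_theta2 mulNr opprK DP.
  by apply: gdvdMl; [apply: ZI_i | apply: gdvdMr => //; apply: gdvdxx].
have [u [v [Zu Zv uv]]] := cop; exists theta, theta, ('i * v), u; split=> //.
  by apply: ZIM => //; apply: ZI_i.
rewrite -expr2 qd_theta2 DP (_ : 'i * v * _ = - ('i * 'i) * v * (q * P')); last by ring.
by rewrite mulii opprK mul1r -{1}[q]mul1r -uv; ring.
Qed.

Lemma gdvd_i1 (a b m : int) : a + b = 2 * m -> gdvd (1 + 'i) (a%:~R + 'i * b%:~R).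
Proof.
move=> e; exists (m%:~R + 'i * (m - a)%:~R); split; first by exists m, (m - a).
have -> : b = 2 * m - a by rewrite -e; ring.
rewrite !intrD !intrN !intrM.
transitivity (a%:~R + 'i * (2 * m%:~R - a%:~R) + ('i * 'i + 1) * (m%:~R - a%:~R) : algC); last by ring.
by rewrite mulii addNr mul0r addr0.
Qed.

(** In [qd_disc] the imaginary part 2 c d of v^2 is even. As P is odd, the coordinates a, b of the
    trace have the same parity, so 1 + i divides it. For P = 4 m + 1 the product (1 + theta) (1 -
    theta) = 1 + i P equals (1 + i) (1 + 2 m (1 + i)), which expresses 1 + i as required. *)
Lemma ramified_i1 : ramified (1 + 'i).
Proof.
have [m Dm] : exists m : nat, P = (m * 4 + 1)%N by exists (P %/ 4)%N; rewrite {1}(divn_eq P 4) (qd_P H).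
have i2 : (1 + 'i) ^+ 2 = 2%:R * 'i :> algC.
  by rewrite sqrrD expr1n sqrCi mul1r mulr_natl; ring.
split; first by exists 2%N; apply: gprime_2.
  move=> x Ox _; have [v [[c [d Dv]] e]] := qd_disc Ox.
  have [a [b DT]] := qd_T_ZI Ox; have [n1 [n2 DN]] := qd_N_ZI Ox.
  have E : v ^+ 2 = 'i * (P%:R * ((a%:~R + 'i * b%:~R) ^+ 2 - 4%:R * (n1%:~R + 'i * n2%:~R))).
    by rewrite e DT DN.
  have {E e} : (c ^+ 2 - d ^+ 2)%:~R + 'i * (2 * c * d)%:~R =
     (- (P%:Z * (2 * a * b - 4 * n2)))%:~R + 'i * (P%:Z * (a ^+ 2 - b ^+ 2 - 4 * n1))%:~R :> algC.
    have sq (t u : algC) : (t + 'i * u) ^+ 2 = t ^+ 2 - u ^+ 2 + 'i * (2%:R * t * u).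
      transitivity (t ^+ 2 + ('i * 'i) * u ^+ 2 + 'i * (2%:R * t * u)); first by ring.
      by rewrite mulii; ring.
    transitivity (v ^+ 2); first by rewrite Dv sq !(intrD, intrN, intrM, rmorphXn) /=; ring.
    rewrite E sq !(intrD, intrN, intrM, rmorphXn) /= -!pmulrn.
    transitivity (P%:R * (('i * 'i) * (2%:R * a%:~R * b%:~R - 4%:R * n2%:~R) +
       'i * (a%:~R ^+ 2 - b%:~R ^+ 2 - 4%:R * n1%:~R)) : algC); first by ring.
    by rewrite mulii; ring.
  case/ZI_inj => _ e2; rewrite DT.
  have [t Dt] : exists t, a + b = 2 * t.
    exists ((a + b) %/ 2)%Z.
    have := divz_eq (a + b) 2; have := modz_ge0 (a + b) (isT : 2 != 0 :> int).
    have := ltz_pmod (a + b) (isT : 0 < 2 :> int).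
    move: (_ %/ _)%Z (_ %% _)%Z => t r r1 r0 Dab.
    suff : r = 0 by lia.
    apply/eqP; apply: contraT => rn; have r1' : r = 1 by lia.
    by exfalso; move: e2 Dab; rewrite Dm r1'; clear; nia.
  exact: gdvd_i1 Dt.
have Z2 : ZI (1 + 2%:R * m%:R * (1 + 'i)).
  apply: ZID; first exact: ZI1.
  by apply: ZIM; [rewrite -natrM; apply: ZI_nat | apply: gp_ZI gprime_2].
have E : 1 - theta ^+ 2 = (1 + 'i) * (1 + 2%:R * m%:R * (1 + 'i)).
  rewrite qd_theta2 Dm natrD natrM.
  transitivity (1 + 'i + (2%:R * m%:R) * (2%:R * 'i) : algC); first by ring.
  by rewrite -i2; ring.
have O1 : Oint k 1 by apply: Oint1.
exists (1 + theta), (1 - theta), 1, (- (2%:R * m%:R)); split.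
- split; first by apply: OintD => //; apply: qd_O_theta.
  rewrite rmorphD rmorph1 /= qd_tau_theta; exists (1 + 2%:R * m%:R * (1 + 'i)); split=> //.
  by rewrite -E; ring.
- split; first by apply: OintB => //; apply: qd_O_theta.
  rewrite rmorphB rmorph1 /= qd_tau_theta; exists (1 + 2%:R * m%:R * (1 + 'i)); split=> //.
  by rewrite -E; ring.
- exact: ZI1.
- by apply: ZIN; rewrite -natrM; apply: ZI_nat.
- rewrite (_ : (1 + theta) * (1 - theta) = 1 - theta ^+ 2); last by ring.
  by rewrite E; ring.
Qed.

End QuadData.

(** For a ramified q this is the prime of k above q. Describing it by norms makes it available
    without factorization of ideals. *)
Definition ram_ideal (k : nfield) (tau : algC -> algC) (q x : algC) : Prop :=
  Oint k x /\ gdvd q (x * tau x).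

Section PrimeAbove.
Variables (P : nat) (s : algC) (k : nfield) (tau : {rmorphism algC -> algC}).
Hypothesis H : quad_data P s k tau.
Let sk := qd_subfield H.
Local Notation ramified := (ramified k tau).
Local Notation Ok := (Oint k).
Local Notation J := (ram_ideal k tau).

Section OnePrime.
Variables (q : algC) (rq : ramified q).

Lemma rm_ZI : ZI q. Proof. by case: (rm_gprime rq) => p /gp_ZI. Qed.
Lemma rm_neq0 : q != 0. Proof. by case: (rm_gprime rq) => p /gprime_neq0. Qed.
Let Zq := rm_ZI.
Let q0 := rm_neq0.

(** This is the trace of x tau y, whose norm is N x N y, so [rm_trace] applies. It gives closure
    under addition. *)
Lemma ram_ideal_mixed_trace x y : J q x -> J q y -> gdvd q (x * tau y + y * tau x).
Proof.
move=> [Ox qx] [Oy qy]; have [kx _] := Ox; have [ky _] := Oy.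
have Oxy : Ok (x * tau y) by apply: OintM => //; apply: (qd_O_tau H).
have -> : x * tau y + y * tau x = x * tau y + tau (x * tau y).
  by rewrite rmorphM /= (qd_tauK H) // [y * _]mulrC.
apply: (rm_trace rq Oxy); rewrite rmorphM /= (qd_tauK H) //.
rewrite (_ : x * tau y * _ = (x * tau x) * (y * tau y)); last by ring.
by apply: gdvdMr => //; apply: (qd_N_ZI H).
Qed.

Lemma omod_ram_ideal : omod k (J q).
Proof.
split.
- by split; [apply: Oint0 | rewrite mul0r; apply: gdvd0].
- move=> x y Jx Jy; have [[Ox qx] [Oy qy]] := (Jx, Jy); split; first exact: OintD.
  rewrite rmorphD /= (_ : _ * _ = x * tau x + y * tau y + (x * tau y + y * tau x)); last by ring.
  by apply: gdvdD; [apply: gdvdD | apply: ram_ideal_mixed_trace].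
- move=> a x Oa [Ox qx]; split; first exact: OintM.
  rewrite rmorphM /= mulrACA; apply: gdvdMl => //; exact: (qd_N_ZI H).
Qed.

Lemma ram_ideal_q : J q q.
Proof.
split; first exact: (qd_O_ZI H).
by rewrite (qd_tau_QI H (ZI_QI Zq)); apply: gdvdMr => //; apply: gdvdxx.
Qed.

Lemma ideal_ram_ideal : ideal k (J q).
Proof.
have mJ := omod_ram_ideal; split.
- by move=> x [].
- exact: omod0 mJ.
- exact: omodD mJ.
- exact: omodM mJ.
- by exists q; split=> //; apply: ram_ideal_q.
Qed.

(** For x, y in the ideal, x y / q is integral: x y has trace T x T y - Tr (x tau y), divisible by
    q, and norm divisible by q^2. Conversely [rm_gen] writes q as an element of the square. *)
Lemma ram_ideal_sqr : idealM (J q) (J q) = scale q Ok.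
Proof.
have mJ := omod_ram_ideal; have mq := omod_scale q (omod_Oint sk).
apply: pred_ext => x; split.
  apply: idealM_min => [||{}x y Jx Jy]; [exact: omod0 mq | exact: omodD mq |].
  have [[Ox qx] [Oy qy]] := (Jx, Jy); have [kx _] := Ox; have [ky _] := Oy.
  have [t [Zt Dt]] := rm_trace rq Ox qx; have [u [Zu Du]] := rm_trace rq Oy qy.
  have [v [Zv Dv]] := qx; have [w [Zw Dw]] := qy.
  have [r [Zr Dr]] := ram_ideal_mixed_trace Jx Jy.
  exists (x * y / q); split; last by rewrite [RHS]mulrC divfK.
  apply: (qd_O_quad (t := q * (t * u) - r) (n := v * w)).
  - by apply: sf_div => //; [apply: sfM | apply: (qd_QI H); apply: ZI_QI].
  - by apply: ZIB => //; do !apply: ZIM.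
  - exact: ZIM.
  have e1 : x * y + tau x * tau y = q * (q * (t * u) - r).
    rewrite mulrBr -Dr (_ : q * (q * (t * u)) = (q * t) * (q * u)); last by ring.
    by rewrite -Dt -Du; ring.
  have e2 : (x * y) * (tau x * tau y) = q ^+ 2 * (v * w).
    rewrite (_ : q ^+ 2 * _ = (q * v) * (q * w)); last by ring.
    by rewrite -Dv -Dw; ring.
  apply: (mulfI (expf_neq0 2 q0)); transitivity ((x * y) ^+ 2); first by field.
  transitivity (q * (q * (t * u) - r) * (x * y) - q ^+ 2 * (v * w)); last by field.
  by rewrite -e1 -e2; ring.
have mJJ : omod k (idealM (J q) (J q)) by apply: omod_idealM.
case=> o [Oo ->]; rewrite mulrC; apply: (omodM mJJ) => //.
have [y [y' [a [b [Jy Jy' Za Zb e]]]]] := rm_gen rq.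
suff : idealM (J q) (J q) (a * (y * y') + b * q ^+ 2) by rewrite -e.
apply: (omodD mJJ); apply: (omodM mJJ); do ?exact: (qd_O_ZI H).
  exact: idealM_mem.
by rewrite expr2; apply: idealM_mem; apply: ram_ideal_q.
Qed.

(** An element of Q with norm prime to q would put 1 into Q. Conversely, if q divides N x then x^2 =
    T x - N x is a multiple of q, so x lies in the prime Q. *)
Lemma ram_idealP Q : prime_ideal k Q -> Q q -> Q = J q.
Proof.
move=> [[QO Q0 QD QM _] Q1 Qprime] Qq; apply: pred_ext => x; split=> [Qx|[Ox qN]].
  have Ox := QO _ Qx; split=> //; have ZN := qd_N_ZI H Ox.
  have [p hq] := rm_gprime rq; apply: Classical_Prop.NNPP => nq.
  have [u [v [Zu Zv e]]] := gprime_coprime hq ZN nq.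
  have QN : Q (x * tau x) by rewrite mulrC; apply: QM => //; apply: (qd_O_tau H).
  by apply: Q1; rewrite -e; apply: QD; apply: QM => //; apply: (qd_O_ZI H).
have : Q (x * x).
  have -> : x * x = x * (x + tau x) - x * tau x by ring.
  have [t [Zt ->]] := rm_trace rq Ox qN; have [n [Zn ->]] := qN.
  have -> : x * (q * t) - q * n = (x * t - n) * q by ring.
  by apply: QM => //; apply: OintB => //; [apply: OintM => // |]; apply: (qd_O_ZI H).
by case/Qprime.
Qed.

Lemma ram_ideal_tau x : J q x -> J q (tau x).
Proof.
by move=> [Ox qN]; split; [apply: (qd_O_tau H) | rewrite (qd_tauK H) 1?mulrC //; case: Ox].
Qed.

End OnePrime.

(* This is the image of I under tau, because tau is an involution on k. *)
Definition conj_ideal (I : algC -> Prop) (x : algC) : Prop := k x /\ I (tau x).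

Lemma scale_Ok_div a b : a != 0 -> k a -> k b -> b != 0 -> scale a Ok = scale b Ok ->
  Ok (a / b) /\ Ok (b / a).
Proof.
move=> a0 ka kb b0 e.
have [o [Oo Da]] : scale b Ok a by rewrite -e; exists 1; rewrite mulr1; split=> //; apply: Oint1.
have [o' [Oo' Db]] : scale a Ok b by rewrite e; exists 1; rewrite mulr1; split=> //; apply: Oint1.
by split; [rewrite {1}Da | rewrite {1}Db]; rewrite mulrAC divff // mul1r.
Qed.

(** * Descent on the ideals invariant under tau *)

Section Strip.
Variables (qs : seq algC).
Hypothesis qs_ram : forall q, q \in qs -> ramified q.
Hypothesis qs_all : forall r, ZI r -> (forall q, q \in qs -> ~ gdvd q r) ->
  gcoprime r (4%:R * (2 * P)%:R).

Record inv_ideal (I : algC -> Prop) : Prop := {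
  ii_omod : omod k I;
  ii_sub : forall x, I x -> k x;
  ii_tau : forall x, I x -> I (tau x) }.

(* Base case: r is coprime to the discriminant. With I cap Z[i] = (n), n divides r, r divides n^2,
   and n^2 divides 4Dr since 2 sqrt(D) I is contained in (n); hence I = (n). *)
Lemma inv_ideal_coprime I r : inv_ideal I -> ZI r -> r != 0 -> idealM I I = scale r Ok ->
  gcoprime r (4%:R * (2 * P)%:R) -> exists n, [/\ k n, n != 0 & I = scale n Ok].
Proof.
move=> [mI kI tI] Zr r0 II cop.
have IO x : I x -> Ok x.
  move=> Ix; split; first exact: kI.
  have [o [[_ Ao] e]] : scale r Ok (x * x) by rewrite -II; apply: idealM_mem.
  by apply: Aint_sqr; rewrite expr2 e rpredM //; apply: ZI_Aint.
have Ir : I r.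
  have : idealM I I r by rewrite II; exists 1; rewrite mulr1; split=> //; apply: Oint1.
  apply: idealM_min; [exact: omod0 mI | exact: omodD mI | move=> x y Ix Iy].
  by apply: (omodM mI) => //; apply: IO.
have OZ z : ZI z -> Ok z by apply: (qd_O_ZI H).
have [||||n [[In Zn] n0 nI]] := @ZI_PID (fun z => I z /\ ZI z).
- by move=> x [].
- by move=> x y [Ix Zx] [Iy Zy]; split; [apply: (omodD mI) | apply: ZID].
- by move=> a x Za [Ix Zx]; split; [apply: (omodM mI) => //; apply: OZ | apply: ZIM].
- by exists r.
have kn : k n by case: (OZ _ Zn).
have [n' [Zn' Dr]] : gdvd n r by apply: nI.
have [m [Zm Dm]] : gdvd r (n ^+ 2).
  have [o [Oo e]] : scale r Ok (n * n) by rewrite -II; apply: idealM_mem.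
  exists o; split=> //; apply: QI_Aint_ZI; last by case: Oo.
  have -> : o = n * n / r by rewrite e mulrAC divff ?mul1r.
  by apply: (sf_div subfield_QI); [apply: (sfM subfield_QI)|]; apply: ZI_QI.
have dvd4 x y : I x -> I y -> exists o, Ok o /\ 4%:R * (2 * P)%:R * (x * y) = n ^+ 2 * o.
  (* One has 2 s z = s (z + tau z) + (s z + tau (s z)), and both traces lie in the intersection (n)
     of I with Z[i]. *)
  have half z : I z -> exists o, Ok o /\ 2%:R * s * z = n * o.
    move=> Iz; have Os : Ok s.
      split; [exact: (qd_ks H) | apply: Aint_sqr; rewrite (qd_s H) Aint_Cnat //].
    have Isz : I (s * z) by apply: (omodM mI).
    have [a [Za Da]] : gdvd n (z + tau z).
      by apply: nI; split; [apply: (omodD mI) => //; apply: tI | apply: (qd_T_ZI H); apply: IO].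
    have [b [Zb Db]] : gdvd n (s * z + tau (s * z)).
      by apply: nI; split; [apply: (omodD mI) => //; apply: tI | apply: (qd_T_ZI H); apply: IO].
    exists (s * a + b); split.
      by apply: OintD => //; [apply: OintM => //; apply: OZ | apply: OZ].
    rewrite mulrDr mulrCA -Da -Db rmorphM /= (qd_tau_s H); ring.
  move=> /half[o [Oo Dx]] /half[o' [Oo' Dy]]; exists (o * o'); split; first exact: OintM.
  rewrite -(qd_s H); transitivity ((2%:R * s * x) * (2%:R * s * y)); first by ring.
  by rewrite Dx Dy; ring.
have [o [Oo Do]] : exists o, Ok o /\ 4%:R * (2 * P)%:R * r = n ^+ 2 * o.
  have : idealM I I r by rewrite II; exists 1; rewrite mulr1; split=> //; apply: Oint1.
  apply: (@idealM_min I I (fun z => exists o, Ok o /\ 4%:R * (2 * P)%:R * z = n ^+ 2 * o)).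
  - by exists 0; rewrite !mulr0; split=> //; apply: Oint0.
  - move=> x y [o [Oo Dx]] [o' [Oo' Dy]]; exists (o + o'); split; first exact: OintD.
    by rewrite mulrDr Dx Dy mulrDr.
  - exact: dvd4.
have m4 : gdvd m (4%:R * (2 * P)%:R).
  exists o; split; last first.
    by apply: (mulIf r0); rewrite Do Dm; ring.
  apply: QI_Aint_ZI; last by case: Oo.
  have -> : o = 4%:R * (2 * P)%:R * r / n ^+ 2 by rewrite Do mulrAC divff ?mul1r ?expf_neq0.
  apply: (sf_div subfield_QI); apply: ZI_QI; last exact: ZIX.
  by do !apply: ZIM => //; apply: ZI_nat.
have copn : gcoprime n m.
  by apply: gcoprime_dvdr m4; apply: gcoprime_dvdl cop _; exists n'.
have um : gunit m.
  apply: (gdvd_coprime_unit Zm (y := n ^+ 2)).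
    by rewrite expr2; apply: gcoprimeM => //; apply: gcoprime_sym.
  by rewrite Dm; apply: gdvdMl => //; apply: gdvdxx.
exists n; split=> //; apply: (omod_sqr_principal sk mI kI kn n0).
rewrite II Dm -scaleM (scale_Oint_unit sk (u := m)) //; first exact: OZ.
  by apply: OZ; case: (gunitV um).
exact: gunit_neq0.
Qed.

(** Descent on the norm of r. If some q of the list divides r, then I1 = q^-1 I J(q) is again
    invariant, has square (r / q), and I = I1 J(q). If none does, I is principal by
    [inv_ideal_coprime]. *)
Lemma inv_ideal_classes (G : (algC -> Prop) -> Prop) :
  (forall c, k c -> c != 0 -> G (scale c Ok)) ->
  (forall q I, q \in qs -> inv_ideal I -> G I -> G (idealM I (J q))) ->
  forall I r, inv_ideal I -> ZI r -> r != 0 -> idealM I I = scale r Ok -> G I.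
Proof.
move=> Gprin GM I r iI Zr r0 II; have [N DN] := ZI_cnorm Zr.
have [d leNd] := ubnP N.
elim: d => // d IHd in N I r iI Zr r0 II DN leNd *.
have [[q [qqs qr]]|nq] := Classical_Prop.classic (exists q, q \in qs /\ gdvd q r); last first.
  have [|n [kn n0 ->]] := inv_ideal_coprime iI Zr r0 II; last exact: Gprin.
  by apply: qs_all => // q qqs qr; apply: nq; exists q.
have rq := qs_ram qqs; have q0 := rm_neq0 rq; have Zq := rm_ZI rq.
have mJ := omod_ram_ideal rq.
have [r1 [Zr1 Dr]] := qr; have [mI kI tI] := iI.
pose I1 := scale q^-1 (idealM I (J q)).
have kq : k q by apply: (qd_QI H); apply: ZI_QI.
have sub : forall x, idealM I (J q) x -> k x.
  apply: idealM_min; [exact: sf0 | exact: (sfD sk) | move=> x y /kI kx [[ky _] _]].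
  exact: sfM.
have iI1 : inv_ideal I1.
  split; first by apply: omod_scale; apply: omod_idealM.
    by move=> _ [x [/sub kx ->]]; apply: sfM => //; apply: sfV.
  move=> _ [x [Ix ->]]; exists (tau x); split; last first.
    by rewrite rmorphM /= fmorphV (qd_tau_QI H (ZI_QI Zq)).
  apply: (@idealM_min I (J q) (fun x => idealM I (J q) (tau x))) Ix.
  - by rewrite rmorph0; apply: idealM0.
  - by move=> y z; rewrite rmorphD; apply: idealMD.
  - move=> y z Iy Jz; rewrite rmorphM /=; apply: idealM_mem; first exact: tI.
    exact: ram_ideal_tau.
have E1 : I = idealM I1 (J q).
  rewrite /I1 idealM_scalel -idealMA (ram_ideal_sqr rq) idealM_scaler (idealMO sk mI).
  by rewrite scaleM mulVf // scale1.
have r10 : r1 != 0 by apply: contraNneq r0; rewrite Dr => ->; rewrite mulr0.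
rewrite E1; apply: GM => //; have [N1 DN1] := ZI_cnorm Zr1.
apply: (IHd N1 I1 r1) => //.
  rewrite /I1 idealM_scalel idealM_scaler idealMACA II (ram_ideal_sqr rq).
  rewrite idealM_scalel idealM_scaler (idealMO sk (omod_Oint sk)) !scaleM Dr.
  by congr scale; field.
have [p hq] := rm_gprime rq.
have /eqP : N%:R = (p * N1)%:R :> algC.
  by rewrite natrM -DN -DN1 Dr cnormM /cnorm (gp_norm hq).
rewrite eqr_nat => /eqP eN; have p2 := prime_gt1 (gp_prime hq).
have N10 : (0 < N1)%N by rewrite -(ltr0n algC) -DN1 lt_def cnorm_ge0 cnorm_eq0 r10.
by rewrite eN in leNd; nia.
Qed.

End Strip.

End PrimeAbove.

(** * From classes of order two to invariant ideals *)

Section Ambiguous.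
Variables (P : nat) (s : algC) (k : nfield) (tau : {rmorphism algC -> algC}).
Hypothesis H : quad_data P s k tau.
Let sk := qd_subfield H.
Local Notation Ok := (Oint k).
Local Notation conjI := (conj_ideal k tau).

Lemma conj_ideal_mem I x : k x -> I x -> conjI I (tau x).
Proof. by move=> kx Ix; split; [apply: (qd_tau_k H) | rewrite (qd_tauK H)]. Qed.

Lemma conj_ideal_scale c I : k c -> c != 0 -> conjI (scale c I) = scale (tau c) (conjI I).
Proof.
move=> kc c0; have tc0 : tau c != 0 by rewrite fmorph_eq0.
have ktc := qd_tau_k H kc.
apply: pred_ext => x; split=> [[kx [y [Iy e]]]|[y [[ky Iy] ->]]].
  exists (x / tau c); split; last by rewrite [RHS]mulrC divfK.
  split; first exact: sf_div.
  by rewrite fmorph_div /= (qd_tauK H) // e mulrAC divff // mul1r.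
split; first exact: sfM.
by exists (tau y); rewrite rmorphM /= (qd_tauK H).
Qed.

Lemma conj_idealK I : (forall x, I x -> k x) -> conjI (conjI I) = I.
Proof.
move=> kI; apply: pred_ext => x; split=> [[kx [_]]|Ix]; first by rewrite (qd_tauK H).
have kx := kI _ Ix; split=> //; split; first exact: (qd_tau_k H).
by rewrite (qd_tauK H).
Qed.

(* The content of the norm form of I: the Z[i]-ideal of all N x and Tr (x tau y) is principal,
   generated by n, and x tau y / n is integral since its trace and norm are. *)
Lemma ideal_mul_conj I : ideal k I ->
  exists n, [/\ ZI n, n != 0 & idealM I (conjI I) = scale n Ok].
Proof.
move=> idI; have mI := ideal_omod idI; have [IO _ _ _ [x0 [Ix0 x00]]] := idI.
have mA : omod k (idealM I (conjI I)) by apply: omod_idealM.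
have kI x : I x -> k x by case/IO.
have AT x y : I x -> I y -> idealM I (conjI I) (x * tau y).
  by move=> Ix Iy; apply: idealM_mem => //; apply: conj_ideal_mem => //; apply: kI.
have [||||n [[An Zn] n0 nA]] := @ZI_PID (fun z => idealM I (conjI I) z /\ ZI z).
- by move=> x [].
- by move=> x y [Ix Zx] [Iy Zy]; split; [apply: (omodD mA) | apply: ZID].
- by move=> a x Za [Ix Zx]; split; [apply: (omodM mA) => //; apply: (qd_O_ZI H) | apply: ZIM].
- exists (x0 * tau x0); split; last by rewrite mulf_neq0 ?fmorph_eq0.
  by split; [apply: AT | apply: (qd_N_ZI H); apply: IO].
have kn : k n by apply: (qd_QI H); apply: ZI_QI.
have mn := omod_scale n (omod_Oint sk).
exists n; split=> //; apply: pred_ext => x; split; last first.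
  by case=> o [Oo ->]; rewrite mulrC; apply: (omodM mA).
apply: idealM_min => [||{}x y' Ix [ky' Iy]]; [exact: omod0 mn | exact: omodD mn |].
set y := tau y' in Iy; have -> : y' = tau y by rewrite /y (qd_tauK H).
have [Ox Oy] := (IO _ Ix, IO _ Iy); have [kx _] := Ox; have [ky _] := Oy.
have [t [Zt Dt]] : gdvd n (x * tau y + y * tau x).
  apply: nA; split; first by apply: (omodD mA); apply: AT.
  have -> : x * tau y + y * tau x = x * tau y + tau (x * tau y).
    by rewrite rmorphM /= (qd_tauK H) // [y * _]mulrC.
  by apply: (qd_T_ZI H); apply: OintM => //; apply: (qd_O_tau H).
have [v [Zv Dv]] : gdvd n (x * tau x) by apply: nA; split; [apply: AT | apply: (qd_N_ZI H)].
have [w [Zw Dw]] : gdvd n (y * tau y) by apply: nA; split; [apply: AT | apply: (qd_N_ZI H)].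
exists (x * tau y / n); split; last by rewrite [RHS]mulrC divfK.
apply: (qd_O_quad (t := t) (n := v * w)) => //; last 2 first.
- exact: ZIM.
- apply: (mulfI (expf_neq0 2 n0)); transitivity ((x * tau y) ^+ 2); first by field.
  transitivity ((n * t) * (x * tau y) - (n * v) * (n * w)); last by field.
  by rewrite -Dt -Dv -Dw; ring.
by apply: sf_div => //; apply: sfM => //; apply: (qd_tau_k H).
Qed.

(** Squaring c I = I gives (c^2 nu) = (nu), so c and its inverse are integral. *)
Lemma scale_fixed_unit I nu c : omod k I -> k nu -> nu != 0 -> QI c -> c != 0 ->
  idealM I I = scale nu Ok -> scale c I = I -> gunit c.
Proof.
move=> mI knu nu0 Qc c0 II cI; have kc : k c by apply: (qd_QI H).
have e : scale (c ^+ 2 * nu) Ok = scale nu Ok.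
  by rewrite -scaleM -II expr2 -scaleM -idealM_scaler -idealM_scalel cI.
have c20 := expf_neq0 2 c0.
have [O1 O2] : Ok (c ^+ 2 * nu / nu) /\ Ok (nu / (c ^+ 2 * nu)).
  by apply: (scale_Ok_div H) e => //; [apply: mulf_neq0 | apply: sfM => //; apply: sfX].
rewrite mulfK // in O1; rewrite invfM mulrCA mulfV // mulr1 -exprVn in O2.
have Zc : ZI c by apply: QI_Aint_ZI => //; apply: Aint_sqr; case: O1.
split=> //; exists c^-1; rewrite mulfV //; split=> //.
apply: QI_Aint_ZI; first exact: (sfV subfield_QI).
by apply: Aint_sqr; case: O2.
Qed.

Hypothesis not_norm_i : forall C, C = 'i \/ C = - 'i -> ~ QI_norm (2 * P)%:R C.

(** From I^2 = (nu) and I conj(I) = (n) follows conj(I) = be I with be = n / nu. The norm of be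
    fixes I, hence is a unit of Z[i]; once it is corrected to 1, be = tau(ga) / ga, and I / ga is
    invariant. *)
Lemma exists_inv_ideal I nu : ideal k I -> k nu -> nu != 0 -> idealM I I = scale nu Ok ->
  exists c r, [/\ k c, c != 0, inv_ideal k tau (scale c I), ZI r
                & r != 0 /\ idealM (scale c I) (scale c I) = scale r Ok].
Proof.
move=> idI knu nu0 II; have mI := ideal_omod idI; have [IO _ _ _ _] := idI.
have kI x : I x -> k x by case/IO.
have [n [Zn n0 IcI]] := ideal_mul_conj idI; have kn : k n by apply: (qd_QI H); apply: ZI_QI.
have mcI : omod k (conjI I).
  split.
  - by split; [apply: sf0 | rewrite rmorph0; apply: (omod0 mI)].
  - by move=> x y [kx Ix] [ky Iy]; split; [apply: sfD | rewrite rmorphD; apply: (omodD mI)].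
  - move=> a x Oa [kx Ix]; split; first by apply: sfM => //; case: Oa.
    by rewrite rmorphM; apply: (omodM mI) => //; apply: (qd_O_tau H).
have [be [kbe be0 conjE]] : exists be, [/\ k be, be != 0 & conjI I = scale be I].
  exists (n / nu); split; [exact: sf_div | by rewrite mulf_neq0 ?invr_eq0|].
  have : scale nu (conjI I) = scale n I.
    have -> : scale nu (conjI I) = idealM I (idealM I (conjI I)).
      by rewrite idealMA II idealM_scalel (idealOM sk mcI).
    by rewrite IcI idealM_scaler (idealMO sk mI).
  by move/(scaleK nu0)->; rewrite scaleM mulrC.
have ubN : gunit (be * tau be).
  apply: (scale_fixed_unit mI knu nu0 _ _ II).
  - apply: (qd_fix H); first by apply: sfM => //; apply: (qd_tau_k H).
    by rewrite rmorphM /= (qd_tauK H) // mulrC.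
  - by rewrite mulf_neq0 ?fmorph_eq0.
  - by rewrite mulrC -scaleM -conjE -conj_ideal_scale // -conjE conj_idealK.
have {ubN} [be' [kbe' be'0 conjE' N1]] : exists be', [/\ k be', be' != 0, conjI I = scale be' I & be' * tau be' = 1].
  have i0 : 'i != 0 :> algC by apply: neq0Ci.
  have Oi : Ok 'i by apply: (qd_O_ZI H); apply: ZI_i.
  have Oi' : Ok 'i^-1 by rewrite invCi; apply: OintN.
  have [a [b [Qa Qb Nab]]] := qd_normE H kbe.
  case/gunitP: ubN => e.
  - by exists be.
  - have ki : k 'i by apply: (qd_QI H); apply: QI_i.
    exists ('i * be); split.
    + exact: sfM.
    + by rewrite mulf_neq0.
    + by rewrite conjE mulrC -scaleM (scale_omod_unit (u := 'i) mI).
    + by rewrite rmorphM /= (qd_tau_i H) mulrACA mulii e mulrNN mulr1.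
  - by case: (@not_norm_i 'i); [left | exists a, b; rewrite -Nab].
  - by case: (@not_norm_i (- 'i)); [right | exists a, b; rewrite -Nab].
(* Hilbert 90: 1 + tau be' is such a ga unless it vanishes, in which case be' = -1 and s serves. *)
have [ga [kga ga0 Dga]] : exists ga, [/\ k ga, ga != 0 & tau ga = be' * ga].
  have [e|ne] := eqVneq (1 + tau be') 0; last first.
    exists (1 + tau be'); split=> //.
      by apply: sfD; [|apply: sf1 |apply: (qd_tau_k H)].
    by rewrite rmorphD rmorph1 /= (qd_tauK H) // mulrDr mulr1 N1 addrC.
  exists s; split; [exact: (qd_ks H)|exact: (qd_s0 H)|].
  have -> : be' = -1.
    by rewrite -[be'](qd_tauK H) //; move/eqP: e; rewrite addrC addr_eq0 => /eqP->; rewrite rmorphN1.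
  by rewrite (qd_tau_s H) mulN1r.
have gai0 : ga^-1 != 0 by rewrite invr_eq0.
have kgai : k ga^-1 by apply: sfV.
have tga0 : tau ga != 0 by rewrite fmorph_eq0.
set I1 := scale ga^-1 I.
have mI1 : omod k I1 by apply: omod_scale.
have conjI1 : conjI I1 = I1.
  rewrite /I1 conj_ideal_scale // conjE' scaleM fmorphV Dga invfM mulrAC mulVf // mul1r //.
have II1 : idealM I1 I1 = scale (n / (ga * tau ga)) Ok.
  rewrite -[X in idealM _ X]conjI1 /I1 conj_ideal_scale // idealM_scalel idealM_scaler IcI !scaleM.
  by rewrite fmorphV; congr scale; field; rewrite ?ga0 ?tga0.
pose r0 := n / (ga * tau ga); have r00 : r0 != 0 by rewrite mulf_neq0 ?invr_eq0 ?mulf_neq0.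
have Qr0 : QI r0.
  apply: (sf_div subfield_QI); first exact: ZI_QI.
  apply: (qd_fix H); first by apply: sfM => //; apply: (qd_tau_k H).
  by rewrite rmorphM /= (qd_tauK H) // mulrC.
(* The square of I1 is generated by r0 in Q(i); scaling by a denominator m makes the generator m^2
   r0 a Gaussian integer. *)
have [m [m0 Zm]] := QI_denom Qr0; have m00 : m%:R != 0 :> algC by rewrite pnatr_eq0 -lt0n.
have km : k m%:R by apply: sf_nat.
have kI1 x : I1 x -> k x by case=> y [/kI ky ->]; apply: sfM.
exists (m%:R / ga), (m%:R * (m%:R * r0)); rewrite -(scaleM m%:R ga^-1) -/I1; split.
- exact: sf_div.
- by rewrite mulf_neq0.
- split; first exact: omod_scale.
    by move=> _ [x [Ix ->]]; apply: sfM => //; apply: kI1.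
  move=> _ [x [Ix ->]]; exists (tau x); rewrite rmorphM /= rmorph_nat; split=> //.
  by rewrite -conjI1; apply: conj_ideal_mem => //; apply: kI1.
- by apply: ZIM => //; apply: ZI_nat.
split; first by apply: mulf_neq0 => //; apply: mulf_neq0.
by rewrite idealM_scalel idealM_scaler II1 !scaleM -/r0 !mulrA.
Qed.

Lemma two_torsion_classes (qs : seq algC) (G : (algC -> Prop) -> Prop) :
  (forall q, q \in qs -> ramified k tau q) ->
  (forall r, ZI r -> (forall q, q \in qs -> ~ gdvd q r) -> gcoprime r (4%:R * (2 * P)%:R)) ->
  (forall c, k c -> c != 0 -> G (scale c Ok)) ->
  (forall c I, k c -> c != 0 -> G I -> G (scale c I)) ->
  (forall q I, q \in qs -> inv_ideal k tau I -> G I -> G (idealM I (ram_ideal k tau q))) ->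
  forall I nu, ideal k I -> k nu -> nu != 0 -> idealM I I = scale nu Ok -> G I.
Proof.
move=> ram all Gprin Gscale GM I nu idI knu nu0 II.
have [c [r [kc c0 iI Zr [r0 cII]]]] := exists_inv_ideal idI knu nu0 II.
have := inv_ideal_classes H ram all Gprin GM iI Zr r0 cII.
move/(Gscale c^-1); rewrite scaleM mulVf // scale1; apply; first exact: sfV.
by rewrite invr_eq0.
Qed.

End Ambiguous.

(** * Capitulation in a quadratic extension *)

Definition intunit (K : nfield) (u : algC) : Prop := [/\ Oint K u, Oint K u^-1 & u != 0].

Lemma intunitM K (sK : subfield K) u v : intunit K u -> intunit K v -> intunit K (u * v).
Proof.
move=> [Ou Ou' u0] [Ov Ov' v0]; split; last by rewrite mulf_neq0.
  exact: OintM.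
by rewrite invfM; apply: OintM.
Qed.

Lemma intunitV K u : intunit K u -> intunit K u^-1.
Proof. by move=> [Ou Ou' u0]; split; rewrite ?invrK ?invr_eq0. Qed.

Record quad_galois (k K : nfield) (sigma : algC -> algC) : Prop := {
  qg_stable : forall x, K x -> K (sigma x);
  qg_id : forall x, k x -> sigma x = x;
  qg_fix : forall x, K x -> sigma x = x -> k x;
  qg_invol : forall x, K x -> sigma (sigma x) = x }.

Section Extension.
Variables (k K : nfield) (sk : subfield k) (sK : subfield K).
Hypothesis kK : forall x, k x -> K x.
Local Notation Ok := (Oint k).
Local Notation OK := (Oint K).

Lemma Oint_sub x : Ok x -> OK x.
Proof. by move=> [kx Ax]; split=> //; apply: kK. Qed.

Lemma idealM_Oint_ext : idealM Ok OK = OK.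
Proof.
apply: pred_ext => x; split.
  apply: idealM_min => [||y z /Oint_sub Oy Oz]; [exact: Oint0|exact: OintD|exact: OintM].
by move=> Ox; rewrite -[x]mul1r; apply: idealM_mem => //; apply: Oint1.
Qed.

Lemma ideal_ext_scale c I : ideal_ext K (scale c I) = scale c (ideal_ext K I).
Proof. exact: idealM_scalel. Qed.

Lemma ideal_ext_Oint : ideal_ext K Ok = OK.
Proof. exact: idealM_Oint_ext. Qed.

Lemma ideal_extM I J : idealM (ideal_ext K I) (ideal_ext K J) = ideal_ext K (idealM I J).
Proof. by rewrite /ideal_ext idealMACA (idealMO sK (omod_Oint sK)). Qed.

Lemma omod_ideal_ext I : omod K (ideal_ext K I).
Proof. by rewrite /ideal_ext idealMC; apply: omod_idealM; apply: omod_Oint. Qed.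

Lemma ideal_ext_sub I : (forall x, I x -> k x) -> forall x, ideal_ext K I x -> K x.
Proof.
move=> kI; apply: idealM_min; [exact: sf0 | exact: (sfD sK) | move=> x y /kI/kK Kx [Ky _]].
exact: sfM.
Qed.

Lemma ideal_ext_mem I x : I x -> ideal_ext K I x.
Proof. by move=> Ix; rewrite -[x]mulr1; apply: idealM_mem => //; apply: Oint1. Qed.

Lemma ext_square_principal I q al u : (forall x, I x -> k x) ->
  idealM I I = scale q Ok -> K al -> al != 0 -> intunit K u -> al ^+ 2 = q * u ->
  ideal_ext K I = scale al OK.
Proof.
move=> kI II Kal al0 [Ou Ou' u0] e.
apply: (omod_sqr_principal sK (omod_ideal_ext I) (ideal_ext_sub kI) Kal al0).
by rewrite ideal_extM II ideal_ext_scale ideal_ext_Oint e -(scaleM q u) (scale_Oint_unit sK Ou Ou' u0).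
Qed.

Lemma ext_principal_square I q al : q != 0 ->
  idealM I I = scale q Ok -> K q -> K al -> ideal_ext K I = scale al OK ->
  [/\ al != 0, intunit K (al ^+ 2 / q) & al ^+ 2 = q * (al ^+ 2 / q)].
Proof.
move=> q0 II Kq Kal e; have O1 : OK 1 by apply: Oint1.
have E : scale (al ^+ 2) OK = scale q OK.
  rewrite -ideal_ext_Oint -[in RHS]ideal_ext_scale -II -ideal_extM e ideal_ext_Oint.
  by rewrite idealM_scalel idealM_scaler (idealMO sK (omod_Oint sK)) scaleM expr2.
have al0 : al != 0.
  apply: contraNneq q0 => al0.
  have [o [_ ->]] : scale (al ^+ 2) OK q by rewrite E; exists 1; rewrite mulr1.
  by rewrite al0 expr0n mul0r.
have al20 := expf_neq0 2 al0.
split=> //; last by rewrite mulrC divfK.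
have [o [Oo Da]] : scale q OK (al ^+ 2) by rewrite -E; exists 1; rewrite mulr1.
have [o' [Oo' Dq]] : scale (al ^+ 2) OK q by rewrite E; exists 1; rewrite mulr1.
split; last by rewrite mulf_neq0 ?invr_eq0.
  by rewrite Da mulrAC divff // mul1r.
by rewrite invf_div {1}Dq mulrAC divff // mul1r.
Qed.

Variable sigma : {rmorphism algC -> algC}.
Hypothesis QG : quad_galois k K sigma.
Let sigma_K := qg_stable QG.
Let sigma_k := qg_id QG.
Let sigma_fix := qg_fix QG.
Let sigmaK := qg_invol QG.

(* If I O_K = (al), then I^2 = (N al). *)
Lemma capitulation_square I : ideal k I -> principal K (ideal_ext K I) ->
  exists nu, [/\ k nu, nu != 0 & idealM I I = scale nu Ok].
Proof.
move=> idI /principalE[al [Kal e]]; have mI := ideal_omod idI; have [IO _ _ _ [x0 [Ix0 x00]]] := idI.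
have mE := omod_ideal_ext I.
have al0 : al != 0.
  apply: contraNneq x00 => al0; have := ideal_ext_mem Ix0; rewrite e => -[o [_ ->]].
  by rewrite al0 mul0r.
have sal0 : sigma al != 0 by rewrite fmorph_eq0.
have knu : k (al * sigma al).
  apply: sigma_fix; first by apply: sfM => //; apply: sigma_K.
  by rewrite rmorphM /= sigmaK // mulrC.
exists (al * sigma al); split=> //; first by rewrite mulf_neq0.
have mII : omod k (idealM I I) by apply: omod_idealM.
have mnu := omod_scale (al * sigma al) (omod_Oint sk).
have sOK x : OK x -> OK (sigma x).
  by move=> [Kx Ax]; split; [apply: sigma_K | rewrite Aint_aut].
have fixO x : OK x -> sigma x = x -> Ok x.
  by move=> [Kx Ax] sx; split=> //; apply: sigma_fix.
apply: pred_ext => x; split.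
  apply: idealM_min => [||{}x y Ix Iy]; [exact: omod0 mnu | exact: omodD mnu |].
  have kx : k x by case: (IO _ Ix).
  have ky : k y by case: (IO _ Iy).
  have := ideal_ext_mem Ix; rewrite e => -[o [Oo Dx]].
  have := ideal_ext_mem Iy; rewrite e => -[o' [Oo' Dy]].
  (* As y is fixed by sigma, it equals sigma (al o'), which brings out the norm of al. *)
  have E : x * y = al * sigma al * (o * sigma o').
    by rewrite -{1}(sigma_k ky) Dx Dy rmorphM /=; ring.
  exists (o * sigma o'); split=> //; split; last first.
    by rewrite rpredM ?Aint_aut //; [case: Oo | case: Oo'].
  have -> : o * sigma o' = x * y / (al * sigma al).
    by rewrite E mulrAC divff ?mul1r // mulf_neq0.
  by apply: sf_div => //; apply: sfM.
suff : idealM I I (al * sigma al).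
  by move=> Inu [o [Oo ->]]; rewrite mulrC; apply: (omodM mII).
have tr o o' : OK o -> OK o' -> Ok (o * sigma o' + o' * sigma o).
  move=> Oo Oo'; apply: fixO.
    by apply: OintD => //; apply: OintM => //; apply: sOK.
  have [[Ko _] [Ko' _]] := (Oo, Oo').
  by rewrite rmorphD !rmorphM /= !sigmaK //; ring.
(* The norm is not additive on the sums that make up al, so its polarization has to be controlled
   along with it. *)
have bil y z : ideal_ext K I y -> ideal_ext K I z -> idealM I I (y * sigma z + z * sigma y).
  move=> Ey; apply: (@idealM_min I OK (fun z => idealM I I (y * sigma z + z * sigma y))).
  - by rewrite rmorph0 mulr0 mul0r addr0; apply: idealM0.
  - move=> z1 z2 h1 h2; have -> : y * sigma (z1 + z2) + (z1 + z2) * sigma y =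
      (y * sigma z1 + z1 * sigma y) + (y * sigma z2 + z2 * sigma y) by rewrite rmorphD; ring.
    exact: idealMD.
  move=> z1 o Iz1 Oo; apply: (@idealM_min I OK
    (fun y => idealM I I (y * sigma (z1 * o) + z1 * o * sigma y))) Ey.
  - by rewrite rmorph0 mulr0 mul0r addr0; apply: idealM0.
  - move=> y1 y2 h1 h2; have -> : (y1 + y2) * sigma (z1 * o) + z1 * o * sigma (y1 + y2) =
      (y1 * sigma (z1 * o) + z1 * o * sigma y1) + (y2 * sigma (z1 * o) + z1 * o * sigma y2).
      by rewrite rmorphD; ring.
    exact: idealMD.
  move=> y1 o' Iy1 Oo'; have [[kz1 _] [ky1 _]] := (IO _ Iz1, IO _ Iy1).
  have -> : y1 * o' * sigma (z1 * o) + z1 * o * sigma (y1 * o') =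
      (o' * sigma o + o * sigma o') * (y1 * z1).
    by rewrite !rmorphM /= (sigma_k kz1) (sigma_k ky1); ring.
  by apply: (omodM mII); [apply: tr | apply: idealM_mem].
have Eal : ideal_ext K I al by rewrite e; exists 1; rewrite mulr1; split=> //; apply: Oint1.
suff : ideal_ext K I al /\ idealM I I (al * sigma al) by case.
apply: (@idealM_min I OK (fun y => ideal_ext K I y /\ idealM I I (y * sigma y))) (Eal).
- by split; [apply: (omod0 mE) | rewrite mul0r; apply: idealM0].
- move=> y z [Ey Qy] [Ez Qz]; split; first exact: (omodD mE).
  have -> : (y + z) * sigma (y + z) = (y * sigma y + z * sigma z) + (y * sigma z + z * sigma y).
    by rewrite rmorphD; ring.
  by apply: idealMD; [apply: idealMD | apply: bil].
move=> y o Iy Oo; split; first exact: idealM_mem.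
rewrite rmorphM /= (sigma_k (proj1 (IO _ Iy))) mulrACA mulrC; apply: (omodM mII).
  apply: fixO; first by apply: OintM => //; apply: sOK.
  by have [Ko _] := Oo; rewrite rmorphM /= sigmaK // mulrC.
exact: idealM_mem.
Qed.

End Extension.

Lemma ZI_sqrE (c d : int) :
  (c%:~R + 'i * d%:~R) ^+ 2 = (c ^+ 2 - d ^+ 2)%:~R + 'i * (2 * c * d)%:~R :> algC.
Proof.
rewrite !(intrD, intrN, intrM, rmorphXn) /=.
transitivity (c%:~R ^+ 2 + ('i * 'i) * d%:~R ^+ 2 + 'i * (2%:R * c%:~R * d%:~R) : algC); first by ring.
by rewrite mulii; ring.
Qed.

Lemma ZI_real_int x : ZI x -> x^* = x -> exists n : int, x = n%:~R.
Proof.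
case=> a [b ->]; rewrite rmorphD rmorphM /= conjCi !conj_int => /addrI /eqP.
rewrite mulNr eqNr mulf_eq0 (negPf (neq0Ci _)) /= => /eqP->.
by exists a; rewrite mulr0 addr0.
Qed.

(** The root is a Gaussian integer c + d i with a real square, so c d = 0 and the square is that of
    a rational integer up to sign. *)
Lemma QI_sqrt_nonsquare (p m : nat) z : prime p -> ~~ (p %| m)%N -> QI z ->
  z ^+ 2 = (p * m)%:R \/ z ^+ 2 = - (p * m)%:R -> False.
Proof.
move=> pr_p pm Qz e.
have [c [d Dz]] : ZI z.
  apply: QI_Aint_ZI => //; apply: Aint_sqr.
  by case: e => ->; rewrite ?rpredN Aint_Cnat // rpred_nat.
have m0 : (0 < p * m)%N.
  by rewrite muln_gt0 prime_gt0 // lt0n; apply: contraNneq pm => ->; rewrite dvdn0.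
have nsq (a : int) : a ^+ 2 = (p * m)%N -> False.
  by move=> ea; have := prime_part_nonsquare pr_p pm (a := a) (b := 1); rewrite mulr1 => /(_ ea).
have E : c ^+ 2 - d ^+ 2 = (p * m)%N%:Z \/ c ^+ 2 - d ^+ 2 = - (p * m)%N%:Z.
  move: e; rewrite Dz ZI_sqrE => -[] e; [left|right].
    by have /ZI_inj[] : (c ^+ 2 - d ^+ 2)%:~R + 'i * (2 * c * d)%:~R = ((p * m)%N%:Z)%:~R + 'i * 0%:~R :> algC by rewrite e mulr0 addr0.
  by have /ZI_inj[] : (c ^+ 2 - d ^+ 2)%:~R + 'i * (2 * c * d)%:~R = (- (p * m)%N%:Z)%:~R + 'i * 0%:~R :> algC by rewrite e mulr0 addr0 intrN.
have cd : c * d = 0.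
  have H (t : algC) : t = (p * m)%:R \/ t = - (p * m)%:R -> exists n : int, t = n%:~R + 'i * 0%:~R.
    by case=> ->; [exists (p * m)%N%:Z | exists (- (p * m)%N%:Z)]; rewrite ?intrN mulr0 addr0.
  have [n] := H _ e; rewrite Dz ZI_sqrE => /ZI_inj[_]; lia.
have [c0|d0] : c = 0 \/ d = 0 by move/eqP: cd; rewrite mulf_eq0 => /orP[] /eqP; [left|right].
- rewrite c0 in E; case: E => E; first by move: (sqr_ge0 d); lia.
  by apply: (nsq d); lia.
- rewrite d0 in E; case: E => E; last by move: (sqr_ge0 c); lia.
  by apply: (nsq c); lia.
Qed.

(* With t = x + nu x and w = (x - nu x)^2 in Z[i], |t|^2 + |w| = 4 and m w is the square of
   g (x - nu x) in Z[i]; a prime p > 4 exactly dividing m forces w = 0. *)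
Lemma quad_unimodular (p m' : nat) (g x : algC) (nu : {rmorphism algC -> algC}) :
  prime p -> (4 < p)%N -> ~~ (p %| m')%N -> g ^+ 2 = (p * m')%:R -> g^* = g ->
  nu g = - g -> nu 'i = 'i -> quad_ext QI g x -> x \in Aint ->
  x * x^* = 1 -> nu x * (nu x)^* = 1 -> gunit x.
Proof.
move=> pr_p p4 pm' g2 gr nug nui Fx Ax x1 nux1.
have nuQ z : QI z -> nu z = z.
  by case/QIP=> a [b ->]; rewrite rmorphD fmorph_rat [nu ('i * _)]rmorphM /= nui fmorph_rat.
have [A [B [QA QB Dx]]] := Fx.
have Dnux : nu x = A - g * B by rewrite Dx rmorphD rmorphM /= nug !nuQ // mulNr.
have Anux : nu x \in Aint by rewrite Aint_aut.
have sQ := subfield_QI.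
have Ag : g \in Aint by apply: Aint_sqr; rewrite g2 Aint_Cnat // rpred_nat.
have ZT : ZI (x + nu x).
  apply: QI_Aint_ZI; last by rewrite rpredD.
  by rewrite Dnux Dx addrACA subrr addr0; apply: sfD.
have Zv : ZI (g * (x - nu x)).
  apply: QI_Aint_ZI; last by rewrite rpredM ?rpredB.
  rewrite (_ : _ * _ = 2%:R * g ^+ 2 * B); last by rewrite Dnux Dx; ring.
  by rewrite g2; apply: sfM => //; apply: sfM => //; apply: sf_nat.
have Zw : ZI ((x - nu x) ^+ 2).
  apply: QI_Aint_ZI; last by rewrite rpredX ?rpredB.
  rewrite (_ : _ ^+ 2 = 4%:R * g ^+ 2 * B ^+ 2); last by rewrite Dnux Dx; ring.
  by rewrite g2; apply: sfM => //; [apply: sfM => //; apply: sf_nat | apply: sfX].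
have [n Dn] := ZI_cnorm ZT; have [l Dl] := ZI_cnorm Zv.
have par : cnorm (x + nu x) + cnorm (x - nu x) = 4%:R.
  rewrite /cnorm rmorphD rmorphB.
  transitivity (2%:R * (x * x^*) + 2%:R * (nu x * (nu x)^*)); first by ring.
  by rewrite x1 nux1; ring.
have cv : cnorm (g * (x - nu x)) = (p * m')%:R * cnorm (x - nu x).
  by rewrite cnormM {1}/cnorm gr -expr2 g2.
have E : (l + (p * m') * n = (p * m') * 4)%N.
  apply/eqP; rewrite -(eqr_nat algC) natrD !natrM -Dl -Dn cv -par natrM; apply/eqP; ring.
have [c [d Dv]] := Zv; have [a [b Dw]] := Zw.
have Ev : (c%:~R + 'i * d%:~R) ^+ 2 = (p * m')%:R * (a%:~R + 'i * b%:~R) :> algC.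
  by rewrite -Dv -Dw exprMn g2.
have {Ev} [e1 e2] : c ^+ 2 - d ^+ 2 = (p * m')%N%:Z * a /\ 2 * c * d = (p * m')%N%:Z * b.
  apply: ZI_inj; rewrite -ZI_sqrE Ev !intrM -!pmulrn; ring.
have p2 : ~~ (p %| 2)%N.
  by apply/negP => /(dvdn_leq (isT : (0 < 2)%N)); rewrite leqNgt (leq_trans _ p4).
have dvz (z : int) : (p %| absz (z ^+ 2)%R)%N -> (p %| absz z)%N.
  by rewrite abszX Euclid_dvdX // => /andP[].
have pcd : (p %| absz c)%N /\ (p %| absz d)%N.
  have : (p %| absz (2 * c * d)%R)%N by rewrite e2 abszM /= -mulnA dvdn_mulr.
  rewrite !abszM !Euclid_dvdM // (negPf p2) /=.
  have h : (p%:Z %| c ^+ 2 - d ^+ 2)%Z by rewrite e1 PoszM -mulrA dvdz_mulr.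
  case/orP => [pc|pd]; split=> //.
    apply: dvz; have : (p%:Z %| d ^+ 2)%Z; last by [].
    have -> : d ^+ 2 = c ^+ 2 - (c ^+ 2 - d ^+ 2) by ring.
    by rewrite rpredB //; apply: dvdz_exp.
  apply: dvz; have : (p%:Z %| c ^+ 2)%Z; last by [].
  have -> : c ^+ 2 = d ^+ 2 + (c ^+ 2 - d ^+ 2) by ring.
  by rewrite rpredD //; apply: dvdz_exp.
have El : l%:Z = c ^+ 2 + d ^+ 2.
  by apply: intr_inj_C; rewrite -cnormE -Dv Dl -pmulrn.
(* Here l = |g (x - nu x)|^2 is divisible by p^2 and equals p m' (4 - n), so p divides 4 - n; since
   n <= 4 < p, this forces n = 4 and l = 0. *)
have l0 : l = 0%N.
  case: pcd => /dvdnP[c' Dc] /dvdnP[d' Dd].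
  have ll : (l = p ^ 2 * (c' ^ 2 + d' ^ 2))%N.
    have : (l%:Z = (absz c ^ 2 + absz d ^ 2)%N)%R by rewrite El PoszD -!abszX !gez0_abs ?sqr_ge0.
    by move=> /eqP; rewrite eqz_nat => /eqP->; rewrite Dc Dd; ring.
  have n4 : (n <= 4)%N.
    have pm0 : (0 < p * m')%N.
      by rewrite muln_gt0 prime_gt0 // lt0n; apply: contraNneq pm' => ->; rewrite dvdn0.
    by rewrite -(leq_pmul2l pm0) -E leq_addl.
  have el : (l = p * (m' * (4 - n)))%N by rewrite mulnA mulnBr -E addnK.
  have : (p %| m' * (4 - n))%N.
    rewrite -(dvdn_pmul2l (prime_gt0 pr_p)) -el ll -mulnA mulnA; apply: dvdn_mulr.
    by rewrite mulnn.
  rewrite Euclid_dvdM // (negPf pm') /= => p4n.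
  have /eqP z : (4 - n == 0)%N.
    apply: contraTT p4n => nz; rewrite gtnNdvd ?lt0n //.
    by apply: leq_ltn_trans (leq_subr _ _) p4.
  by rewrite el z !muln0.
have x_nux : x = nu x.
  apply/eqP; rewrite -subr_eq0; have /eqP : cnorm (g * (x - nu x)) = 0 by rewrite Dl l0.
  rewrite cnorm_eq0 mulf_eq0 => /orP[/eqP g0|//].
  move: g2; rewrite g0 expr0n /= => /esym/eqP; rewrite pnatr_eq0 muln_eq0.
  case/orP=> /eqP z; first by rewrite z in pr_p.
  by rewrite z dvdn0 in pm'.
have QA' : QI x.
  have -> : x = (x + nu x) / 2%:R by rewrite -x_nux; field.
  by apply: sf_div => //; [apply: ZI_QI | apply: sf_nat].
by apply: cnorm1_unit => //; apply: QI_Aint_ZI.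
Qed.

(** * The biquadratic extensions of Q(i) *)

(** K = Q(i, sqrt p1, sqrt(2 p2)), with a and b generating its Galois group over Q(i); s and t are
    real, so complex conjugation fixes them. The second extension is the same data with p1 and p2
    exchanged. *)
Record biquad (p1 p2 : nat) (K : nfield) (s t : algC) (a b : {rmorphism algC -> algC}) : Prop := {
  bq_pr1 : prime p1; bq_pr2 : prime p2; bq_neq : p1 != p2;
  bq_mod1 : (p1 %% 4 = 1)%N; bq_mod2 : (p2 %% 4 = 1)%N;
  bq_K : forall x, K x <-> quad_ext (quad_ext QI t) s x;
  bq_s2 : s ^+ 2 = p1%:R; bq_t2 : t ^+ 2 = (2 * p2)%:R;
  bq_sr : s^* = s; bq_tr : t^* = t;
  bq_as : a s = - s; bq_at : a t = t; bq_ai : a 'i = 'i;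
  bq_bs : b s = s; bq_bt : b t = - t; bq_bi : b 'i = 'i }.

Section Biquad.
Variables (p1 p2 : nat) (K : nfield) (s t : algC) (a b : {rmorphism algC -> algC}).
Hypothesis H : biquad p1 p2 K s t a b.
Let pr1 := bq_pr1 H.
Let pr2 := bq_pr2 H.
Let sQ := subfield_QI.

Lemma bq_Qt2 : QI (t ^+ 2). Proof. by rewrite (bq_t2 H); apply: sf_nat. Qed.

Lemma bq_subfield_t : subfield (quad_ext QI t).
Proof. exact: subfield_quad_ext sQ _ bq_Qt2. Qed.
Let st := bq_subfield_t.

Lemma bq_ts2 : quad_ext QI t (s ^+ 2).
Proof. by rewrite (bq_s2 H); apply: sf_nat. Qed.

Lemma bq_subfield : subfield K.
Proof.
have S := subfield_quad_ext st bq_ts2.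
have E := bq_K H; split=> [|x y /E kx /E ky|x y /E kx /E ky|x /E kx]; apply/E.
- exact: (sf1 S).
- exact: (sfB S).
- exact: (sfM S).
- exact: (sfV S).
Qed.
Let sK := bq_subfield.

Lemma bq_odd1 : odd p1. Proof. exact: mod4_odd (bq_mod1 H). Qed.
Lemma bq_odd2 : odd p2. Proof. exact: mod4_odd (bq_mod2 H). Qed.

Lemma bq_gt4 p : prime p -> (p %% 4 = 1)%N -> (4 < p)%N.
Proof. by case: p => [|[|[|[|[|p]]]]]. Qed.

Lemma bq_ndvd12 : ~~ (p1 %| 2 * p2)%N.
Proof.
rewrite Euclid_dvdM // !dvdn_prime2 // negb_or (bq_neq H) andbT.
by apply: contraTneq bq_odd1 => ->.
Qed.

Lemma bq_ndvd21 : ~~ (p2 %| 2)%N.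
Proof. by rewrite dvdn_prime2 //; apply: contraTneq bq_odd2 => ->. Qed.

Lemma bq_QI_K x : QI x -> K x.
Proof. by move=> Qx; apply/(bq_K H); apply: quad_ext_base => //; apply: quad_ext_base. Qed.

Lemma bq_Ks : K s.
Proof. by apply/(bq_K H); apply: quad_ext_gen. Qed.

Lemma bq_Kt : K t.
Proof. by apply/(bq_K H); apply: quad_ext_base => //; apply: quad_ext_gen. Qed.

Lemma bq_coord x : K x -> exists x0 x1 x2 x3,
  [/\ QI x0, QI x1, QI x2, QI x3 & x = x0 + t * x1 + s * (x2 + t * x3)].
Proof.
case/(bq_K H)=> _ [_ [[x0 [x1 [Q0 Q1 ->]]] [x2 [x3 [Q2 Q3 ->]]] ->]].
by exists x0, x1, x2, x3.
Qed.

Lemma bq_aut_eq (f g : {rmorphism algC -> algC}) : f 'i = g 'i -> f s = g s -> f t = g t ->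
  forall x, K x -> f x = g x.
Proof.
move=> ei es et x /bq_coord[x0 [x1 [x2 [x3 [Q0 Q1 Q2 Q3 ->]]]]].
have eQ y : QI y -> f y = g y.
  case/QIP=> r [q ->]; rewrite !rmorphD !fmorph_rat [f ('i * _)]rmorphM [g ('i * _)]rmorphM /=.
  by rewrite !fmorph_rat ei.
rewrite !rmorphD [f (t * x1)]rmorphM [g (t * x1)]rmorphM [f (s * _)]rmorphM [g (s * _)]rmorphM /=.
by rewrite !rmorphD [f (t * x3)]rmorphM [g (t * x3)]rmorphM /= (eQ _ Q0) (eQ _ Q1) (eQ _ Q2) (eQ _ Q3) es et.
Qed.

Lemma bq_fix_QI (f : {rmorphism algC -> algC}) x : f 'i = 'i -> QI x -> f x = x.
Proof.
by move=> fi /QIP[r [q ->]]; rewrite rmorphD fmorph_rat [f ('i * _)]rmorphM /= fmorph_rat fi.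
Qed.

Lemma bq_conj x : K x -> K x^*.
Proof.
case/bq_coord=> x0 [x1 [x2 [x3 [Q0 Q1 Q2 Q3 ->]]]].
rewrite !(rmorphD, rmorphM) /= (bq_sr H) (bq_tr H).
have [Ks Kt] := (bq_Ks, bq_Kt).
have Q y : QI y -> K y^* by move=> Qy; apply: bq_QI_K; apply: QI_conj.
by apply: (sfD sK); [apply: (sfD sK)|]; do ?[apply: (sfM sK) | apply: (sfD sK)] => //; apply: Q.
Qed.

Lemma bq_aut_K (f : {rmorphism algC -> algC}) : f 'i = 'i -> K (f s) -> K (f t) ->
  forall x, K x -> K (f x).
Proof.
move=> fi Kfs Kft x /bq_coord[x0 [x1 [x2 [x3 [Q0 Q1 Q2 Q3 ->]]]]].
rewrite !(rmorphD, rmorphM) /= (bq_fix_QI fi Q0) (bq_fix_QI fi Q1) (bq_fix_QI fi Q2) (bq_fix_QI fi Q3).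
have Q y : QI y -> K y by move=> Qy; apply: bq_QI_K.
by apply: (sfD sK); [apply: (sfD sK)|]; do ?[apply: (sfM sK) | apply: (sfD sK)] => //; apply: Q.
Qed.

Lemma bq_aK x : K x -> K (a x).
Proof.
apply: bq_aut_K; rewrite ?(bq_ai H) // ?(bq_as H) ?(bq_at H); last exact: bq_Kt.
by apply: (sfN sK); apply: bq_Ks.
Qed.

Lemma bq_bK x : K x -> K (b x).
Proof.
apply: bq_aut_K; rewrite ?(bq_bi H) // ?(bq_bs H) ?(bq_bt H); first exact: bq_Ks.
by apply: (sfN sK); apply: bq_Kt.
Qed.

Lemma bq_a_conj x : K x -> a x^* = (a x)^*.
Proof.
apply: (@bq_aut_eq (a \o Num.conj) (Num.conj \o a)) => /=.
- by rewrite conjCi rmorphN /= (bq_ai H) conjCi.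
- by rewrite (bq_sr H) (bq_as H) rmorphN /= (bq_sr H).
- by rewrite (bq_tr H) (bq_at H) (bq_tr H).
Qed.

Lemma bq_b_conj x : K x -> b x^* = (b x)^*.
Proof.
apply: (@bq_aut_eq (b \o Num.conj) (Num.conj \o b)) => /=.
- by rewrite conjCi rmorphN /= (bq_bi H) conjCi.
- by rewrite (bq_sr H) (bq_bs H) (bq_sr H).
- by rewrite (bq_tr H) (bq_bt H) rmorphN /= (bq_tr H).
Qed.

Lemma bq_aa x : K x -> a (a x) = x.
Proof.
apply: (@bq_aut_eq (a \o a) idfun) => /=; rewrite ?(bq_ai H) ?(bq_at H) ?(bq_as H) ?rmorphN ?opprK //=.
by rewrite (bq_as H) opprK.
Qed.

Lemma bq_bb x : K x -> b (b x) = x.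
Proof.
apply: (@bq_aut_eq (b \o b) idfun) => /=; rewrite ?(bq_bi H) ?(bq_bs H) ?(bq_bt H) ?rmorphN ?opprK //=.
by rewrite (bq_bt H) opprK.
Qed.

Lemma bq_ab x : K x -> a (b x) = b (a x).
Proof.
apply: (@bq_aut_eq (a \o b) (b \o a)) => /=.
- by rewrite (bq_bi H) (bq_ai H) (bq_bi H).
- by rewrite (bq_bs H) (bq_as H) rmorphN /= (bq_bs H).
- by rewrite (bq_bt H) (bq_at H) rmorphN /= (bq_bt H) (bq_at H).
Qed.

Lemma bq_half (x y : algC) : x = y -> x = (x + y) / 2%:R.
Proof. by move=> ->; field. Qed.

Lemma bq_coord_a x0 x1 x2 x3 : QI x0 -> QI x1 -> QI x2 -> QI x3 ->
  a (x0 + t * x1 + s * (x2 + t * x3)) = x0 + t * x1 - s * (x2 + t * x3).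
Proof.
move=> Q0 Q1 Q2 Q3; have fi := bq_fix_QI (bq_ai H).
rewrite !(rmorphD, rmorphM) /= (fi _ Q0) (fi _ Q1) (fi _ Q2) (fi _ Q3).
by rewrite (bq_as H) (bq_at H); ring.
Qed.

Lemma bq_coord_b x0 x1 x2 x3 : QI x0 -> QI x1 -> QI x2 -> QI x3 ->
  b (x0 + t * x1 + s * (x2 + t * x3)) = x0 - t * x1 + s * (x2 - t * x3).
Proof.
move=> Q0 Q1 Q2 Q3; have fi := bq_fix_QI (bq_bi H).
rewrite !(rmorphD, rmorphM) /= (fi _ Q0) (fi _ Q1) (fi _ Q2) (fi _ Q3).
by rewrite (bq_bs H) (bq_bt H); ring.
Qed.

Lemma bq_fix_a x : K x -> a x = x -> quad_ext QI t x.
Proof.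
move=> Kx ax; have := Kx; case/bq_coord=> x0 [x1 [x2 [x3 [Q0 Q1 Q2 Q3 Dx]]]].
exists x0, x1; split=> //; have Dax : a x = x0 + t * x1 - s * (x2 + t * x3) by rewrite Dx bq_coord_a.
by rewrite (bq_half (esym ax)) Dax Dx; field.
Qed.

Lemma bq_fix_b x : K x -> b x = x -> quad_ext QI s x.
Proof.
move=> Kx ax; have := Kx; case/bq_coord=> x0 [x1 [x2 [x3 [Q0 Q1 Q2 Q3 Dx]]]].
exists x0, x2; split=> //; have Dbx : b x = x0 - t * x1 + s * (x2 - t * x3) by rewrite Dx bq_coord_b.
by rewrite (bq_half (esym ax)) Dbx Dx; field.
Qed.

Lemma bq_fix_ab x : K x -> a (b x) = x -> quad_ext QI (s * t) x.
Proof.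
move=> Kx ax; have := Kx; case/bq_coord=> x0 [x1 [x2 [x3 [Q0 Q1 Q2 Q3 Dx]]]].
exists x0, x3; split=> //.
have Dabx : a (b x) = x0 - t * x1 - s * (x2 - t * x3).
  rewrite Dx bq_coord_b //.
  have -> : x0 - t * x1 + s * (x2 - t * x3) = x0 + t * (- x1) + s * (x2 + t * (- x3)) by ring.
  by rewrite bq_coord_a //; [ring | apply: sfN | apply: sfN].
by rewrite (bq_half (esym ax)) Dabx Dx; field.
Qed.

(* A unimodular integer has unimodular norms to the three quadratic subfields over Q(i),
   which are therefore units of Z[i]; zeta^2 is a quotient of these norms. *)
Lemma bq_unimodular_sqr z : K z -> z \in Aint -> z * z^* = 1 -> gunit (z ^+ 2).
Proof.
move=> Kz Az z1; have z0 : z != 0.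
  by apply: contra_eqN z1 => /eqP->; rewrite mul0r eq_sym oner_eq0.
have za : a z * (a z)^* = 1 by rewrite -bq_a_conj // -rmorphM /= z1 rmorph1.
have zb : b z * (b z)^* = 1 by rewrite -bq_b_conj // -rmorphM /= z1 rmorph1.
have Kbz := bq_bK Kz; have Kaz := bq_aK Kz; have Kabz := bq_aK Kbz.
have zab : a (b z) * (a (b z))^* = 1 by rewrite -bq_a_conj // -rmorphM /= zb rmorph1.
have cM x y : x * x^* = 1 -> y * y^* = 1 -> (x * y) * (x * y)^* = 1.
  by move=> ex ey; rewrite rmorphM mulrACA ex ey mulr1.
have Aaz : a z \in Aint by rewrite Aint_aut.
have Abz : b z \in Aint by rewrite Aint_aut.
have Aabz : a (b z) \in Aint by rewrite Aint_aut.
have u1 : gunit (z * b z).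
  apply: (@quad_unimodular p1 1 s _ a pr1) => //.
  - exact: bq_gt4 (bq_mod1 H).
  - by rewrite dvdn1; case: eqP pr1 => // ->.
  - by rewrite muln1 (bq_s2 H).
  - exact: bq_sr H.
  - exact: bq_as H.
  - exact: bq_ai H.
  - by apply: bq_fix_b; [apply: (sfM sK) | rewrite rmorphM /= bq_bb // mulrC].
  - by rewrite rpredM.
  - exact: cM.
  - by rewrite [a (z * _)]rmorphM; apply: cM.
have u2 : gunit (z * a z).
  apply: (@quad_unimodular p2 2 t _ b pr2) => //.
  - exact: bq_gt4 (bq_mod2 H).
  - exact: bq_ndvd21.
  - by rewrite mulnC (bq_t2 H).
  - exact: bq_tr H.
  - exact: bq_bt H.
  - exact: bq_bi H.
  - by apply: bq_fix_a; [apply: (sfM sK) | rewrite rmorphM /= bq_aa // mulrC].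
  - by rewrite rpredM.
  - exact: cM.
  - by rewrite [b (z * _)]rmorphM /= -bq_ab //; apply: cM.
have u3 : gunit (z * a (b z)).
  apply: (@quad_unimodular p1 (2 * p2) (s * t) _ a pr1) => //.
  - exact: bq_gt4 (bq_mod1 H).
  - exact: bq_ndvd12.
  - by rewrite exprMn (bq_s2 H) (bq_t2 H) -natrM.
  - by rewrite rmorphM /= (bq_sr H) (bq_tr H).
  - by rewrite rmorphM /= (bq_as H) (bq_at H) mulNr.
  - exact: bq_ai H.
  - apply: bq_fix_ab; first exact: (sfM sK).
    by rewrite !rmorphM /= -(bq_ab Kbz) bq_bb // bq_aa // mulrC.
  - by rewrite rpredM.
  - exact: cM.
  - by rewrite [a (z * _)]rmorphM /= bq_aa //; apply: cM.
have a1 : a (z * b z) = z * b z.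
  by apply: (bq_fix_QI (bq_ai H)); apply: ZI_QI; case: u1.
have -> : z ^+ 2 = (z * a z) * (z * a (b z)) * (z * b z)^-1.
  apply: (mulIf (gunit_neq0 u1)); rewrite divfK ?gunit_neq0 //.
  by rewrite -{1}a1 rmorphM /=; ring.
by apply: gunitM; [apply: gunitM | apply: gunitV].
Qed.

Lemma bq_sqrt_cases x : K x -> QI (x ^+ 2) ->
  [\/ QI x, QI (x * t), QI (x * s) | QI (x * s * t)].
Proof.
move=> Kx Qx2; have tx2 : quad_ext QI t (x ^+ 2) by apply: quad_ext_base.
have Qt2 := bq_Qt2.
have Qs2 : QI (s ^+ 2) by rewrite (bq_s2 H); apply: sf_nat.
case: (quad_ext_sqrt st bq_ts2 (proj1 (bq_K H x) Kx) tx2) => [tx|txs].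
  by case: (quad_ext_sqrt sQ Qt2 tx Qx2); [constructor 1 | constructor 2].
have Qxs2 : QI ((x * s) ^+ 2) by rewrite exprMn; apply: sfM.
by case: (quad_ext_sqrt sQ Qt2 txs Qxs2); [constructor 3 | constructor 4].
Qed.

(** By Kummer theory 2 or -2, times one of 1, 2 p2, p1 and 2 p1 p2, would be a square in Q(i); in
    each product some prime occurs exactly once up to a square. *)
Lemma bq_no_sqrt2 x : K x -> x ^+ 2 = 2%:R \/ x ^+ 2 = - 2%:R -> False.
Proof.
move=> Kx e; have Qx2 : QI (x ^+ 2).
  by case: e => ->; [apply: sf_nat | apply: sfN => //; apply: sf_nat].
have sgn (g : algC) (n : nat) : g = n%:R -> x ^+ 2 * g = (2 * n)%:R \/ x ^+ 2 * g = - (2 * n)%:R.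
  by move=> ->; case: e => ->; [left | right]; rewrite natrM // mulNr.
have np1 : ~~ (p1 %| 2)%N by rewrite dvdn_prime2 //; apply: contraTneq bq_odd1 => ->.
have p21 : ~~ (p2 %| 1)%N by rewrite dvdn1; case: eqP pr2 => // ->.
case: (bq_sqrt_cases Kx Qx2) => Q.
- by apply: (@QI_sqrt_nonsquare 2 1 x) => //; rewrite muln1.
- apply: (@QI_sqrt_nonsquare p2 4 (x * t)) => //.
    by rewrite (Euclid_dvdX 2 2 pr2) negb_and bq_ndvd21.
  by rewrite exprMn (_ : p2 * 4 = 2 * (2 * p2))%N; [apply: sgn; apply: (bq_t2 H) | lia].
- apply: (@QI_sqrt_nonsquare p1 2 (x * s)) => //.
  by rewrite exprMn mulnC; apply: sgn; apply: (bq_s2 H).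
- apply: (@QI_sqrt_nonsquare p1 (2 * (2 * p2)) (x * s * t)) => //.
    by rewrite Euclid_dvdM // negb_or np1 bq_ndvd12.
  rewrite -mulrA exprMn (_ : p1 * _ = 2 * (p1 * (2 * p2)))%N; last by lia.
  by apply: sgn; rewrite exprMn (bq_s2 H) (bq_t2 H) [RHS]natrM.
Qed.

End Biquad.

(* An element whose quotient by its conjugate is a power of i is, up to a factor 1, i, 1 - i
   or 1 + i, real. *)
Lemma real_twist al z : al = z * al^* -> gunit z ->
  exists ka (c : nat), [/\ ZI ka, (c = 1 \/ c = 2)%N, cnorm ka = c%:R & (ka * al)^* = ka * al].
Proof.
move=> e /gunitP zu; have ni : cnorm 'i = 1 by rewrite /cnorm conjCi mulrN mulii opprK.
have n1 : cnorm (1 + 'i) = 2%:R by rewrite /cnorm (gp_norm gprime_2).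
have ec : (al^*)^* = al by rewrite conjCK.
case: zu => ez; rewrite ez in e.
- exists 1, 1%N; split; [exact: ZI1 | by left | by rewrite /cnorm conjC1 mulr1 |].
  by rewrite !mul1r {2}e mul1r.
- exists 'i, 1%N; split; [exact: ZI_i | by left | exact: ni |].
  by rewrite rmorphM /= conjCi [in RHS]e; ring.
- exists (1 - 'i), 2%N; split; [by apply: ZIB; [apply: ZI1 | apply: ZI_i] | by right | |].
    have -> : 1 - 'i = (1 + 'i)^* :> algC by rewrite rmorphD /= conjC1 conjCi.
    by rewrite /cnorm conjCK mulrC (gp_norm gprime_2).
  rewrite rmorphM rmorphB /= conjC1 conjCi opprK [in RHS]e.
  rewrite (_ : (1 - 'i) * _ = ('i - 'i * 'i) * al^*); last by ring.
  by rewrite mulii; ring.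
- exists (1 + 'i), 2%N; split; [exact: gp_ZI gprime_2 | by right | exact: n1 |].
  rewrite rmorphM rmorphD /= conjC1 conjCi [in RHS]e.
  rewrite (_ : (1 + 'i) * _ = (- 'i - 'i * 'i) * al^*); last by ring.
  by rewrite mulii; ring.
Qed.

(** * 1 + i is not a square up to a unit *)

Section NotSquare.
Variables (p1 p2 : nat) (K : nfield) (s t : algC) (a b : {rmorphism algC -> algC}).
Hypothesis H : biquad p1 p2 K s t a b.
Let sK := bq_subfield H.

(** The square of z is a power of i. If it is i or - i, then (1 + i) / z is a square root of 2 or
    -2, which K does not contain; thus K has no primitive eighth root of unity. *)
Lemma bq_unimodular z : K z -> z \in Aint -> z * z^* = 1 -> gunit z.
Proof.
move=> Kz Az z1; have z0 : z != 0.
  by apply: contra_eqN z1 => /eqP->; rewrite mul0r eq_sym oner_eq0.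
have Kd : K ((1 + 'i) / z).
  by apply: (sf_div sK) => //; apply: (bq_QI_K H); apply: ZI_QI; apply: gp_ZI gprime_2.
have i2 : (1 + 'i) ^+ 2 = 2%:R * 'i :> algC.
  by rewrite sqrrD expr1n sqrCi mul1r mulr_natl; ring.
have i0 : 'i != 0 :> algC by apply: neq0Ci.
have zn1 : cnorm z = 1 by [].
have Zi := ZI_i.
case/gunitP: (bq_unimodular_sqr H Kz Az z1) => e.
- have : (z - 1) * (z + 1) = 0 by rewrite -subr_sqr e expr1n subrr.
  move/eqP; rewrite mulf_eq0 subr_eq0 addr_eq0 => /orP[] /eqP ez; apply: cnorm1_unit => //; rewrite ez.
    exact: ZI1.
  by apply: ZIN; apply: ZI1.
- have : (z - 'i) * (z + 'i) = 0 by rewrite -subr_sqr e sqrCi subrr.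
  move/eqP; rewrite mulf_eq0 subr_eq0 addr_eq0 => /orP[] /eqP ez; apply: cnorm1_unit => //; rewrite ez //.
  exact: ZIN.
- case: (bq_no_sqrt2 H Kd); left.
  by rewrite expr_div_n i2 e mulfK.
- case: (bq_no_sqrt2 H Kd); right.
  by rewrite expr_div_n i2 e invrN mulrN mulfK.
Qed.

Lemma int_sqr_even (x y : int) : x ^+ 2 = 2 * y -> exists z, x = 2 * z.
Proof.
move=> e; have [z [r [Dx [r0|r1]]]] : exists z r : int, x = 2 * z + r /\ (r = 0 \/ r = 1).
  exists (x %/ 2)%Z, (x %% 2)%Z; split; first by rewrite mulrC -divz_eq.
  have := ltz_pmod x (isT : 0 < 2 :> int); have := modz_ge0 x (isT : 2 != 0 :> int).
  by move: (x %% 2)%Z => r; lia.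
- by exists z; rewrite Dx r0 addr0.
- by exfalso; move: e; rewrite Dx r1; clear; nia.
Qed.

(* From be^2 = 2 e with e a unit: N = be (a be) = +-2 and the trace T is even, and then
   (s (be - a be) / 2)^2 = p1 ((T/2)^2 - N) is impossible modulo 4. *)
Lemma quad_no_sqrt_2unit be e : quad_ext QI s be -> be^* = be -> (a be)^* = a be ->
  e \in Aint -> e^-1 \in Aint -> e != 0 -> be ^+ 2 = 2%:R * e -> False.
Proof.
move=> Fb br abr Ae Aei e0 De; have sQ := subfield_QI.
have be0 : be != 0.
  by apply: contra_eqN De => /eqP->; rewrite expr0n eq_sym mulf_neq0 ?pnatr_eq0.
have [A [B [QA QB Db]]] := Fb.
have aQ y : QI y -> a y = y by apply: bq_fix_QI (bq_ai H).
have Dab : a be = A - s * B by rewrite Db rmorphD rmorphM /= (bq_as H) !aQ // mulNr.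
have Aas : s \in Aint by apply: Aint_sqr; rewrite (bq_s2 H) Aint_Cnat // rpred_nat.
have Ab : be \in Aint by apply: Aint_sqr; rewrite De rpredM // Aint_Cnat // rpred_nat.
have Aab : a be \in Aint by rewrite Aint_aut.
have ZR x : QI x -> x \in Aint -> x^* = x -> exists n : int, x = n%:~R.
  by move=> Qx Ax xr; apply: ZI_real_int => //; apply: QI_Aint_ZI.
have [T DT] : exists n : int, be + a be = n%:~R.
  apply: ZR; last by rewrite rmorphD /= br abr.
    by rewrite Dab Db addrACA subrr addr0; apply: sfD.
  by rewrite rpredD.
have [N DN] : exists n : int, be * a be = n%:~R.
  apply: ZR; last by rewrite rmorphM /= br abr.
    rewrite (_ : _ * _ = A ^+ 2 - s ^+ 2 * B ^+ 2); last by rewrite Dab Db; ring.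
    rewrite (bq_s2 H); apply: sfB => //; first exact: sfX.
    by apply: sfM; [|apply: sf_nat|apply: sfX].
  by rewrite rpredM.
have [v Dv] : exists n : int, s * (be - a be) = n%:~R.
  apply: ZR; last by rewrite rmorphM rmorphB /= br abr (bq_sr H).
    rewrite (_ : _ * _ = s ^+ 2 * (2%:R * B)); last by rewrite Dab Db; ring.
    by rewrite (bq_s2 H); apply: sfM; [|apply: sf_nat|apply: sfM => //; apply: sf_nat].
  by rewrite rpredM ?rpredB.
have De' : e = be ^+ 2 / 2%:R by rewrite De mulrAC divff ?mul1r // pnatr_eq0.
have er : e^* = e by rewrite De' fmorph_div rmorphXn /= br rmorph_nat.
have aer : (a e)^* = a e.
  by rewrite De' fmorph_div rmorphXn /= rmorph_nat fmorph_div rmorphXn /= abr rmorph_nat.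
have Qbe2 : be ^+ 2 + a be ^+ 2 = T%:~R ^+ 2 - 2%:R * N%:~R by rewrite -DT -DN; ring.
have ea : e + a e = (T%:~R ^+ 2 - 2%:R * N%:~R) / 2%:R.
  by rewrite De' fmorph_div rmorphXn /= rmorph_nat -Qbe2; field.
have ea' : e * a e = N%:~R ^+ 2 / 4%:R.
  by rewrite De' fmorph_div rmorphXn /= rmorph_nat -DN; field.
have [E1 DE1] : exists n : int, e + a e = n%:~R.
  apply: ZR; last by rewrite rmorphD /= er aer.
    by rewrite ea; apply: sf_div => //; [apply: sfB => //; [apply: sfX => //; apply: sf_int |
      apply: sfM => //; [apply: sf_nat | apply: sf_int]] | apply: sf_nat].
  by rewrite rpredD ?Aint_aut.
have QE : QI (e * a e).
  by rewrite ea'; apply: sf_div => //; [apply: sfX => //; apply: sf_int | apply: sf_nat].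
have [E2 DE2] : exists n : int, e * a e = n%:~R.
  apply: ZR => //; last by rewrite rmorphM /= er aer.
  by rewrite rpredM ?Aint_aut.
have [E3 DE3] : exists n : int, (e * a e)^-1 = n%:~R.
  apply: ZR; first exact: sfV.
    by rewrite invfM -fmorphV rpredM ?Aint_aut.
  by rewrite fmorphV rmorphM /= er aer.
have N4 : N ^+ 2 = 4 * E2.
  by apply: intr_inj_C; rewrite intrM rmorphXn /= -DE2 ea'; field.
have E23 : E2 * E3 = 1 \/ N = 0.
  have [N0|N0] := eqVneq N 0; [by right | left].
  apply: intr_inj_C; rewrite intrM -DE2 -DE3 mulfV // ea' mulf_neq0 ?invr_eq0 ?pnatr_eq0 //.
  by rewrite expf_neq0 // intr_eq0.
have T2 : T ^+ 2 = 2 * (E1 + N).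
  by apply: intr_inj_C; rewrite intrM intrD rmorphXn /= -DE1 ea; field.
have v2 : v ^+ 2 = p1%:Z * (T ^+ 2 - 4 * N).
  apply: intr_inj_C; rewrite intrM intrD intrN intrM !rmorphXn /= -Dv -DT -DN exprMn (bq_s2 H).
  by rewrite -pmulrn; ring.
have [T' DT'] := int_sqr_even T2.
have N0 : N != 0.
  apply: contra_neq be0 => N0; have : be * a be = 0 by rewrite DN N0.
  by move/eqP; rewrite mulf_eq0 fmorph_eq0 orbb => /eqP.
have Npm : N = 2 \/ N = -2.
  case: E23 => [E23|NN]; last by rewrite NN in N0.
  have E2p : 0 < E2 by move: (sqr_ge0 N) (expf_neq0 2 N0); rewrite N4; lia.
  have E21 : E2 = 1 by apply: mulz_eq1_pos E2p E23.
  have : (N - 2) * (N + 2) = 0 by rewrite -subr_sqr N4 E21.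
  by move/eqP; rewrite mulf_eq0 subr_eq0 addr_eq0 => /orP[] /eqP; [left|right].
have [v' Dv'] : exists v', v = 2 * v'.
  by apply: (@int_sqr_even v (p1%:Z * (2 * T' ^+ 2 - 2 * N))); rewrite v2 DT'; ring.
have [m Dm] : exists m : int, p1%:Z = 4 * m + 1.
  by exists (p1 %/ 4)%N%:Z; have := divn_eq p1 4; rewrite (bq_mod1 H); lia.
have V : v' ^+ 2 = p1%:Z * (T' ^+ 2 - N).
  have : 4 * v' ^+ 2 = 4 * (p1%:Z * (T' ^+ 2 - N)).
    by move: v2; rewrite Dv' DT' => v2; transitivity ((2 * v') ^+ 2); [ring | rewrite v2; ring].
  by apply: mulfI.
have par (z : int) : exists q r, z = 2 * q + r /\ (r = 0 \/ r = 1).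
  exists (z %/ 2)%Z, (z %% 2)%Z; split; first by rewrite mulrC -divz_eq.
  have := ltz_pmod z (isT : 0 < 2 :> int); have := modz_ge0 z (isT : 2 != 0 :> int).
  by move: (z %% 2)%Z => r; lia.
have [x [r [Dx hr]]] := par v'; have [y [r' [Dy hr']]] := par T'.
(* With r and r' the parities of v' and T', the right side is a multiple of 4, while r^2 - r'^2 + N
   with N = 2 or -2 never is. *)
have {V} V : r ^+ 2 - (r' ^+ 2 - N) =
    4 * (m * ((2 * y + r') ^+ 2 - N) + y ^+ 2 + y * r' - x ^+ 2 - x * r).
  transitivity ((2 * x + r) ^+ 2 - 4 * (x ^+ 2 + x * r) - (r' ^+ 2 - N)); first by ring.
  by rewrite -Dx V Dm Dy; ring.
move: (_ - x * r) V => Z V.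
by clear -hr hr' Npm V; case: hr hr' Npm V => -> [] -> [] ->; lia.
Qed.

(** The quotient z of al by its conjugate is a unimodular integer, since z^2 is i times a unit; by
    [bq_unimodular] it is a power of i, and [real_twist] supplies a real multiple rho of al. Then
    rho^4 = c^2 2 u u^*, and the norm of rho fixed by b contradicts [quad_no_sqrt_2unit]. *)
Lemma bq_i1_not_square al u : K al -> intunit K u -> al ^+ 2 = (1 + 'i) * u -> False.
Proof.
move=> Kal [Ou Ou' u0] Dal.
have [[Ku Au] [_ Aui]] := (Ou, Ou').
have i10 : 1 + 'i != 0 :> algC := gprime_neq0 gprime_2.
have al0 : al != 0.
  apply: contra_eqN Dal => /eqP->; rewrite expr0n eq_sym mulf_neq0 //.
have cal0 : al^* != 0 by rewrite conjC_eq0.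
have cu0 : u^* != 0 by rewrite conjC_eq0.
pose z := al / al^*.
have Kz : K z by apply: (sf_div sK) => //; apply: (bq_conj H).
have z1 : z * z^* = 1 by rewrite /z fmorph_div /= conjCK; field; rewrite al0.
have z2 : z ^+ 2 = 'i * (u * (u^-1)^*).
  rewrite /z expr_div_n -rmorphXn /= Dal rmorphM rmorphD /= conjC1 conjCi fmorphV.
  have i10' : 1 - 'i != 0 :> algC by rewrite -conjCi -(conjC1 algC) -rmorphD conjC_eq0.
  transitivity ((1 + 'i) / (1 - 'i) * (u / u^*)).
    by field; rewrite ?cu0 ?i10'.
  congr (_ * _); apply: (mulIf i10'); rewrite divfK // mulrBr mulr1 mulii opprK addrC //.
have Az : z \in Aint.
  by apply: Aint_sqr; rewrite z2 rpredM ?Aint_i // rpredM // Aint_conj.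
have uz := bq_unimodular Kz Az z1.
have [ka [c [Zka hc nka kar]]] := real_twist (z := z) (esym (divfK cal0 al)) uz.
pose rho := ka * al.
have Krho : K rho by apply: (sfM sK) => //; apply: (bq_QI_K H); apply: ZI_QI.
have c0 : c%:R != 0 :> algC by case: hc => ->; rewrite pnatr_eq0.
have i1n : (1 + 'i) * (1 + 'i)^* = 2%:R :> algC := gp_norm gprime_2.
have rho4 : rho ^+ 4 = c%:R ^+ 2 * (2%:R * (u * u^*)).
  transitivity (rho ^+ 2 * (rho ^+ 2)^*); first by rewrite rmorphXn /= kar -/rho; ring.
  transitivity ((ka * ka^*) ^+ 2 * (al ^+ 2 * (al ^+ 2)^*)).
    by rewrite /rho !rmorphXn /= rmorphM /=; ring.
  rewrite Dal rmorphM /=; transitivity ((ka * ka^*) ^+ 2 * (((1 + 'i) * (1 + 'i)^*) * (u * u^*))); first by ring.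
  by rewrite i1n -/(cnorm ka) nka.
have Kbrho := bq_bK H Krho.
have brr : (b rho)^* = b rho by rewrite -(bq_b_conj H) // kar.
pose eta := u * u^* * b (u * u^*).
(* Dividing by the norm c of the twist gives be^4 = 4 eta with a unit eta, so be^2 / 2 is a unit
   with square eta. *)
pose be := rho * b rho / c%:R.
have be4 : be ^+ 4 = 4%:R * eta.
  have -> : be ^+ 4 = rho ^+ 4 * b (rho ^+ 4) / c%:R ^+ 4.
    by rewrite /be rmorphXn /=; field.
  rewrite rho4 rmorphM rmorphXn /= rmorph_nat [b (2%:R * _)]rmorphM /= rmorph_nat /eta.
  by field.
have Kbe : K be by apply: (sf_div sK); [apply: (sfM sK) | apply: (sf_nat sK)].
have bbe : b be = be.
  by rewrite /be fmorph_div rmorphM /= (bq_bb H) // rmorph_nat [b rho * _]mulrC.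
have ber : be^* = be by rewrite /be fmorph_div rmorphM /= kar brr rmorph_nat.
have aber : (a be)^* = a be by rewrite -(bq_a_conj H) // ber.
pose e := be ^+ 2 / 2%:R.
have e2 : e ^+ 2 = eta.
  by rewrite /e expr_div_n -exprM be4; field.
have Aeta : eta \in Aint by rewrite rpredM ?Aint_aut // rpredM // Aint_conj.
have Aetai : eta^-1 \in Aint.
  by rewrite /eta !(invfM, rmorphM) /= -!fmorphV rpredM ?rpredM ?Aint_aut // ?Aint_conj.
apply: (@quad_no_sqrt_2unit be e) => //.
- exact: (bq_fix_b H).
- by apply: Aint_sqr; rewrite e2.
- by apply: Aint_sqr; rewrite exprVn e2.
- have : eta != 0 by rewrite /eta !mulf_neq0 // fmorph_eq0 mulf_neq0.
  by rewrite -e2 expf_eq0.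
- by rewrite /e; field.
Qed.

End NotSquare.

(** * Subgroups generated by two classes of order at most two *)

Section TwoTorsion.
Variables (k : nfield) (sk : subfield k).
Local Notation Ok := (Oint k).

(** Exponents are taken in F_2, because the squares of the ideals concerned are principal; exclusive
    or adds them. *)
Definition ideal_pow (x : bool) (A : algC -> Prop) : algC -> Prop := if x then A else Ok.

Lemma omod_ideal_pow x A : omod k A -> omod k (ideal_pow x A).
Proof. by case: x => // _; apply: omod_Oint. Qed.

Lemma ideal_Oint : ideal k Ok.
Proof.
split=> //; [exact: Oint0 | exact: OintD | exact: OintM |].
by exists 1; split; [apply: Oint1 | apply: oner_neq0].
Qed.

Lemma ideal_ideal_pow x A : ideal k A -> ideal k (ideal_pow x A).
Proof. by case: x => // _; apply: ideal_Oint. Qed.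

Lemma ideal_idealM A B : ideal k A -> ideal k B -> ideal k (idealM A B).
Proof.
move=> iA iB; have mA := ideal_omod iA.
have [AO _ _ _ [x [Ax x0]]] := iA; have [BO _ _ _ [y [By y0]]] := iB.
have mAB := omod_idealM B mA; split.
- apply: idealM_min; [exact: Oint0 | exact: OintD | move=> u v Au Bv].
  by apply: OintM => //; [apply: AO | apply: BO].
- exact: omod0 mAB.
- exact: omodD mAB.
- exact: omodM mAB.
- by exists (x * y); split; [apply: idealM_mem | rewrite mulf_neq0].
Qed.

Lemma ideal_powM A a x y : omod k A -> k a -> a != 0 -> idealM A A = scale a Ok ->
  exists d, [/\ k d, d != 0 & idealM (ideal_pow x A) (ideal_pow y A) = scale d (ideal_pow (x (+) y) A)].
Proof.
move=> mA ka a0 AA; case: x; case: y => /=; first by exists a.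
- by exists 1; rewrite scale1 (idealMO sk mA); split=> //; [apply: sf1 | apply: oner_neq0].
- by exists 1; rewrite scale1 (idealOM sk mA); split=> //; [apply: sf1 | apply: oner_neq0].
- by exists 1; rewrite scale1 (idealMO sk (omod_Oint sk)); split=> //; [apply: sf1 | apply: oner_neq0].
Qed.

Lemma idealX_pow A a n : omod k A -> k a -> a != 0 -> idealM A A = scale a Ok ->
  exists d, [/\ k d, d != 0 & idealX k A n = scale d (ideal_pow (odd n) A)].
Proof.
move=> mA ka a0 AA; elim: n => [|n [d [kd d0 IHn]]].
  by exists 1; rewrite scale1; split=> //; [apply: sf1 | apply: oner_neq0].
have [d' [kd' d'0 e]] := ideal_powM (odd n) true mA ka a0 AA.
exists (d * d'); split; [exact: sfM | by rewrite mulf_neq0 |].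
by rewrite /= IHn idealM_scalel -scaleM -addbT -e.
Qed.

Lemma in_2class_square I nu : omod k I -> k nu -> idealM I I = scale nu Ok -> in_2class k I.
Proof.
move=> mI knu II; exists 1%N; apply/principalE; exists nu; split=> //.
by rewrite idealX2.
Qed.

Section Pair.
Variables (A B : algC -> Prop) (a b : algC).
Hypotheses (iA : ideal k A) (iB : ideal k B) (ka : k a) (kb : k b) (a0 : a != 0) (b0 : b != 0).
Hypotheses (AA : idealM A A = scale a Ok) (BB : idealM B B = scale b Ok).
Let mA := ideal_omod iA.
Let mB := ideal_omod iB.

Definition pair_pow (x y : bool) := idealM (ideal_pow x A) (ideal_pow y B).

Lemma ideal_pair_pow x y : ideal k (pair_pow x y).
Proof. by apply: ideal_idealM; apply: ideal_ideal_pow. Qed.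

Lemma pair_powM x y x' y' : exists d,
  [/\ k d, d != 0 & idealM (pair_pow x y) (pair_pow x' y') = scale d (pair_pow (x (+) x') (y (+) y'))].
Proof.
have [d [kd d0 e]] := ideal_powM x x' mA ka a0 AA.
have [d' [kd' d'0 e']] := ideal_powM y y' mB kb b0 BB.
exists (d * d'); split; [exact: sfM | by rewrite mulf_neq0 |].
by rewrite /pair_pow idealMACA e e' idealM_scalel idealM_scaler scaleM.
Qed.

Lemma pair_pow0 : pair_pow false false = Ok.
Proof. by rewrite /pair_pow /= (idealMO sk (omod_Oint sk)). Qed.

(** The natural exponents of [in_gen2], placed on both sides to express inverses, only matter modulo
    2, so four standard products represent the whole subgroup. *)
Lemma in_gen2_pair I : ideal k I ->
  (in_gen2 k A B I <-> exists c x y, [/\ k c, c != 0 & I = scale c (pair_pow x y)]).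
Proof.
move=> iI; have mI := ideal_omod iI.
have X n m : exists d, [/\ k d, d != 0 & idealM (idealX k A n) (idealX k B m) = scale d (pair_pow (odd n) (odd m))].
  have [d [kd d0 e]] := idealX_pow n mA ka a0 AA.
  have [d' [kd' d'0 e']] := idealX_pow m mB kb b0 BB.
  exists (d * d'); split; [exact: sfM | by rewrite mulf_neq0 |].
  by rewrite e e' idealM_scalel idealM_scaler scaleM.
split=> [[m1 [n1 [m2 [n2 /(ideal_equivE sk)[c [kc c0 E]]]]]]|[c [x [y [kc c0 ->]]]]].
  have [d [kd d0 e]] := X m1 n1; have [d' [kd' d'0 e']] := X m2 n2.
  rewrite -idealMA e e' idealM_scaler scaleM in E.
  (* The pair multiplied with I has a principal square; multiplying by it once more moves it to the
     other side. *)
  have [u [ku u0 eu]] := pair_powM (odd m1) (odd n1) (odd m1) (odd n1).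
  rewrite !addbb pair_pow0 in eu.
  have [v [kv v0 ev]] := pair_powM (odd m2) (odd n2) (odd m1) (odd n1).
  have {}E : scale (d * u) I = scale (c * d' * v) (pair_pow (odd m2 (+) odd m1) (odd n2 (+) odd n1)).
    rewrite -scaleM -[in LHS](idealMO sk mI) -idealM_scaler -eu idealMA -idealM_scalel E.
    by rewrite idealM_scalel ev scaleM.
  have du0 : d * u != 0 by rewrite mulf_neq0.
  rewrite (scaleK du0 E) scaleM; eexists _, _, _; split; last reflexivity.
    by apply: sfM => //; [apply: sfV => //; apply: sfM | apply: sfM => //; apply: sfM].
  by rewrite mulf_neq0 ?invr_eq0 // !mulf_neq0.
exists 0%N, 0%N, x, y.
have [d [kd d0 e]] := X x y; apply/(ideal_equivE sk).
exists (c / d); split; [exact: sf_div | by rewrite mulf_neq0 ?invr_eq0 |].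
rewrite e !oddb /= !(idealMO sk) ?scaleM ?divfK //; apply: omod_scale; exact: ideal_omod (ideal_pair_pow x y).
Qed.

Hypothesis nonprincipal : forall c x y, k c -> pair_pow x y = scale c Ok -> x = false /\ y = false.

Lemma exactly_four_pair K :
  (forall I, ideal k I -> (capitulates k K I <-> in_gen2 k A B I)) -> exactly_four_capitulate k K.
Proof.
(* The two binary digits of i serve as exponents. *)
move=> cap; pose ix (i : 'I_4) := odd i; pose iy (i : 'I_4) := odd i./2.
exists (fun i => pair_pow (ix i) (iy i)); split.
- move=> i; have iI := ideal_pair_pow (ix i) (iy i); split=> //; apply/cap => //.
  apply/in_gen2_pair => //; exists 1, (ix i), (iy i); rewrite scale1; split=> //; first exact: sf1.
  exact: oner_neq0.
- move=> i j /(ideal_equivE sk)[c [kc c0 e]].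
  have [d [kd d0 ed]] := pair_powM (ix i) (iy i) (ix j) (iy j).
  have [d' [kd' d'0 ed']] := pair_powM (ix j) (iy j) (ix j) (iy j).
  rewrite !addbb pair_pow0 in ed'; rewrite e idealM_scalel ed' scaleM in ed.
  have := scaleK d0 (esym ed); rewrite scaleM => /nonprincipal[].
    by apply: sfM => //; [apply: sfV | apply: sfM].
  have addF (u v : bool) : u (+) v = false -> u = v by case: u v => [] [].
  move=> /addF ex /addF ey; apply: val_inj; rewrite /= -[LHS]odd_double_half -[RHS]odd_double_half.
  have half (l : 'I_4) : l./2 = odd l./2 by case: l => [[|[|[|[|//]]]]].
  by rewrite (half i) (half j); rewrite /ix /iy in ex ey; rewrite ex ey.
- move=> I iI /(cap I iI) /(in_gen2_pair iI)[c [x [y [kc c0 DI]]]].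
  have [i [ex ey]] : exists i : 'I_4, ix i = x /\ iy i = y.
    case: x {DI}; case: y.
    + by exists (@Ordinal 4 3 isT).
    + by exists (@Ordinal 4 1 isT).
    + by exists (@Ordinal 4 2 isT).
    + by exists (@Ordinal 4 0 isT).
  by exists i; apply/(ideal_equivE sk); exists c; rewrite ex ey.
Qed.

End Pair.

End TwoTorsion.

(* An ideal of F whose square is (c) is principal exactly when c is a square up to a unit. *)
Definition sq_class (F : nfield) (c : algC) : Prop :=
  exists al u, [/\ F al, al != 0, intunit F u & al ^+ 2 = c * u].

Section SqClass.
Variables (F : nfield) (sF : subfield F).

Lemma sq_classM c d : sq_class F c -> sq_class F d -> sq_class F (c * d).
Proof.
move=> [al [u [Fal al0 uu e]]] [be [v [Fbe be0 uv e']]].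
exists (al * be), (u * v); split; [exact: sfM | by rewrite mulf_neq0 | exact: intunitM |].
by rewrite exprMn e e' mulrACA.
Qed.

Lemma sq_class_unit u : intunit F u -> sq_class F u.
Proof.
move=> uu; exists 1, u^-1; split; [exact: sf1 | exact: oner_neq0 | exact: intunitV |].
by rewrite expr1n mulfV //; case: uu.
Qed.

Lemma sq_class_sqr c : F c -> c != 0 -> sq_class F (c ^+ 2).
Proof.
move=> Fc c0; exists c, 1; rewrite mulr1; split=> //; split; rewrite ?invr1 ?oner_neq0 //.
  exact: Oint1.
exact: Oint1.
Qed.

Lemma sq_class_mulK c d : F d -> d != 0 -> sq_class F d -> sq_class F (c * d) -> sq_class F c.
Proof.
move=> Fd d0 Sd Scd; have [be [v [Fbe be0 uv e']]] := Sd.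
have [al [u [Fal al0 uu e]]] := Scd.
exists (al / be), (u / v); split; [exact: sf_div | by rewrite mulf_neq0 ?invr_eq0 | |].
  by apply: intunitM => //; apply: intunitV.
have [_ _ v0] := uv; rewrite expr_div_n e e'; field; by rewrite d0 v0.
Qed.

Lemma sq_class_unitM c u : intunit F u -> sq_class F (c * u) <-> sq_class F c.
Proof.
move=> uu; split=> Sc; last by apply: sq_classM => //; apply: sq_class_unit.
by apply: sq_class_mulK Sc; [case: uu => -[] | case: uu | apply: sq_class_unit].
Qed.

End SqClass.

Section SqClassIdeal.
Variables (k K : nfield) (sk : subfield k) (sK : subfield K).
Hypothesis kK : forall x, k x -> K x.

Lemma sq_class_capitulates I q : ideal k I -> k q -> q != 0 -> idealM I I = scale q (Oint k) ->
  (principal K (ideal_ext K I) <-> sq_class K q).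
Proof.
move=> iI kq q0 II; have [IO _ _ _ _] := iI.
have kI x : I x -> k x by case/IO.
split=> [/principalE[al [Kal e]]|[al [u [Kal al0 uu e]]]].
  have [al0 uu e'] := ext_principal_square sk sK kK q0 II (kK kq) Kal e.
  by exists al, (al ^+ 2 / q).
apply/principalE; exists al; split=> //.
exact: (ext_square_principal sk sK kK kI II Kal al0 uu e).
Qed.

End SqClassIdeal.

Lemma ideal_ext_id k I : subfield k -> ideal k I -> ideal_ext k I = I.
Proof. by move=> sk iI; apply: idealMO => //; apply: ideal_omod. Qed.

(** * Squares up to units *)

Lemma i1_sqr : (1 + 'i) ^+ 2 = 2%:R * 'i :> algC.
Proof. by rewrite sqrrD expr1n sqrCi mul1r mulr_natl; ring. Qed.

Lemma i1_neq0 : 1 + 'i != 0 :> algC. Proof. exact: gprime_neq0 gprime_2. Qed.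

Lemma gunit_intunit (F : nfield) u : (forall x, QI x -> F x) -> gunit u -> intunit F u.
Proof.
move=> QF uu; have [Zu _] := uu; have [Zv _] := gunitV uu.
by split; [split; [apply: QF; apply: ZI_QI | apply: ZI_Aint]
  | split; [apply: QF; apply: ZI_QI | apply: ZI_Aint] | apply: gunit_neq0].
Qed.

(* With e = x + y sqrt n of norm -1: (e + i)^2 = 2 e (x + i). *)
Lemma sq_class_pell (F : nfield) (g : algC) (n x y : nat) : subfield F -> (forall z, QI z -> F z) ->
  F g -> g ^+ 2 = n%:R -> (x ^ 2 + 1 = n * y ^ 2)%N -> sq_class F (x%:R + 'i).
Proof.
move=> sF QF Fg g2 e; pose ep := x%:R + y%:R * g; pose ep' := x%:R - y%:R * g.
have Fi : F 'i by apply: QF; apply: QI_i.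
have e1 : ep * ep' = -1.
  transitivity (x%:R ^+ 2 - g ^+ 2 * y%:R ^+ 2); first by rewrite /ep /ep'; ring.
  by rewrite g2 -!natrX -natrM -e natrD; ring.
have ep0 : ep != 0 by apply: contra_eqN e1 => /eqP->; rewrite mul0r eq_sym oppr_eq0 oner_eq0.
have Ag : g \in Aint by apply: Aint_sqr; rewrite g2 Aint_Cnat // rpred_nat.
have An (m : nat) : m%:R \in Aint by rewrite Aint_Cnat // rpred_nat.
have Fn (m : nat) : F m%:R by apply: sf_nat.
have Oep : Oint F ep by split; [apply: sfD => //; apply: sfM | rewrite rpredD // rpredM].
have Oep' : Oint F ep' by split; [apply: sfB => //; apply: sfM | rewrite rpredB // rpredM].
have uep : intunit F ep.
  split=> //; have -> : ep^-1 = - ep' by apply: (mulfI ep0); rewrite divff // mulrN e1 opprK.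
  exact: OintN.
have E : (ep + 'i) ^+ 2 = 2%:R * ep * (x%:R + 'i).
  transitivity (ep ^+ 2 + 2%:R * 'i * ep + 'i ^+ 2); first by ring.
  by rewrite sqrCi -e1 /ep /ep'; ring.
have i10 := i1_neq0; have i0 : 'i != 0 :> algC by apply: neq0Ci.
have x0 : x%:R + 'i != 0 :> algC.
  apply/eqP => z.
  have /ZI_inj[_] : x%:~R + 'i * 1%:~R = 0%:~R + 'i * 0%:~R :> algC.
    by rewrite mulr1 mulr0 addr0 -pmulrn z.
  by [].
(* Dividing (ep + i)^2 = 2 ep (x + i) by (1 + i)^2 = 2 i removes the factor 2. *)
exists ((ep + 'i) / (1 + 'i)), (ep / 'i); split.
- apply: sf_div => //; first by apply: sfD => //; case: Oep.
  by apply: sfD => //; apply: sf1.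
- by rewrite mulf_neq0 ?invr_eq0 // -sqrf_eq0 E !mulf_neq0 ?pnatr_eq0.
- apply: intunitM => //; apply: intunitV; exact: gunit_intunit gunit_i.
- by rewrite expr_div_n E i1_sqr; field.
Qed.

(** One of q and [q^*] divides X. Splitting it off leaves a factor X1 that is still coprime to its
    conjugate, so the step can be repeated for another prime. *)
Lemma split_conj_factor (q : algC) (p : nat) (X w : algC) : gprime q p -> ZI X -> ZI w ->
  gcoprime X X^* -> X * X^* = p%:R * w ->
  exists q' X1, [/\ q' = q \/ q' = q^*, ZI X1, X = q' * X1, gcoprime X1 X1^* & X1 * X1^* = w].
Proof.
move=> hq ZX Zw cop e; have Zq := gp_ZI hq.
have p0 : p%:R != 0 :> algC by rewrite pnatr_eq0 -lt0n prime_gt0 ?(gp_prime hq).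
have key q' : gprime q' p -> gdvd q' X -> exists X1,
    [/\ ZI X1, X = q' * X1, gcoprime X1 X1^* & X1 * X1^* = w].
  move=> hq' [X1 [ZX1 DX]]; exists X1; split=> //.
    apply: gcoprime_dvdl (gcoprime_dvdr cop _) _.
      by rewrite DX rmorphM; apply: gdvdMl; [apply: ZI_conj; apply: gp_ZI hq' | apply: gdvdxx].
    by rewrite DX; apply: gdvdMl; [apply: gp_ZI hq' | apply: gdvdxx].
  by apply: (mulfI p0); rewrite -e -(gp_norm hq') DX rmorphM; ring.
have : gdvd q (X * X^*) by rewrite e; apply: gdvdMr => //; apply: gprime_dvd_norm hq.
case/(gprime_mul hq) => // [|qX|qX]; first exact: ZI_conj.
  by have [X1 [Z1 D1 c1 e1]] := key q hq qX; exists q, X1; split=> //; left.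
have qX' : gdvd q^* X by rewrite -[X]conjCK; apply: gdvd_conj.
by have [X1 [Z1 D1 c1 e1]] := key _ (gprime_conj hq) qX'; exists q^*, X1; split=> //; right.
Qed.

Section SqField.
Variables (F : nfield) (sF : subfield F).
Hypothesis QF : forall z, QI z -> F z.

Lemma ZI_sub_field z : ZI z -> F z. Proof. by move=> Zz; apply: QF; apply: ZI_QI. Qed.

Lemma sq_class_ZI_square c u g : ZI c -> ZI g -> g != 0 -> gunit u ->
  sq_class F (c * (u * g ^+ 2)) -> sq_class F c.
Proof.
move=> Zc Zg g0 uu S; have Fg := ZI_sub_field Zg.
have uF := gunit_intunit QF uu.
apply/(sq_class_unitM sF _ uF); apply: (sq_class_mulK sF (d := g ^+ 2)).
- exact: sfX.
- exact: expf_neq0.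
- exact: sq_class_sqr.
- by rewrite -mulrA.
Qed.

Lemma sq_class_twice_unit : sq_class F 2%:R.
Proof.
have -> : 2%:R = (1 + 'i) ^+ 2 * (- 'i) :> algC.
  by rewrite i1_sqr -mulrA mulrN mulii opprK mulr1.
apply: sq_classM => //.
  by apply: (sq_class_sqr sF); [apply: ZI_sub_field; apply: gp_ZI gprime_2 | apply: i1_neq0].
apply: sq_class_unit => //; apply: gunit_intunit => //.
by split; [apply/ZIN/ZI_i | exists 'i; rewrite mulNr mulii opprK; split=> //; apply: ZI_i].
Qed.

(** For x^2 + 1 = p y^2, reduction modulo 4 makes x even, so x + i is coprime to its conjugate and
    equals q' times a unit and a square, with q' one of q and [q^*]. The other one follows because
    their product p is the square of g. *)
Lemma sq_class_prime (q g : algC) (p : nat) : gprime q p -> (p %% 4 = 1)%N -> F g -> g ^+ 2 = p%:R ->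
  sq_class F q /\ sq_class F q^*.
Proof.
move=> hq p1 Fg g2; have Zq := gp_ZI hq; have Zq' := ZI_conj Zq.
have [x [y e]] := neg_pell_prime (gp_prime hq) p1.
have S := sq_class_pell sF QF Fg g2 e.
pose X : algC := x%:R + 'i; have ZX : ZI X by apply: ZID; [apply: ZI_nat | apply: ZI_i].
have DcX : X^* = x%:R - 'i by rewrite /X rmorphD rmorph_nat /= conjCi.
have XX : X * X^* = p%:R * (y%:R ^+ 2).
  rewrite DcX -natrX -natrM -e natrD natrX.
  transitivity (x%:R ^+ 2 - 'i * 'i : algC); first by rewrite /X; ring.
  by rewrite mulii opprK.
have [m Dm] : exists m, x = (2 * m)%N.
  have ox : ~~ odd x.
    apply/negP => ox; have Dx : (x = 2 * x./2 + 1)%N by rewrite -[LHS]odd_double_half ox; lia.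
    have [py Dp] : exists p', (p = 4 * p' + 1)%N by exists (p %/ 4)%N; rewrite {1}(divn_eq p 4) p1; lia.
    have Dy : (y = 2 * y./2 + odd y)%N by rewrite -[LHS]odd_double_half; lia.
    move: e; rewrite Dx Dy Dp; move: (x./2) (y./2) (odd y) => u v [] /=; clear; nia.
  by exists x./2; rewrite -[LHS]odd_double_half (negPf ox); lia.
have cop : gcoprime X X^*.
  exists (m%:R - 'i), (- m%:R); split.
  - by apply: ZIB; [apply: ZI_nat | apply: ZI_i].
  - by apply: ZIN; apply: ZI_nat.
  rewrite DcX /X Dm natrM; transitivity (- ('i * 'i) : algC); first by ring.
  by rewrite mulii opprK.
have Zy : ZI (y%:R ^+ 2) by rewrite -natrX; apply: ZI_nat.
have [q' [X1 [Eq ZX1 DX c1 e1]]] := split_conj_factor hq ZX Zy cop XX.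
have X0 : X != 0.
  apply/eqP => z; have : X * X^* = 0 by rewrite z mul0r.
  rewrite XX -natrX -natrM -e => /eqP; rewrite pnatr_eq0; lia.
have X10 : X1 != 0 by apply: contraNneq X0; rewrite DX => ->; rewrite mulr0.
have [u [h [uu Zh h0 DX1]]] := gcoprime_conj_square ZX1 (ZI_nat y) X10 c1 e1.
have Zq'' : ZI q' by case: Eq => ->.
have Sq' : sq_class F q' by apply: (sq_class_ZI_square Zq'' Zh h0 uu); rewrite -DX1 -DX.
have Sp : sq_class F (q * q^*).
  rewrite (gp_norm hq) -g2; apply: sq_class_sqr => //.
  apply/eqP => z; move: g2; rewrite z expr0n /= => /esym/eqP; rewrite pnatr_eq0 => /eqP p0.
  by have := gp_prime hq; rewrite p0.
have q0 := gprime_neq0 hq; have q'0 := gprime_neq0 (gprime_conj hq).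
case: Eq Sq' => -> Sq'; split=> //.
  by apply: (sq_class_mulK sF _ q0 Sq'); [apply: ZI_sub_field | rewrite mulrC].
by apply: (sq_class_mulK sF _ q'0 Sq' Sp); apply: ZI_sub_field.
Qed.

(** Here x is odd in x^2 + 1 = 2 p1 p2 y^2, so 1 + i splits off from x + i. The cofactor has norm p1
    p2 y^2 and contains one prime above p1 and one above p2; which of the conjugates occur is not
    determined. *)
Lemma sq_class_biprime p1 p2 pi rho g : biprime p1 p2 pi rho -> F g -> g ^+ 2 = (2 * p1 * p2)%:R ->
  exists pi' rho', [/\ pi' = pi \/ pi' = pi^*, rho' = rho \/ rho' = rho^*
                   & sq_class F ((1 + 'i) * (pi' * rho'))].
Proof.
move=> H Fg g2; have [x [y e]] := bp_neg_pell H.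
have [hp hr] := (bp_pi H, bp_rho H).
have S := sq_class_pell sF QF Fg g2 e.
have [m Dm] : exists m, x = (2 * m + 1)%N.
  exists x./2; rewrite -[LHS]odd_double_half; suff -> : odd x by lia.
  have : odd (x ^ 2 + 1) = false by rewrite e -!mulnA oddM.
  by rewrite oddD oddX /=; case: (odd x).
(* The quotient of x + i = 2 m + 1 + i by 1 + i. *)
pose X : algC := (m%:R + 1) - 'i * m%:R.
have ZX : ZI X by apply: ZIB; [rewrite natr1; apply: ZI_nat | apply: ZIM; [apply: ZI_i|apply: ZI_nat]].
have DX : x%:R + 'i = (1 + 'i) * X.
  rewrite /X Dm natrD natrM; transitivity (2%:R * m%:R + 1 + 'i - ('i * 'i + 1) * m%:R : algC).
    by rewrite mulii addNr mul0r subr0.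
  by ring.
have DcX : X^* = (m%:R + 1) + 'i * m%:R.
  by rewrite /X rmorphB rmorphD rmorphM /= conjCi !rmorph_nat rmorph1 mulNr opprK.
have XX0 : X * X^* = 1 + 2%:R * (m%:R ^+ 2 + m%:R).
  rewrite DcX /X; transitivity ((m%:R + 1) ^+ 2 - ('i * 'i) * m%:R ^+ 2 : algC); first by ring.
  by rewrite mulii; ring.
have XX : X * X^* = p1%:R * (p2%:R * y%:R ^+ 2).
  have e2 : (1 + 2 * (m ^ 2 + m) = p1 * (p2 * y ^ 2))%N by move: e; rewrite Dm -!mulnA; clear; nia.
  by rewrite XX0 -!natrX -!(natrM, natrD) -e2 natrD.
have cop : gcoprime X X^*.
  pose r : algC := m%:R ^+ 2 + m%:R.
  have Zr : ZI r by rewrite /r -natrX -natrD; apply: ZI_nat.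
  exists (X^* - r * (1 - 'i)), (- (r * (1 + 'i))); split.
  - by apply: ZIB; [apply: ZI_conj | apply: ZIM => //; apply: ZIB; [apply: ZI1|apply: ZI_i]].
  - by apply: ZIN; apply: ZIM => //; apply: gp_ZI gprime_2.
  transitivity (X * X^* - r * ((X + X^*) - 'i * (X - X^*))); first by ring.
  rewrite XX0 -/r (_ : (X + X^*) - _ = 2%:R); first by ring.
  rewrite DcX /X; transitivity (2%:R * (m%:R + 1) + 2%:R * ('i * 'i) * m%:R : algC); first by ring.
  by rewrite mulii; ring.
have Zy : ZI (y%:R ^+ 2) by rewrite -natrX; apply: ZI_nat.
have Zpy : ZI (p2%:R * y%:R ^+ 2) by apply: ZIM => //; apply: ZI_nat.
have [pi' [X1 [Epi ZX1 DX1 c1 e1]]] := split_conj_factor hp ZX Zpy cop XX.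
have [rho' [X2 [Erho ZX2 DX2 c2 e2]]] := split_conj_factor hr ZX1 Zy c1 e1.
have X20 : X2 != 0.
  apply/eqP => z; have : X = 0 by rewrite DX1 DX2 z !mulr0.
  move=> X0; have /eqP : X * X^* = 0 by rewrite X0 mul0r.
  rewrite XX0 -natrX -natrD -natrM -(natrD _ 1) pnatr_eq0; lia.
have [u [h [uu Zh h0 DX2']]] := gcoprime_conj_square ZX2 (ZI_nat y) X20 c2 e2.
exists pi', rho'; split=> //.
have Zpi' : ZI pi' by case: Epi => ->; [apply: gp_ZI hp | apply: ZI_conj; apply: gp_ZI hp].
have Zrho' : ZI rho' by case: Erho => ->; [apply: gp_ZI hr | apply: ZI_conj; apply: gp_ZI hr].
apply: (sq_class_ZI_square _ Zh h0 uu).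
  by apply: ZIM; [apply: gp_ZI gprime_2 | apply: ZIM].
rewrite -DX2' -!mulrA -DX2 -DX1; move: S; rewrite DX //.
Qed.

End SqField.

Lemma Aint_pow4 z : z ^+ 4 \in Aint -> z \in Aint.
Proof. by move=> A; apply: Aint_sqr; apply: Aint_sqr; rewrite -exprM. Qed.

Lemma QI_real_unit z : QI z -> z^* = z -> z != 0 -> z ^+ 4 \in Aint -> z^-1 ^+ 4 \in Aint ->
  z = 1 \/ z = -1.
Proof.
move=> Qz zr z0 A4 Ai4; have Zz : ZI z by apply: QI_Aint_ZI => //; apply: Aint_pow4.
have uz : gunit z.
  split=> //; exists z^-1; rewrite divff //; split=> //.
  by apply: QI_Aint_ZI; [apply: (sfV subfield_QI) | apply: Aint_pow4].
have i0 : 'i != 0 :> algC by apply: neq0Ci.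
case/gunitP: uz => e; [by left | by right | |]; exfalso; move: zr; rewrite e ?rmorphN /= conjCi.
  by move/eqP; rewrite eqNr (negPf i0).
by rewrite opprK => /eqP; rewrite -eqr_oppLR; rewrite eqNr (negPf i0).
Qed.

(** * Non-principal ideals of k *)

Section KField.
Variables (p1 p2 : nat) (pi rho : algC) (s : algC) (k : nfield) (tau : {rmorphism algC -> algC}).
Hypothesis B : biprime p1 p2 pi rho.
Hypothesis H : quad_data (p1 * p2) s k tau.
Hypothesis sr : s^* = s.
Let sk := qd_subfield H.
Let pr1 := gp_prime (bp_pi B).
Let pr2 := gp_prime (bp_rho B).
Local Notation Ok := (Oint k).

Lemma kf_conj y : k y -> k y^*.
Proof.
case/(qd_k H)=> a [b [Qa Qb ->]]; rewrite rmorphD rmorphM /= sr.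
by apply: sfD => //; [|apply: sfM => //; first exact: qd_ks H]; apply: (qd_QI H); apply: QI_conj.
Qed.

Lemma kf_tau_conj y : k y -> tau y^* = (tau y)^*.
Proof.
case/(qd_k H)=> a [b [Qa Qb ->]].
have [Qa' Qb'] := (QI_conj Qa, QI_conj Qb).
rewrite !(rmorphD, rmorphM) /= sr (qd_tau_s H) rmorphN /= sr.
by rewrite (qd_tau_QI H Qa) (qd_tau_QI H Qb) (qd_tau_QI H Qa') (qd_tau_QI H Qb').
Qed.

Lemma kf_norm_QI_norm x : k x -> QI_norm (2 * p1 * p2)%:R (x * tau x).
Proof. by move=> kx; have [a [b [Qa Qb e]]] := qd_normE H kx; exists a, b; rewrite -mulnA e. Qed.

Lemma kf_tau_norm x : k x -> QI (x * tau x).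
Proof.
move=> kx; apply: (qd_fix H); first by apply: sfM => //; apply: (qd_tau_k H).
by rewrite rmorphM /= (qd_tauK H) // mulrC.
Qed.

(* The norm of x divided by c is a real number of Q(i) whose fourth power is a unit, hence 1 or -1. *)
Lemma kf_real_norm (x u : algC) (c : nat) : k x -> x^* = x -> (0 < c)%N -> intunit k u ->
  x ^+ 4 = c%:R ^+ 2 * u ->
  exists C, (C = c%:R \/ C = - c%:R) /\ QI_norm (2 * p1 * p2)%:R C.
Proof.
move=> kx xr c0 [[ku Au] [kv Av] u0] e; exists (x * tau x); split; last exact: kf_norm_QI_norm.
have cn0 : c%:R != 0 :> algC by rewrite pnatr_eq0 -lt0n.
have QN := kf_tau_norm kx; pose z := x * tau x / c%:R.
have tu0 : tau u != 0 by rewrite fmorph_eq0.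
have z4 : z ^+ 4 = u * tau u.
  rewrite /z expr_div_n exprMn -rmorphXn /= e rmorphM rmorphXn /= rmorph_nat; by field.
suff [zE|zE] : z = 1 \/ z = -1.
- by left; rewrite -[LHS](divfK cn0) -/z zE mul1r.
- by right; rewrite -[LHS](divfK cn0) -/z zE mulN1r.
apply: QI_real_unit.
- by apply: (sf_div subfield_QI) => //; apply: (sf_nat subfield_QI).
- by rewrite /z fmorph_div rmorphM /= rmorph_nat -kf_tau_conj // xr.
- have : z ^+ 4 != 0 by rewrite z4 mulf_neq0.
  by rewrite expf_eq0.
- by rewrite z4 rpredM ?Aint_aut.
- by rewrite exprVn z4 invfM -fmorphV rpredM ?Aint_aut.
Qed.

Lemma intunit_conj u : intunit k u -> intunit k u^*.
Proof.
move=> [[ku Au] [kv Av] u0]; split; last by rewrite conjC_eq0.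
  by split; [apply: kf_conj | rewrite Aint_conj].
by rewrite -fmorphV; split; [apply: kf_conj | rewrite Aint_conj].
Qed.

(** If al^2 = q u, the real number al al^* has square m u u^*, and [kf_real_norm] applies to it. *)
Lemma sq_class_norm q (m : nat) : (0 < m)%N -> cnorm q = m%:R -> sq_class k q ->
  exists C, (C = m%:R \/ C = - m%:R) /\ QI_norm (2 * p1 * p2)%:R C.
Proof.
move=> m0 qm [al [u [kal al0 uu e]]].
have [_ _ u0] := uu; have kc := kf_conj kal.
apply: (@kf_real_norm (al * al^*) ((u * u^*) ^+ 2) m) => //.
- exact: sfM.
- by rewrite rmorphM /= conjCK mulrC.
- by rewrite expr2; do !apply: intunitM => //; apply: intunit_conj.
- have E : (al * al^*) ^+ 2 = m%:R * (u * u^*).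
    by rewrite exprMn -rmorphXn /= e rmorphM /= -qm /cnorm; ring.
  by rewrite (exprM _ 2 2) E; ring.
Qed.

(** For a rational q the argument of [sq_class_norm] only yields the norm p1^2 up to sign. Instead
    al itself is made real: its quotient by its conjugate is a unimodular integer of k, hence a
    power of i, and a twist of norm 1 or 2 makes p1 or 2 p1 a norm up to sign. *)
Lemma not_sq_class_p1 : ~ sq_class k p1%:R.
Proof.
move=> [al [u [kal al0 uu e]]].
have [[ku Au] [kv Av] u0] := uu; have kc := kf_conj kal.
have cal0 : al^* != 0 by rewrite conjC_eq0.
have cu0 : u^* != 0 by rewrite conjC_eq0.
have p0 : p1%:R != 0 :> algC by rewrite pnatr_eq0 -lt0n prime_gt0.
pose z := al / al^*.
have kz : k z by apply: sf_div.
have z2 : z ^+ 2 = u * (u^-1)^*.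
  by rewrite /z expr_div_n -rmorphXn /= e rmorphM rmorph_nat /= fmorphV; field; rewrite p0 cu0.
have Az : z \in Aint by apply: Aint_sqr; rewrite z2 rpredM // Aint_conj.
have z1 : z * z^* = 1 by rewrite /z fmorph_div /= conjCK; field; rewrite al0.
have uz : gunit z.
  apply: (@quad_unimodular p1 (2 * p2) s z tau pr1) => //.
  - by have := bp_mod1 B; case: (p1) pr1 => [|[|[|[|[|p]]]]].
  - exact: bp_ndvd22 B.
  - by rewrite (qd_s H) mulnCA.
  - exact: qd_tau_s H.
  - exact: qd_tau_i H.
  - exact/(qd_k H).
  - by rewrite -kf_tau_conj // -rmorphM z1 rmorph1.
have [ka [c [Zka hc nka kar]]] := real_twist (esym (divfK cal0 al)) uz.
have kka : k ka by apply: (qd_QI H); apply: ZI_QI.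
have m0 : (0 < c * p1)%N by rewrite muln_gt0 (prime_gt0 pr1); case: hc => ->.
have [C [DC NC]] : exists C, (C = (c * p1)%:R \/ C = - (c * p1)%:R) /\ QI_norm (2 * p1 * p2)%:R C.
  apply: (@kf_real_norm (ka * al) (u * u^*) (c * p1)) => //.
  - exact: sfM.
  - by apply: intunitM => //; apply: intunit_conj.
  - transitivity ((ka * al) ^+ 2 * ((ka * al) ^+ 2)^*); first by rewrite rmorphXn /= kar; ring.
    transitivity ((ka * ka^*) ^+ 2 * (al ^+ 2 * (al ^+ 2)^*)).
      by rewrite !rmorphXn /= rmorphM /=; ring.
    by rewrite e rmorphM rmorph_nat /= -/(cnorm ka) nka natrM; ring.
case: hc DC => ->; rewrite ?mul1n => DC; first exact: (bp_not_norm_p1 B DC NC).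
exact: (bp_not_norm_2p1 B DC NC).
Qed.

Lemma ramified_pi : ramified k tau pi.
Proof.
apply: (ramified_divisor H (bp_pi B) (P' := pi^* * p2%:R)).
- by apply: ZIM; [apply: ZI_conj; apply: gp_ZI (bp_pi B) | apply: ZI_nat].
- by rewrite mulrA (gp_norm (bp_pi B)) natrM.
case/(gprime_mul (bp_pi B)) => [||pp|/(gprime_nat (bp_pi B))].
- by apply: ZI_conj; apply: gp_ZI (bp_pi B).
- exact: ZI_nat.
- case: (gprime_not_dvd1 (bp_pi B)).
  by case: (gdvd_coprime_unit (gp_ZI (bp_pi B)) (bp_coprime_conj B) pp).
by rewrite (negPf (bp_ndvd12 B)).
Qed.

End KField.

Lemma biprime_conj1 p1 p2 pi rho : biprime p1 p2 pi rho -> biprime p1 p2 pi^* rho.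
Proof. by move=> [h1 h2 ne m1 m2 r2 r1 r1']; split=> //; apply: gprime_conj. Qed.

Lemma biprime_conj2 p1 p2 pi rho : biprime p1 p2 pi rho -> biprime p1 p2 pi rho^*.
Proof. by move=> [h1 h2 ne m1 m2 r2 r1 r1']; split=> //; apply: gprime_conj. Qed.

Section Classes.
Variables (p1 p2 : nat) (pi rho : algC) (s : algC) (k : nfield) (tau : {rmorphism algC -> algC}).
Hypothesis B : biprime p1 p2 pi rho.
Hypothesis H : quad_data (p1 * p2) s k tau.
Hypothesis sr : s^* = s.
Let sk := qd_subfield H.
Local Notation Ok := (Oint k).
Local Notation J := (ram_ideal k tau).

Definition ram_primes : seq algC := [:: 1 + 'i; pi; pi^*; rho; rho^*].

Lemma ram_primes_ramified q : q \in ram_primes -> ramified k tau q.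
Proof.
have H' : quad_data (p2 * p1) s k tau by rewrite mulnC.
rewrite !inE => /orP[/eqP->|/orP[/eqP->|/orP[/eqP->|/orP[/eqP->|/eqP->]]]].
- exact: ramified_i1 H.
- exact: ramified_pi B H.
- exact: ramified_pi (biprime_conj1 B) H.
- exact: ramified_pi (biprime_sym B) H'.
- exact: ramified_pi (biprime_sym (biprime_conj2 B)) H'.
Qed.

Lemma ram_primes_coprime r : ZI r -> (forall q, q \in ram_primes -> ~ gdvd q r) ->
  gcoprime r (4%:R * (2 * (p1 * p2))%:R).
Proof.
move=> Zr nd; have [hp hr] := (bp_pi B, bp_rho B).
have c q p : gprime q p -> q \in ram_primes -> gcoprime r q.
  by move=> hq qin; apply: gcoprime_sym; apply: (gprime_coprime hq Zr); apply: nd.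
have c0 : gcoprime r (1 + 'i) by apply: c gprime_2 _; rewrite !inE eqxx.
have c1 : gcoprime r pi by apply: c hp _; rewrite !inE eqxx ?orbT.
have c1' : gcoprime r pi^* by apply: c (gprime_conj hp) _; rewrite !inE eqxx ?orbT.
have c2 : gcoprime r rho by apply: c hr _; rewrite !inE eqxx ?orbT.
have c2' : gcoprime r rho^* by apply: c (gprime_conj hr) _; rewrite !inE eqxx ?orbT.
have Z0 := gp_ZI gprime_2; have Zn (n : nat) := ZI_nat n.
have [Zp Zr'] := (gp_ZI hp, gp_ZI hr).
have ci : gcoprime r (- 'i).
  exists 0, 'i; split; [exact: ZI0 | exact: ZI_i | by rewrite mul0r add0r mulrN mulii opprK].
have cc : gcoprime r 2%:R.
  have -> : 2%:R = (1 + 'i) * (1 + 'i) * (- 'i) :> algC.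
    by rewrite -expr2 i1_sqr -mulrA mulrN mulii opprK mulr1.
  have Zi : ZI (- 'i) by apply: ZIN; apply: ZI_i.
  by apply: (gcoprimeM Zr (ZIM Z0 Z0) Zi _ ci); apply: gcoprimeM.
have -> : 4%:R * (2 * (p1 * p2))%:R = 2%:R * 2%:R * 2%:R * (pi * pi^*) * (rho * rho^*) :> algC.
  by rewrite (gp_norm hp) (gp_norm hr) !natrM; ring.
have [Zpp Zrr] : ZI (pi * pi^*) /\ ZI (rho * rho^*) by split; apply: ZIM => //; apply: ZI_conj.
have Z4 : ZI (2%:R * 2%:R : algC) by apply: ZIM.
have Z8 : ZI (2%:R * 2%:R * 2%:R : algC) by apply: ZIM.
have cpp : gcoprime r (pi * pi^*) by apply: gcoprimeM => //; apply: ZI_conj.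
have crr : gcoprime r (rho * rho^*) by apply: gcoprimeM => //; apply: ZI_conj.
have c4 : gcoprime r (2%:R * 2%:R) by apply: gcoprimeM.
have c8 : gcoprime r (2%:R * 2%:R * 2%:R) by apply: gcoprimeM.
by apply: gcoprimeM => //; [apply: ZIM | apply: gcoprimeM].
Qed.

Let rm0 : ramified k tau (1 + 'i) := ramified_i1 H.
Let rm1 : ramified k tau pi := ramified_pi B H.
Let rm2 : ramified k tau pi^* := ramified_pi (biprime_conj1 B) H.

Definition class_rep (x0 x1 x2 : bool) : algC -> Prop :=
  idealM (ideal_pow k x0 (J (1 + 'i))) (idealM (ideal_pow k x1 (J pi)) (ideal_pow k x2 (J pi^*))).

Lemma ram_k q : ramified k tau q -> k q.
Proof. by move=> rq; apply: (qd_QI H); apply: ZI_QI; apply: rm_ZI rq. Qed.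

Lemma ram_powM q x y : ramified k tau q -> exists d, [/\ k d, d != 0 &
  idealM (ideal_pow k x (J q)) (ideal_pow k y (J q)) = scale d (ideal_pow k (x (+) y) (J q))].
Proof.
move=> rq; apply: (ideal_powM sk x y (omod_ram_ideal H rq) (ram_k rq) (rm_neq0 rq)).
exact: ram_ideal_sqr H _ rq.
Qed.

Lemma class_repM x0 x1 x2 y0 y1 y2 : exists d, [/\ k d, d != 0 &
  idealM (class_rep x0 x1 x2) (class_rep y0 y1 y2) = scale d (class_rep (x0 (+) y0) (x1 (+) y1) (x2 (+) y2))].
Proof.
have [d0 [k0 n0 e0]] := ram_powM x0 y0 rm0.
have [d1 [k1 n1 e1]] := ram_powM x1 y1 rm1.
have [d2 [k2 n2 e2]] := ram_powM x2 y2 rm2.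
exists (d0 * (d1 * d2)); split; [by do !apply: sfM | by rewrite !mulf_neq0 |].
rewrite /class_rep idealMACA e0 idealMACA e1 e2.
by rewrite !(idealM_scalel, idealM_scaler) !scaleM; congr (scale _ _); ring.
Qed.

End Classes.

(** * Capitulating classes *)

Definition elt_pow (x : bool) (q : algC) : algC := if x then q else 1.

Section Classes2.
Variables (p1 p2 : nat) (pi rho : algC) (s : algC) (k : nfield) (tau : {rmorphism algC -> algC}).
Hypothesis B : biprime p1 p2 pi rho.
Hypothesis H : quad_data (p1 * p2) s k tau.
Hypothesis sr : s^* = s.
Let sk := qd_subfield H.
Local Notation Ok := (Oint k).
Local Notation J := (ram_ideal k tau).
Local Notation rep := (class_rep pi k tau).

Let rm0 : ramified k tau (1 + 'i) := ramified_i1 H.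
Let rm1 : ramified k tau pi := ramified_pi B H.
Let rm2 : ramified k tau pi^* := ramified_pi (biprime_conj1 B) H.
Let hp := bp_pi B.
Let hr := bp_rho B.
Let k0 : k (1 + 'i) := ram_k H rm0.
Let k1 : k pi := ram_k H rm1.
Let k2 : k pi^* := ram_k H rm2.
Let n0 : 1 + 'i != 0 := i1_neq0.
Let n1 : pi != 0 := gprime_neq0 hp.
Let n2 : pi^* != 0 := gprime_neq0 (gprime_conj hp).

Definition rep_gen (x0 x1 x2 : bool) : algC :=
  elt_pow x0 (1 + 'i) * (elt_pow x1 pi * elt_pow x2 pi^*).

Lemma elt_pow_k x q : k q -> k (elt_pow x q).
Proof. by case: x => // _; apply: sf1. Qed.

Lemma elt_pow_neq0 x q : q != 0 -> elt_pow x q != 0.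
Proof. by case: x => // _; apply: oner_neq0. Qed.

Lemma rep_gen_k x0 x1 x2 : k (rep_gen x0 x1 x2).
Proof. by do !apply: sfM => //; apply: elt_pow_k. Qed.

Lemma rep_gen_neq0 x0 x1 x2 : rep_gen x0 x1 x2 != 0.
Proof. by rewrite /rep_gen !mulf_neq0 // elt_pow_neq0. Qed.

Lemma ram_pow_sqr x q : ramified k tau q ->
  idealM (ideal_pow k x (J q)) (ideal_pow k x (J q)) = scale (elt_pow x q) Ok.
Proof.
move=> rq; case: x => /=; first exact: ram_ideal_sqr H _ rq.
by rewrite scale1 (idealMO sk (omod_Oint sk)).
Qed.

Lemma scale_OkM a b : idealM (scale a Ok) (scale b Ok) = scale (a * b) Ok.
Proof. by rewrite idealM_scalel idealM_scaler (idealMO sk (omod_Oint sk)) scaleM. Qed.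

Lemma rep_sqr x0 x1 x2 : idealM (rep x0 x1 x2) (rep x0 x1 x2) = scale (rep_gen x0 x1 x2) Ok.
Proof.
by rewrite /class_rep idealMACA ram_pow_sqr // idealMACA !ram_pow_sqr // !scale_OkM.
Qed.

Lemma ideal_rep x0 x1 x2 : ideal k (rep x0 x1 x2).
Proof.
have iJ q : ramified k tau q -> ideal k (J q) by apply: ideal_ram_ideal H _.
by do !apply: (ideal_idealM sk); apply: (ideal_ideal_pow sk); apply: iJ.
Qed.

Lemma rep0 : rep false false false = Ok.
Proof. by rewrite /class_rep /= !(idealMO sk (omod_Oint sk)). Qed.

(** [sq_class_biprime] leaves open which conjugate above p2 occurs. The conjugate product is also a
    square up to a unit, because the two multiply to (1 + i)^2 p1 p2, and p1 p2 = i theta^2. *)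
Lemma sq_class_rho rho' : rho' = rho \/ rho' = rho^* ->
  exists pi', (pi' = pi \/ pi' = pi^*) /\ sq_class k ((1 + 'i) * (pi' * rho')).
Proof.
move=> Erho; have QF z : QI z -> k z by apply: (qd_QI H).
have s2 : s ^+ 2 = (2 * p1 * p2)%:R by rewrite (qd_s H) mulnA.
have [pi0 [rho0 [E1 E2 S]]] := sq_class_biprime sk QF B (qd_ks H) s2.
have [Eq|Eq] : rho' = rho0 \/ rho' = rho0^*.
- by case: Erho => ->; case: E2 => ->; [left | right | right | left]; rewrite ?conjCK.
- by exists pi0; rewrite Eq.
exists pi0^*; split; first by case: E1 => ->; [right | left; rewrite conjCK].
have [Zp0 Zr0] : ZI pi0 /\ ZI rho0.
  split; first by case: E1 => ->; [apply: gp_ZI hp | apply: ZI_conj; apply: gp_ZI hp].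
  by case: E2 => ->; [apply: gp_ZI hr | apply: ZI_conj; apply: gp_ZI hr].
have kZ z : ZI z -> k z by move=> Zz; apply: QF; apply: ZI_QI.
have Np0 : pi0 * pi0^* = p1%:R by case: E1 => ->; rewrite ?conjCK -(gp_norm hp) // mulrC.
have Nr0 : rho0 * rho0^* = p2%:R by case: E2 => ->; rewrite ?conjCK -(gp_norm hr) // mulrC.
have pn0 : p1%:R != 0 :> algC by rewrite pnatr_eq0 -lt0n prime_gt0 // (gp_prime hp).
have pn0' : p2%:R != 0 :> algC by rewrite pnatr_eq0 -lt0n prime_gt0 // (gp_prime hr).
have p00 : pi0 != 0 by apply: contra_eqN Np0 => /eqP->; rewrite mul0r eq_sym.
have r00 : rho0 != 0 by apply: contra_eqN Nr0 => /eqP->; rewrite mul0r eq_sym.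
rewrite Eq; apply: (sq_class_mulK sk _ _ S).
- by do !apply: sfM => //; apply: kZ.
- by rewrite !mulf_neq0.
have -> : (1 + 'i) * (pi0^* * rho0^*) * ((1 + 'i) * (pi0 * rho0)) = (1 + 'i) ^+ 2 * (p1 * p2)%:R.
  by rewrite natrM -Np0 -Nr0; ring.
apply: (sq_classM sk); first exact: (sq_class_sqr sk).
have -> : (p1 * p2)%:R = qd_theta s ^+ 2 * 'i.
  by rewrite (qd_theta2 H) mulrAC mulNr mulii opprK mul1r.
apply: (sq_classM sk).
  apply: (sq_class_sqr sk); first by case: (qd_O_theta H).
  by rewrite /qd_theta mulf_neq0 ?invr_eq0 // (qd_s0 H).
by apply: (sq_class_unit sk); apply: gunit_intunit gunit_i.
Qed.

Lemma sq_class_principal I q : ideal k I -> k q -> q != 0 -> idealM I I = scale q Ok ->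
  (principal k I <-> sq_class k q).
Proof.
move=> iI kq q0 II; have := sq_class_capitulates sk sk (fun x => id) iI kq q0 II.
by rewrite ideal_ext_id.
Qed.

(** The ideal J(1 + i) J(pi') J(rho') has as square the ideal generated by a square up to a unit, so
    it is principal; hence J(rho') is equivalent to J(1 + i) J(pi'). *)
Lemma ram_rho_rep rho' : rho' = rho \/ rho' = rho^* ->
  exists c x1 x2, [/\ k c, c != 0 & J rho' = scale c (rep true x1 x2)].
Proof.
move=> Erho; have [pi' [Epi S]] := sq_class_rho Erho.
have rq : ramified k tau rho'.
  apply: (ram_primes_ramified B H).
  by case: Erho => ->; rewrite !inE eqxx ?orbT.
have rp : ramified k tau pi' by case: Epi => ->.
have iJ q : ramified k tau q -> ideal k (J q) by apply: ideal_ram_ideal H _.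
pose I := idealM (J (1 + 'i)) (idealM (J pi') (J rho')).
have iI : ideal k I by do !apply: (ideal_idealM sk); apply: iJ.
have sqJ q : ramified k tau q -> idealM (J q) (J q) = scale q Ok by apply: ram_ideal_sqr H _.
have II : idealM I I = scale ((1 + 'i) * (pi' * rho')) Ok.
  by rewrite /I idealMACA sqJ // idealMACA !sqJ // !scale_OkM.
have kk : k ((1 + 'i) * (pi' * rho')) by do !apply: sfM => //; apply: (ram_k H).
have nn : (1 + 'i) * (pi' * rho') != 0 by rewrite !mulf_neq0 // ?(rm_neq0 rp) ?(rm_neq0 rq).
have [al [u [kal al0 uu e]]] := S.
have kI x : I x -> k x by have [IO _ _ _ _] := iI; case/IO.
have E : I = scale al Ok.
  by rewrite -[LHS](ideal_ext_id sk) //; apply: (ext_square_principal sk sk (fun x => id) kI II kal al0 uu e).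
have mJ q : ramified k tau q -> omod k (J q) by move=> rq'; apply: ideal_omod; apply: iJ.
have E2 : scale al (J rho') = scale rho' (idealM (J (1 + 'i)) (J pi')).
  rewrite -[in LHS](idealMO sk (mJ _ rq)) -idealM_scaler -E /I idealMCA [idealM (J rho') _]idealMCA.
  rewrite (sqJ _ rq) !idealM_scaler (idealMO sk (mJ _ rp)) //.
have E3 : J rho' = scale (al^-1 * rho') (idealM (J (1 + 'i)) (J pi')).
  by rewrite (scaleK al0 E2) scaleM.
have kc : k (al^-1 * rho') by apply: sfM; [|apply: sfV|apply: (ram_k H)].
have c0 : al^-1 * rho' != 0 by rewrite mulf_neq0 ?invr_eq0 // (rm_neq0 rq).
case: Epi E3 => -> E3.
- by exists (al^-1 * rho'), true, false; rewrite E3 /class_rep /= (idealMO sk (mJ _ rm1)).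
- by exists (al^-1 * rho'), false, true; rewrite E3 /class_rep /= (idealOM sk (mJ _ rm2)).
Qed.

Lemma two_torsion_rep I nu : ideal k I -> k nu -> nu != 0 -> idealM I I = scale nu Ok ->
  exists c x0 x1 x2, [/\ k c, c != 0 & I = scale c (rep x0 x1 x2)].
Proof.
move=> iI knu nu0 II.
have nn C : C = 'i \/ C = - 'i -> ~ QI_norm (2 * (p1 * p2))%:R C.
  by rewrite mulnA; apply: bp_not_norm_i B _.
pose G I := exists c x0 x1 x2, [/\ k c, c != 0 & I = scale c (rep x0 x1 x2)].
have mJ q : ramified k tau q -> omod k (J q) by move=> rq; apply: ideal_omod; apply: ideal_ram_ideal H _ rq.
apply: (two_torsion_classes H nn (ram_primes_ramified B H) (ram_primes_coprime B) (G := G) _ _ _ iI knu nu0 II).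
- by move=> c kc c0; exists c, false, false, false; rewrite rep0.
- move=> c _ kc c0 [d [x0 [x1 [x2 [kd d0 ->]]]]]; exists (c * d), x0, x1, x2.
  by rewrite scaleM mulf_neq0 //; split=> //; apply: sfM.
move=> q _ qin _ [d [x0 [x1 [x2 [kd d0 ->]]]]].
have [c [y0 [y1 [y2 [kc c0 ->]]]]] : exists c y0 y1 y2, [/\ k c, c != 0 & J q = scale c (rep y0 y1 y2)].
  have kone : k 1 by apply: sf1.
  move: qin; rewrite !inE => /orP[/eqP->|/orP[/eqP->|/orP[/eqP->|/orP[/eqP->|/eqP->]]]].
  - exists 1, true, false, false; rewrite scale1 oner_neq0; split=> //.
    by rewrite /class_rep /= (idealMO sk (omod_Oint sk)) (idealMO sk (mJ _ rm0)).
  - exists 1, false, true, false; rewrite scale1 oner_neq0; split=> //.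
    by rewrite /class_rep /= (idealMO sk (mJ _ rm1)) (idealOM sk (mJ _ rm1)).
  - exists 1, false, false, true; rewrite scale1 oner_neq0; split=> //.
    by rewrite /class_rep /= !(idealOM sk (mJ _ rm2)).
  - by have [|c [x [y [kc c0 e]]]] := @ram_rho_rep rho; [left | exists c, true, x, y].
  - by have [|c [x [y [kc c0 e]]]] := @ram_rho_rep rho^*; [right | exists c, true, x, y].
have [e [ke e0 E]] := class_repM B H x0 x1 x2 y0 y1 y2.
exists (d * c * e), (x0 (+) y0), (x1 (+) y1), (x2 (+) y2); split; [by do !apply: sfM | by rewrite !mulf_neq0 |].
by rewrite idealM_scalel idealM_scaler E !scaleM.
Qed.

Section Capitulation.
Variables (K : nfield) (sigma : {rmorphism algC -> algC}).
Hypothesis sK : subfield K.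
Hypothesis kK : forall x, k x -> K x.
Hypothesis QG : quad_galois k K sigma.

Lemma principal_ext_scale c I : k c -> c != 0 -> principal K (ideal_ext K I) ->
  principal K (ideal_ext K (scale c I)).
Proof.
move=> kc c0 /principalE[al [Kal e]]; apply/principalE; exists (c * al).
by split; [apply: sfM => //; apply: kK | rewrite ideal_ext_scale e scaleM].
Qed.

(** Reduces capitulation to deciding which of the eight Gaussian integers [rep_gen] are squares up
    to units in K. *)
Lemma capitulates_rep I : ideal k I ->
  (capitulates k K I <-> exists c x0 x1 x2,
     [/\ k c, c != 0, I = scale c (rep x0 x1 x2) & sq_class K (rep_gen x0 x1 x2)]).
Proof.
move=> iI; have mI := ideal_omod iI.
have eq x0 x1 x2 := sq_class_capitulates sk sK kK (ideal_rep x0 x1 x2)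
  (rep_gen_k x0 x1 x2) (rep_gen_neq0 x0 x1 x2) (rep_sqr x0 x1 x2).
split=> [[_ prin]|[c [x0 [x1 [x2 [kc c0 DI S]]]]]].
  have [nu [knu nu0 II]] := capitulation_square sk sK QG iI prin.
  have [c [x0 [x1 [x2 [kc c0 DI]]]]] := two_torsion_rep iI knu nu0 II.
  exists c, x0, x1, x2; split=> //; apply/eq.
  rewrite (scaleK c0 (esym DI)); apply: principal_ext_scale => //; last by rewrite invr_eq0.
  exact: sfV.
split; last by rewrite DI; apply: principal_ext_scale => //; apply/eq.
apply: (in_2class_square sk (nu := c * c * rep_gen x0 x1 x2) mI).
  by apply: sfM => //; [apply: sfM | apply: rep_gen_k].
by rewrite DI idealM_scalel idealM_scaler rep_sqr !scaleM mulrA.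
Qed.

Hypothesis not_sq_i1 : ~ sq_class K (1 + 'i).

Let iJ0 := ideal_ram_ideal H rm0.
Let iJ1 := ideal_ram_ideal H rm1.
Let iJ2 := ideal_ram_ideal H rm2.
Lemma rep_gen_SqE x0 x1 x2 : sq_class K (elt_pow x1 pi) -> sq_class K (elt_pow x2 pi^*) ->
  sq_class K (rep_gen x0 x1 x2) -> x0 = false.
Proof.
move=> S1 S2; case: x0 => //; rewrite /rep_gen /= => S; case: not_sq_i1.
apply: (sq_class_mulK sK (d := elt_pow x1 pi * elt_pow x2 pi^*)) => //.
- by apply: kK; apply: sfM => //; apply: elt_pow_k.
- by rewrite mulf_neq0 ?elt_pow_neq0.
- exact: sq_classM.
Qed.

Lemma sq_class_pow x q : sq_class K q -> sq_class K (elt_pow x q).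
Proof.
case: x => // _; apply: (sq_class_unit sK).
by split; rewrite ?invr1 ?oner_neq0 //; apply: Oint1.
Qed.

Lemma not_sq_class_norm (q : algC) (m : nat) : (0 < m)%N -> cnorm q = m%:R -> m \in [:: p1; 2 * p1]%N ->
  ~ sq_class k q.
Proof.
move=> m0 qm mE /(sq_class_norm H sr m0 qm)[C [DC NC]].
move: mE DC; rewrite !inE => /orP[/eqP->|/eqP->] DC; first exact: (bp_not_norm_p1 B DC NC).
exact: (bp_not_norm_2p1 B DC NC).
Qed.

Let p1_gt0 : (0 < p1)%N. Proof. by rewrite prime_gt0 ?(gp_prime hp). Qed.
Let cn1 : cnorm pi = p1%:R. Proof. exact: gp_norm hp. Qed.
Let cn2 : cnorm pi^* = p1%:R. Proof. exact: gp_norm (gprime_conj hp). Qed.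
Let cn0 : cnorm (1 + 'i) = 2%:R. Proof. exact: gp_norm gprime_2. Qed.

(** Exactly the products without the factor 1 + i are squares up to units in K. In k the three
    nontrivial ones are not: [pi] and [pi^*] have absolute norm p1, and their product is p1
    itself. *)
Lemma capitulation_pi : sq_class K pi -> sq_class K pi^* ->
  exactly_four_capitulate k K /\
  (forall I, ideal k I -> (capitulates k K I <-> in_gen2 k (J pi) (J pi^*) I)).
Proof.
move=> S1 S2.
have sqJ q : ramified k tau q -> idealM (J q) (J q) = scale q Ok by apply: ram_ideal_sqr H _.
have repE x y : rep false x y = pair_pow k (J pi) (J pi^*) x y.
  by rewrite /class_rep /= (idealOM sk) //; apply: ideal_omod; apply: (ideal_pair_pow sk).
have cap I : ideal k I -> (capitulates k K I <-> in_gen2 k (J pi) (J pi^*) I).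
  move=> iI; have E1 := capitulates_rep iI.
  have E2 := in_gen2_pair sk iJ1 iJ2 k1 k2 n1 n2 (sqJ _ rm1) (sqJ _ rm2) iI.
  split=> [/E1[c [x0 [x1 [x2 [kc c0 DI S]]]]]|/E2[c [x [y [kc c0 DI]]]]].
    apply/E2; exists c, x1, x2; split=> //; rewrite DI -repE.
    by rewrite (rep_gen_SqE _ _ S) //; apply: sq_class_pow.
  apply/E1; exists c, false, x, y; rewrite repE; split=> //.
  by rewrite /rep_gen /= mul1r; apply: (sq_classM sK); apply: sq_class_pow.
split=> //.
apply: (exactly_four_pair sk iJ1 iJ2 k1 k2 n1 n2 (sqJ _ rm1) (sqJ _ rm2) _ cap).
move=> c x y kc E; have := sq_class_principal (ideal_rep false x y) (rep_gen_k _ _ _)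
  (rep_gen_neq0 false x y) (rep_sqr _ _ _).
case=> /(_ _)[|al [u Su] _]; first by apply/principalE; exists c; rewrite repE.
have {al u Su} S : sq_class k (rep_gen false x y) by exists al, u.
case: x y {E} S => [] [] //; rewrite /rep_gen /= ?mul1r ?mulr1.
- by rewrite (gp_norm hp) => /(not_sq_class_p1 B H sr).
- by move/(not_sq_class_norm p1_gt0 cn1); rewrite !inE eqxx => /(_ isT).
- by move/(not_sq_class_norm p1_gt0 cn2); rewrite !inE eqxx => /(_ isT).
Qed.

(** The exponent of 1 + i in a square up to a unit must be the sum modulo 2 of the other two
    exponents. Non-principality in k comes from the absolute norm 2 p1 of (1 + i) pi and its
    analogue, and from p1. *)
Lemma capitulation_i1_pi : sq_class K ((1 + 'i) * pi) -> sq_class K ((1 + 'i) * pi^*) ->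
  exactly_four_capitulate k K /\
  (forall I, ideal k I ->
    (capitulates k K I <-> in_gen2 k (idealM (J (1 + 'i)) (J pi)) (idealM (J (1 + 'i)) (J pi^*)) I)).
Proof.
move=> S1 S2; pose A := idealM (J (1 + 'i)) (J pi); pose A' := idealM (J (1 + 'i)) (J pi^*).
have sqJ q : ramified k tau q -> idealM (J q) (J q) = scale q Ok by apply: ram_ideal_sqr H _.
have AA : idealM A A = scale ((1 + 'i) * pi) Ok by rewrite /A idealMACA !sqJ // scale_OkM.
have AA' : idealM A' A' = scale ((1 + 'i) * pi^*) Ok by rewrite /A' idealMACA !sqJ // scale_OkM.
have iA : ideal k A by apply: ideal_idealM.
have iA' : ideal k A' by apply: ideal_idealM.
have ka : k ((1 + 'i) * pi) by apply: sfM.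
have ka' : k ((1 + 'i) * pi^*) by apply: sfM.
have na : (1 + 'i) * pi != 0 by rewrite mulf_neq0.
have na' : (1 + 'i) * pi^* != 0 by rewrite mulf_neq0.
have mJ q : ramified k tau q -> omod k (J q) by move=> rq; apply: ideal_omod; apply: ideal_ram_ideal H _ rq.
have mJ12 x y : omod k (idealM (ideal_pow k x (J pi)) (ideal_pow k y (J pi^*))).
  by apply: omod_idealM; apply: omod_ideal_pow => //; apply: mJ.
have repE x y : exists d, [/\ k d, d != 0 & pair_pow k A A' x y = scale d (rep (x (+) y) x y)].
  have kone : k 1 by apply: sf1.
  have [[m0 m1] m2] := (mJ _ rm0, mJ _ rm1, mJ _ rm2).
  case: x y => [] []; rewrite /pair_pow /class_rep /=.
  (* In the product of both generators J(1 + i) occurs twice, and its square is (1 + i). *)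
  - exists (1 + 'i); split=> //.
    by rewrite /A /A' idealMACA (sqJ _ rm0) idealM_scalel.
  - exists 1; rewrite scale1 oner_neq0; split=> //.
    by rewrite !(idealMO sk) //; apply: omod_idealM.
  - exists 1; rewrite scale1 oner_neq0; split=> //.
    by rewrite !(idealOM sk) //; apply: omod_idealM.
  - by exists 1; rewrite scale1 oner_neq0; split=> //; rewrite !(idealOM sk) //; apply: omod_Oint.
have pairE x y : exists d, [/\ k d, d != 0 & rep (x (+) y) x y = scale d (pair_pow k A A' x y)].
  have [d [kd d0 e]] := repE x y; exists d^-1; rewrite invr_eq0; split=> //; first exact: sfV.
  exact: scaleK (esym e).
have Sxy x y : sq_class K (rep_gen (x (+) y) x y).
  case: x y => [] []; rewrite /rep_gen /= ?mul1r ?mulr1 //; last first.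
    by apply: (sq_class_unit sK); split; rewrite ?invr1 ?oner_neq0 //; apply: Oint1.
  apply: (sq_class_mulK sK (d := (1 + 'i) ^+ 2)).
  - by apply: kK; apply: sfX.
  - exact: expf_neq0.
  - by apply: (sq_class_sqr sK) => //; apply: kK.
  - have -> : pi * pi^* * (1 + 'i) ^+ 2 = ((1 + 'i) * pi) * ((1 + 'i) * pi^*) by ring.
    exact: sq_classM.
have kpi q : k q -> K q by apply: kK.
(* With the wrong exponent of 1 + i, dividing by products already known to be squares up to units
   leaves 1 + i alone. *)
have par x0 x y : sq_class K (rep_gen x0 x y) -> x0 = x (+) y.
  move=> S; apply/eqP; apply: contraT => ne; case: not_sq_i1.
  have S12 := Sxy true true.
  case: x0 x y ne S => [] [] [] //= _; rewrite /rep_gen /= ?mul1r ?mulr1 => S //.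
  - apply: (sq_class_mulK sK (d := pi * pi^*)) => //; last 1 first.
    + by move: S12; rewrite /rep_gen /= mul1r.
    + by apply: kK; apply: sfM.
    + by rewrite mulf_neq0.
  - by apply: (sq_class_mulK sK (d := pi)) => //; apply: kK.
  - by apply: (sq_class_mulK sK (d := pi^*)) => //; apply: kK.
have cap I : ideal k I -> (capitulates k K I <-> in_gen2 k A A' I).
  move=> iI; have E1 := capitulates_rep iI.
  have E2 := in_gen2_pair sk iA iA' ka ka' na na' AA AA' iI.
  split=> [/E1[c [x0 [x1 [x2 [kc c0 DI S]]]]]|/E2[c [x [y [kc c0 DI]]]]].
    have [d [kd d0 E]] := pairE x1 x2.
    apply/E2; exists (c * d), x1, x2; rewrite mulf_neq0 //; split=> //; first exact: sfM.
    by rewrite DI (par _ _ _ S) E scaleM.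
  have [d [kd d0 E]] := repE x y.
  apply/E1; exists (c * d), (x (+) y), x, y; rewrite mulf_neq0 //; split=> //; first exact: sfM.
  by rewrite DI E scaleM.
split=> //.
apply: (exactly_four_pair sk iA iA' ka ka' na na' AA AA' _ cap).
move=> c x y kc E; have [d [kd d0 Er]] := pairE x y.
have := sq_class_principal (ideal_rep (x (+) y) x y) (rep_gen_k _ _ _)
  (rep_gen_neq0 (x (+) y) x y) (rep_sqr _ _ _).
case=> /(_ _)[|al [u Su] _].
  by apply/principalE; exists (d * c); rewrite Er E scaleM; split=> //; apply: sfM.
have {al u Su} S : sq_class k (rep_gen (x (+) y) x y) by exists al, u.
have g2p : (0 < 2 * p1)%N by rewrite muln_gt0.
have cM q : cnorm ((1 + 'i) * q) = 2%:R * cnorm q by rewrite -cn0 /cnorm rmorphM mulrACA.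
case: x y {E Er} S => [] [] //; rewrite /rep_gen /= ?mul1r ?mulr1.
- by rewrite (gp_norm hp) => /(not_sq_class_p1 B H sr).
- move/(@not_sq_class_norm _ (2 * p1)%N g2p); rewrite cM cn1 -natrM => /(_ erefl).
  by rewrite !inE eqxx orbT => /(_ isT).
- move/(@not_sq_class_norm _ (2 * p1)%N g2p); rewrite cM cn2 -natrM => /(_ erefl).
  by rewrite !inE eqxx orbT => /(_ isT).
Qed.

End Capitulation.

End Classes2.

(** * The fields of the theorem *)

Lemma sqrtC_natr_real (n : nat) : (sqrtC n%:R)^* = sqrtC n%:R :> algC.
Proof. by apply: geC0_conj; rewrite sqrtC_ge0 ler0n. Qed.

(** By Kummer theory p m or p m n would be a square in Q(i), but p divides each of them exactly
    once. *)
Lemma sqrt_prime_not_quad (p m n : nat) g h : prime p -> ~~ (p %| m)%N -> ~~ (p %| m * n)%N ->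
  g ^+ 2 = (p * m)%:R -> h ^+ 2 = n%:R -> ~ quad_ext QI h g.
Proof.
move=> pr_p pm pmn g2 h2 /(quad_ext_sqrt subfield_QI).
case; rewrite ?g2 ?h2; [exact: (sf_nat subfield_QI) | exact: (sf_nat subfield_QI) |..] => Q.
  by apply: (QI_sqrt_nonsquare pr_p pm Q); left.
by apply: (QI_sqrt_nonsquare pr_p pmn Q); left; rewrite exprMn g2 h2 -natrM mulnA.
Qed.

Lemma prime_ndvd_double (p q : nat) : prime p -> prime q -> p != q -> (p %% 4 = 1)%N ->
  ~~ (p %| 2)%N /\ ~~ (p %| 2 * q)%N.
Proof.
move=> pr_p pr_q npq p1; have p2 : ~~ (p %| 2)%N.
  by rewrite dvdn_prime2 //; apply: contraTneq (mod4_odd p1) => ->.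
by rewrite Euclid_dvdM // (negPf p2) dvdn_prime2.
Qed.

Lemma biquad_exists (p1 p2 : nat) : prime p1 -> prime p2 -> p1 != p2 ->
    (p1 %% 4 = 1)%N -> (p2 %% 4 = 1)%N ->
  exists a b, biquad p1 p2 (mq_field [:: sqrtC p1%:R; sqrtC (2 * p2)%:R; 'i])
    (sqrtC p1%:R) (sqrtC (2 * p2)%:R) a b.
Proof.
move=> pr1 pr2 n12 m1 m2; set s := sqrtC p1%:R; set t := sqrtC (2 * p2)%:R.
have s2 : s ^+ 2 = p1%:R by apply: sqrtCK.
have t2 : t ^+ 2 = (2 * p2)%:R by apply: sqrtCK.
have [d12 d12'] := prime_ndvd_double pr1 pr2 n12 m1.
have [d21 d21'] : ~~ (p2 %| 2)%N /\ ~~ (p2 %| 2 * p1)%N by apply: prime_ndvd_double; rewrite // eq_sym.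
have d1 : ~~ (p1 %| 1)%N by rewrite dvdn1; apply: contraL pr1 => /eqP->.
have sQ := subfield_QI; have Qn (n : nat) : QI n%:R by apply: (sf_nat sQ).
have nst : ~ quad_ext QI t s.
  by apply: (@sqrt_prime_not_quad p1 1 (2 * p2)); rewrite ?mul1n ?muln1.
have nts : ~ quad_ext QI s t.
  by apply: (@sqrt_prime_not_quad p2 2 p1); rewrite // mulnC.
have St : subfield (quad_ext QI t) by apply: subfield_quad_ext; rewrite ?t2.
have Ss : subfield (quad_ext QI s) by apply: subfield_quad_ext; rewrite ?s2.
have [a [as_ at_ ai]] : exists nu : {rmorphism algC -> algC}, [/\ nu s = - s, nu t = t & nu 'i = 'i].
  apply: (exists_aut_neg St) => //; [exact: quad_ext_gen | | by rewrite s2 rpred_nat].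
  by apply: quad_ext_base; rewrite //; apply: QI_i.
have [b [bt bs bi]] : exists nu : {rmorphism algC -> algC}, [/\ nu t = - t, nu s = s & nu 'i = 'i].
  apply: (exists_aut_neg Ss) => //; [exact: quad_ext_gen | | by rewrite t2 rpred_nat].
  by apply: quad_ext_base; rewrite //; apply: QI_i.
exists a, b; split=> //; try exact: sqrtC_natr_real.
move=> x; rewrite mq_field_cons; apply: quad_ext_ext => y; exact: mq_field_cons.
Qed.

Section BiquadOverQuad.
Variables (p1 p2 : nat) (k K : nfield) (s t : algC) (a b : {rmorphism algC -> algC}).
Hypothesis H : biquad p1 p2 K s t a b.
Hypothesis kE : forall x, k x <-> quad_ext QI (s * t) x.
Let sK := bq_subfield H.

Lemma bq_quad_data : quad_data (p1 * p2) (s * t) k a.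
Proof.
split=> //; first by rewrite exprMn (bq_s2 H) (bq_t2 H) -natrM mulnCA.
- exact: bq_ai H.
- by rewrite rmorphM /= (bq_as H) (bq_at H) mulNr.
- by rewrite -modnMm (bq_mod1 H) (bq_mod2 H).
Qed.

Lemma bq_quad_sub x : k x -> K x.
Proof.
case/kE=> c [d [Qc Qd ->]]; have QK := bq_QI_K H.
by apply: sfD => //; [apply: QK | do !apply: sfM => //; [apply: bq_Ks H | apply: bq_Kt H | apply: QK]].
Qed.

(** The composite of a and b negates both s and t, so among the subfields quadratic over Q(i) it
    fixes the one generated by s t. *)
Lemma bq_quad_galois : quad_galois k K (a \o b).
Proof.
split=> /= [x Kx|x /kE[c [d [Qc Qd ->]]]|x Kx fx|x Kx].
- by apply: (bq_aK H); apply: (bq_bK H).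
- have fQ (f : {rmorphism algC -> algC}) : f 'i = 'i -> f c = c /\ f d = d.
    by move=> fi; split; apply: (bq_fix_QI fi).
  have [[ac ad] [bc bd]] := (fQ a (bq_ai H), fQ b (bq_bi H)).
  rewrite !(rmorphD, rmorphM) /= (bq_bs H) (bq_bt H) bc bd rmorphN /=.
  by rewrite (bq_as H) (bq_at H) ac ad mulrNN.
- by apply/kE; apply: bq_fix_ab H _ Kx fx.
- by rewrite -(bq_ab H) ?(bq_bb H) ?(bq_aa H) //; do !apply: (bq_bK H).
Qed.

Lemma bq_not_sq_class_i1 : ~ sq_class K (1 + 'i).
Proof. by move=> [al [u [Kal _ uu e]]]; apply: (bq_i1_not_square H Kal uu e). Qed.

End BiquadOverQuad.

(** Reciprocity is needed for the last exclusion only, which speaks of p2 modulo p1 instead of p1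
    modulo p2. *)
Lemma biprime_of_qnr (p1 p2 : nat) pi rho : gprime pi p1 -> gprime rho p2 -> p1 != p2 ->
    (p1 %% 4 = 1)%N -> (p2 %% 4 = 1)%N -> (2 <= qnr p1 p2 + qnr 2 p1 + qnr 2 p2)%N ->
  biprime p1 p2 pi rho.
Proof.
move=> hp hr n12 m1 m2 two; have [pr1 pr2] := (gp_prime hp, gp_prime hr).
have nres a p : prime p -> qnr a p -> ~ qres a p by apply: qnrP.
split=> // -[r r'].
- case: (boolP (qnr 2 p1)) two => [/(nres _ _ pr1)//|_].
  by case: (boolP (qnr 2 p2)) => [/(nres _ _ pr2)//|_]; case: qnr.
- case: (boolP (qnr p1 p2)) two => [/(nres _ _ pr2)//|_].
  by case: (boolP (qnr 2 p1)) => [/(nres _ _ pr1)//|_]; case: qnr.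
- have r'' := quad_reciprocity_1mod4 pr1 pr2 n12 m1 r.
  case: (boolP (qnr p1 p2)) two => [/(nres _ _ pr2)//|_].
  by case: (boolP (qnr 2 p2)) => [/(nres _ _ pr2)//|_]; case: qnr.
Qed.

(* The unit of norm -1 of Q(sqrt(2 p1 p2)) makes some (1 + i) pi' rho' a square up to a unit,
   and rho' is one by itself because sqrt p2 lies in K. *)
Lemma sq_class_i1_pi (K : nfield) (p1 p2 : nat) pi rho g h r : subfield K -> (forall z, QI z -> K z) ->
    biprime p1 p2 pi rho -> K g -> g ^+ 2 = (2 * p1 * p2)%:R ->
    K r -> r ^+ 2 = p2%:R -> K h -> h ^+ 2 = (2 * p1)%:R ->
  sq_class K ((1 + 'i) * pi) /\ sq_class K ((1 + 'i) * pi^*).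
Proof.
move=> sK QK B Kg g2 Kr r2 Kh h2; have [hp hr] := (bp_pi B, bp_rho B).
have KZ z : ZI z -> K z by move=> Zz; apply: QK; apply: ZI_QI.
have Kp := KZ _ (gp_ZI hp); have Kp' := KZ _ (ZI_conj (gp_ZI hp)).
have [p0 p'0] := (gprime_neq0 hp, gprime_neq0 (gprime_conj hp)).
have K1i : K (1 + 'i) by apply: KZ; apply: gp_ZI gprime_2.
have [pi' [rho' [Epi Erho S]]] := sq_class_biprime sK QK B Kg g2.
have Srho : sq_class K rho'.
  have [S1 S2] := sq_class_prime sK QK hr (bp_mod2 B) Kr r2.
  by case: Erho => ->.
have [Kr' r'0] : K rho' /\ rho' != 0.
  case: Erho => ->; split; rewrite ?(gprime_neq0 hr) ?(gprime_neq0 (gprime_conj hr)) //; apply: KZ.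
    exact: gp_ZI hr.
  exact: gp_ZI (gprime_conj hr).
have {}S : sq_class K ((1 + 'i) * pi') by apply: (sq_class_mulK sK Kr' r'0 Srho); rewrite -mulrA.
have Spp : sq_class K (((1 + 'i) * pi) * ((1 + 'i) * pi^*)).
  have -> : ((1 + 'i) * pi) * ((1 + 'i) * pi^*) = (1 + 'i) ^+ 2 * p1%:R by rewrite -(gp_norm hp); ring.
  apply: sq_classM => //; first by apply: sq_class_sqr => //; apply: i1_neq0.
  apply: (sq_class_mulK sK (d := 2%:R)); rewrite ?pnatr_eq0 //; first exact: sf_nat.
    exact: sq_class_twice_unit.
  rewrite -natrM mulnC -h2; apply: sq_class_sqr => //.
  have p1_gt0 := prime_gt0 (gp_prime hp).
  by rewrite -sqrf_eq0 h2 pnatr_eq0 -lt0n muln_gt0.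
have nn (q : algC) : q != 0 -> (1 + 'i) * q != 0 by move=> q0; apply: mulf_neq0 => //; exact: i1_neq0.
have Kn q : K q -> K ((1 + 'i) * q) by move=> Kq; apply: sfM.
case: Epi S => -> S; split=> //.
  by apply: (sq_class_mulK sK (Kn _ Kp) (nn _ p0) S); rewrite mulrC.
exact: (sq_class_mulK sK (Kn _ Kp') (nn _ p'0) S Spp).
Qed.

Theorem mainTheorem7 (p1 p2 : nat) (e f : int)
  (H0 H1 H2 : algC -> Prop) :
  prime p1 -> prime p2 -> p1 != p2 ->
  (p1 %% 4 = 1)%N -> (p2 %% 4 = 1)%N ->
  (2 <= qnr p1 p2 + qnr 2 p1 + qnr 2 p2)%N ->
  p1%:R = e%:~R ^+ 2 + (2 * f)%:~R ^+ 2 :> algC ->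
  let k := mq_field [:: sqrtC (2 * p1 * p2)%:R; 'i] in
  let K1 := mq_field [:: sqrtC p1%:R; sqrtC (2 * p2)%:R; 'i] in
  let K2 := mq_field [:: sqrtC p2%:R; sqrtC (2 * p1)%:R; 'i] in
  let pi1 : algC := e%:~R + 2%:R * 'i * f%:~R in
  let pi2 : algC := e%:~R - 2%:R * 'i * f%:~R in
  prime_ideal k H0 -> H0 (1 + 'i) ->
  prime_ideal k H1 -> H1 pi1 ->
  prime_ideal k H2 -> H2 pi2 ->
  [/\ exactly_four_capitulate k K1,
      exactly_four_capitulate k K2,
      (forall I, ideal k I ->
         (capitulates k K1 I <-> in_gen2 k H1 H2 I))
    & (forall I, ideal k I ->
         (capitulates k K2 I <->
            in_gen2 k (idealM H0 H1) (idealM H0 H2) I))].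
Proof.
move=> pr1 pr2 n12 m1 m2 two p1E k K1 K2 pi1 pi2 P0 H0i P1 H1pi P2 H2pi.
have Dpi2 : pi2 = pi1^*.
  by rewrite /pi1 rmorphD !rmorphM /= conjCi rmorph_nat !rmorph_int mulrN mulNr.
have hp : gprime pi1 p1.
  split=> //.
    exists e, (2 * f); rewrite /pi1 intrM; congr (_ + _); ring.
  rewrite -Dpi2 p1E intrM /pi1 /pi2.
  transitivity (e%:~R ^+ 2 - 4%:R * ('i * 'i) * f%:~R ^+ 2 : algC); first by ring.
  by rewrite mulii; ring.
(* A Gaussian prime above p2 is chosen arbitrarily; it disappears from the final description. *)
have [rho hr] := gprime_exists pr2 m2.
have B := biprime_of_qnr hp hr n12 m1 m2 two.
have [a1 [b1 Q1]] := biquad_exists pr1 pr2 n12 m1 m2; rewrite -/K1 in Q1.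
have [a2 [b2 Q2]] : exists a b, biquad p2 p1 K2 (sqrtC p2%:R) (sqrtC (2 * p1)%:R) a b.
  by apply: biquad_exists; rewrite // eq_sym.
have kE x : k x <-> quad_ext QI (sqrtC (2 * p1 * p2)%:R) x by apply: mq_field_cons.
have kE1 x : k x <-> quad_ext QI (sqrtC p1%:R * sqrtC (2 * p2)%:R) x.
  by rewrite -sqrtCM ?nnegrE ?ler0n // -natrM mulnCA mulnA.
have kE2 x : k x <-> quad_ext QI (sqrtC p2%:R * sqrtC (2 * p1)%:R) x.
  by rewrite -sqrtCM ?nnegrE ?ler0n // -natrM mulnC.
(* The automorphism a1 restricted to k serves for both extensions, so the ideals above 1 + i, pi1
   and pi2 are described once. *)
have H := bq_quad_data Q1 kE1.
set s := (_ * _) in kE1 H.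
have sr : s^* = s by rewrite rmorphM /= !sqrtC_natr_real.
have [E0 E1 E2] : [/\ H0 = ram_ideal k a1 (1 + 'i), H1 = ram_ideal k a1 pi1 & H2 = ram_ideal k a1 pi1^*].
  split; first exact: (ram_idealP H (ramified_i1 H)).
    exact: (ram_idealP H (ramified_pi B H)).
  by apply: (ram_idealP H (ramified_pi (biprime_conj1 B) H)); rewrite -?Dpi2.
have [sK1 sK2] := (bq_subfield Q1, bq_subfield Q2).
have [S1 S1'] := sq_class_prime sK1 (bq_QI_K Q1) hp m1 (bq_Ks Q1) (bq_s2 Q1).
have [four1 cap1] := capitulation_pi B H sr sK1 (bq_quad_sub Q1 kE1) (bq_quad_galois Q1 kE1)
  (bq_not_sq_class_i1 Q1) S1 S1'.
have s2 : s ^+ 2 = (2 * p1 * p2)%:R by rewrite (qd_s H) mulnA.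
have K2s : K2 s by apply: (bq_quad_sub Q2 kE2); apply: (qd_ks H).
have [S2 S2'] := sq_class_i1_pi sK2 (bq_QI_K Q2) B K2s s2 (bq_Ks Q2) (bq_s2 Q2) (bq_Kt Q2) (bq_t2 Q2).
have [four2 cap2] := capitulation_i1_pi B H sr sK2 (bq_quad_sub Q2 kE2) (bq_quad_galois Q2 kE2)
  (bq_not_sq_class_i1 Q2) S2 S2'.
by rewrite E0 E1 E2; split.
Qed.
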